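(* Let $(\vartheta_0,D)$ be one of the pairs $(0.729,2)$, $(0.616,6)$, $(0.554,8)$, $(0.515,12)$, and suppose some $\vartheta>\vartheta_0$ satisfies both conditions (A) and (B) below. Then there exists a positive even integer $d\le D+2$ such that $\lambda(p+d)=-1$ for infinitely many primes $p$.
   Context: $\Omega(n)$ is the number of prime factors of $n$ counted with multiplicity and $\lambda(n)=(-1)^{\Omega(n)}$. Condition (A): for every $\varepsilon>0$, $A>0$, $\sum_{q\le N^{\vartheta-\varepsilon}}\max_{a:(a,q)=1}\bigl|\sum_{p\le N,\,p\equiv a\ (\mathrm{mod}\ q)}\log p-\frac{N}{\varphi(q)}\bigr|\ll_{\varepsilon,A}\frac{N}{(\log N)^A}$ ($p$ over primes). Condition (B): for every $\varepsilon>0$, $A>0$, $\sum_{q\le N^{\vartheta-\varepsilon}}\max_{y\le N}\max_a\bigl|\sum_{n\le y,\,n\equiv a\ (\mathrm{mod}\ q)}\lambda(n)\bigr|\ll_{\varepsilon,A}\frac{N}{(\log N)^A}$. *)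

(* Defs.v *)
From Stdlib Require Import Reals ZArith.
From mathcomp Require Import all_boot.
Set Implicit Arguments.
Unset Strict Implicit.
Unset Printing Implicit Defensive.
Local Open Scope R_scope.

(* floor of a real number, as a nat (0 for negative arguments) *)
Definition fl (x : R) : nat := Z.to_nat (Int_part x).

Definition bigOmega (n : nat) : nat := \sum_(p <- primes n) logn p n.

Definition liouville (n : nat) : R := pow (-1) (bigOmega n).

(* sum_{p <= N, p prime, p = a (mod q)} log p   (a taken with 0 <= a < q) *)
Definition theta_ap (N : R) (q a : nat) : R :=
  \big[Rplus/0]_(p < (fl N).+1 | prime p && (p %% q == a)) ln (INR p).

(* sum_{1 <= n <= y, n = a (mod q)} lambda(n)   (a with 0 <= a < q) *)
Definition lambda_ap (y q a : nat) : R :=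
  \big[Rplus/0]_(1 <= n < y.+1 | n %% q == a) liouville n.

Definition condA (theta : R) : Prop :=
  forall eps A : R, (0 < eps) -> (0 < A) ->
  exists C N0 : R, forall N : R, (N0 <= N) ->
    (\big[Rplus/0]_(1 <= q < (fl (Rpower N (theta - eps))).+1)
       \big[Rmax/0]_(a < q | coprime a q)
          Rabs (theta_ap N q a - N / INR (totient q))
     <= C * (N / Rpower (ln N) A)).

Definition condB (theta : R) : Prop :=
  forall eps A : R, (0 < eps) -> (0 < A) ->
  exists C N0 : R, forall N : R, (N0 <= N) ->
    (\big[Rplus/0]_(1 <= q < (fl (Rpower N (theta - eps))).+1)
       \big[Rmax/0]_(y < (fl N).+1)
         \big[Rmax/0]_(a < q)
            Rabs (lambda_ap y q a)
     <= C * (N / Rpower (ln N) A)).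

(* Main.v *)
(* Suppose lambda(p + d) = 1 for all large primes p and all even d <= D + 2.
   Take the admissible tuple h_1 < ... < h_k = D and set H = D + 2.  For large n
   at most one n + h_i is prime, and if one is then lambda(n + H) = 1, so the
   number of primes among the n + h_i is at most (1 + lambda(n + H)) / 2.  Sum
   this against a Selberg weight (sum_{d | prod (n + h_i)} lambda_d)^2: condition
   (B) makes the lambda term negligible and condition (A) evaluates the prime
   terms, and the inequality becomes k J theta_0 <= (1 + o(1)) I, where I and J
   are the GPY integrals of the linear polynomial P(t) = 1 + beta t.  The choices
   beta = 2, 4, 6, 9 for k = 2, 3, 4, 5 violate it.

   Two devices keep the sieve elementary.  First, n is restricted to a residue
   class modulo the product W of the primes up to a large constant, and all sums
   over squarefree numbers are handled one prime at a time.  Second, the main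
   term of the sum of weights is only bounded above and that of the prime sum only
   below; since the weights are monotone, both are compared with iterated sums of
   f(u - log m) / m over m coprime to W, which act on polynomials like integration. *)
Require Import Defs.
From Stdlib Require Import FunctionalExtensionality Reals Classical.
From mathcomp Require Import all_boot all_order all_algebra.
From mathcomp Require Import Rstruct ring lra zify.
Set Implicit Arguments.
Unset Strict Implicit.
Unset Printing Implicit Defensive.
Import Order.TTheory GRing.Theory Num.Theory.

(** * Quadratic forms of the Selberg sieve *)

(** The sieve level K is tied to N by K ^ 2 = N ^ theta0, so log N = (2 / theta0) log K. This 2
    cancels the 1/2 in (1 + lambda) / 2, which is how k J theta0 comes to be compared with I. With
    the chosen beta, I / (k J) is about 0.7258, 0.6133, 0.5516 and 0.5126 for k = 2, 3, 4, 5, each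
    just below its theta0. The strict gap pays for cutting W off at a constant: in the sieve this
    cut-off is called [D] (only in the final theorem is [D] the largest shift), and it costs a
    factor 1 - 2 k ^ 2 / D. So [D] is fixed from the gap before K tends to infinity. The margin
    theta - theta0 absorbs W and the epsilon of (A) and (B). Once [D] is at least the largest shift,
    a prime p > D divides at most one n + h. The local densities are then exactly k / p for the
    weights and (k - 1) / (p - 1) for the primes, and both main terms carry the same power of phi(W)
    / W, which cancels. All error terms are O(N), against main terms larger by powers of log K. *)

Section SieveAlgebra.
Local Open Scope ring_scope.
Variable R : realFieldType.
Implicit Types (a b c : nat -> R) (ps : seq nat) (l F : bitseq -> R) (G Y : nat -> R).

(* A squarefree product d of primes of [ps] is represented by the mask [m] of its
   prime factors.  [pairsum] is the sum of l(d) l'(e) F(lcm(d, e)), and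
   [sqfsum a ps G] the sum of a(d) G(d) with [a] extended multiplicatively. *)
Fixpoint masksum n F : R :=
  if n is n'.+1 then
    masksum n' (fun m => F (false :: m)) + masksum n' (fun m => F (true :: m))
  else F [::].

Fixpoint pairsum n l l' F : R :=
  if n is n'.+1 then
    let l0 m := l (false :: m) in let l1 m := l (true :: m) in
    let l0' m := l' (false :: m) in let l1' m := l' (true :: m) in
    let F0 m := F (false :: m) in let F1 m := F (true :: m) in
    pairsum n' l0 l0' F0 + (pairsum n' l0 l1' F1 + pairsum n' l1 l0' F1
      + pairsum n' l1 l1' F1)
  else l [::] * l' [::] * F [::].

Definition maskwt a ps (m : bitseq) : R := \prod_(p <- mask m ps) a p.

Fixpoint sqfsum a ps G : R :=
  if ps is p :: ps' then
    sqfsum a ps' G + a p * sqfsum a ps' (fun n => G (p * n)%N)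
  else G 1%N.

(* lambda_d = mu(d) / g(d) * sum_{d | r} h(r) Y(r) with g(p) = k / p and
   h(p) = k / (p - k), unfolded one prime at a time. *)
Fixpoint selberg (k : R) ps Y (m : bitseq) : R :=
  match ps, m with
  | p :: ps', b :: m' =>
      let: Yp := fun n => Y (p * n)%N in
      if b then - (p%:R / (p%:R - k)) * selberg k ps' Yp m'
      else selberg k ps' Y m' + k / (p%:R - k) * selberg k ps' Yp m'
  | _, _ => Y 1%N
  end.

Lemma maskwt_false a p ps m : maskwt a (p :: ps) (false :: m) = maskwt a ps m.
Proof. by []. Qed.

Lemma maskwt_true a p ps m : maskwt a (p :: ps) (true :: m) = a p * maskwt a ps m.
Proof. by rewrite /maskwt /= big_cons. Qed.

Lemma pairsumC n l l' F : pairsum n l l' F = pairsum n l' l F.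
Proof.
elim: n l l' F => [|n IH] l l' F /=; first by rewrite [l _ * _]mulrC.
rewrite (IH (fun m => l (false :: m)) (fun m => l' (false :: m))).
rewrite (IH (fun m => l (false :: m)) (fun m => l' (true :: m))).
rewrite (IH (fun m => l (true :: m)) (fun m => l' (false :: m))).
by rewrite (IH (fun m => l (true :: m)) (fun m => l' (true :: m))); ring.
Qed.

Lemma pairsum_linl n l1 l2 l' F x :
  pairsum n (fun m => l1 m + x * l2 m) l' F
  = pairsum n l1 l' F + x * pairsum n l2 l' F.
Proof. elim: n l1 l2 l' F => [|n IH] l1 l2 l' F /=; [ring|rewrite !IH; ring]. Qed.

Lemma pairsum_linr n l l1 l2 F x :
  pairsum n l (fun m => l1 m + x * l2 m) F
  = pairsum n l l1 F + x * pairsum n l l2 F.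
Proof. by rewrite pairsumC pairsum_linl !(pairsumC n l). Qed.

Lemma pairsum_lin n l l' F1 F2 x :
  pairsum n l l' (fun m => F1 m + x * F2 m)
  = pairsum n l l' F1 + x * pairsum n l l' F2.
Proof. elim: n l l' F1 F2 => [|n IH] l l' F1 F2 /=; [ring|rewrite !IH; ring]. Qed.

Lemma pairsumZ n l l' F x :
  pairsum n l l' (fun m => x * F m) = x * pairsum n l l' F.
Proof. elim: n l l' F => [|n IH] l l' F /=; [ring|rewrite !IH; ring]. Qed.

Lemma pairsumZlr n l F x :
  pairsum n (fun m => x * l m) (fun m => x * l m) F = x ^+ 2 * pairsum n l l F.
Proof.
have E l' : pairsum n (fun m => x * l m) l' F = x * pairsum n l l' F.
  by elim: n l l' F => [|n IH] l l' F /=; [ring|rewrite !IH; ring].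
by rewrite E pairsumC E; ring.
Qed.

Lemma pairsum_sum n l l' (I : Type) (r : seq I) (P : pred I) (F : I -> bitseq -> R) :
  pairsum n l l' (fun m => \sum_(i <- r | P i) F i m)
  = \sum_(i <- r | P i) pairsum n l l' (F i).
Proof.
elim: n l l' F => [|n IH] l l' F /=; first by rewrite mulr_sumr.
by rewrite !IH -!big_split.
Qed.

(** For [a] with values 0 and 1, a(lcm(d, e)) = a(d) a(e), so the form factors. This turns the
    square that defines the sieve weight into a [pairsum]. *)
Lemma pairsum_square l a ps : {in ps, forall p, a p * a p = a p} ->
  pairsum (size ps) l l (maskwt a ps)
  = (masksum (size ps) (fun m => l m * maskwt a ps m)) ^+ 2.
Proof.
move=> idem.
suff E l' : pairsum (size ps) l l' (maskwt a ps)
  = masksum (size ps) (fun m => l m * maskwt a ps m)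
    * masksum (size ps) (fun m => l' m * maskwt a ps m) by rewrite E expr2.
elim: ps idem l l' => [|p ps IH] idem l l' /=.
  by rewrite /maskwt /= big_nil; ring.
have mZ x (F : bitseq -> R) n : masksum n (fun m => x * F m) = x * masksum n F.
  by elim: n F => [|n IHn] F //=; rewrite !IHn mulrDr.
have idem' : {in ps, forall p, a p * a p = a p}.
  by move=> q qs; apply: idem; rewrite inE qs orbT.
have E1 : (fun m => maskwt a (p :: ps) (true :: m)) = (fun m => a p * maskwt a ps m).
  by apply: functional_extensionality => m; exact: maskwt_true.
have E0 : (fun m => maskwt a (p :: ps) (false :: m)) = maskwt a ps.
  by apply: functional_extensionality.
rewrite E1 E0 !pairsumZ !(IH idem').
have E2 (g : bitseq -> R) : (fun m => g (true :: m) * maskwt a (p :: ps) (true :: m))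
    = (fun m => a p * (g (true :: m) * maskwt a ps m)).
  by apply: functional_extensionality => m; rewrite maskwt_true; ring.
rewrite (E2 l) (E2 l') !mZ.
have e := idem p (mem_head _ _).
rewrite mulrDl !mulrDr [a p * _ * (a p * _)]mulrACA e; ring.
Qed.

(** Completing the square at [p]: l0 ^ 2 + g (2 l0 l1 + l1 ^ 2) = (l0 + g l1) ^ 2 + (g - g ^ 2) l1 ^
    2. *)
Lemma pairsum_step n l p ps g :
  pairsum n.+1 l l (maskwt g (p :: ps))
  = pairsum n (fun m => l (false :: m) + g p * l (true :: m))
              (fun m => l (false :: m) + g p * l (true :: m)) (maskwt g ps)
    + (g p - g p ^+ 2)
      * pairsum n (fun m => l (true :: m)) (fun m => l (true :: m)) (maskwt g ps).
Proof.
rewrite /=.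
have E1 : (fun m => maskwt g (p :: ps) (true :: m)) = (fun m => g p * maskwt g ps m).
  by apply: functional_extensionality => m; exact: maskwt_true.
rewrite E1 !pairsumZ pairsum_linl !pairsum_linr.
rewrite (_ : (fun m => maskwt g (p :: ps) (false :: m)) = maskwt g ps); first by ring.
by apply: functional_extensionality.
Qed.

Lemma selberg_lin k ps Y1 Y2 x m :
  selberg k ps (fun n => Y1 n + x * Y2 n) m = selberg k ps Y1 m + x * selberg k ps Y2 m.
Proof.
elim: ps m Y1 Y2 => [|p ps IH] [|[] m] Y1 Y2 //=; rewrite !IH; ring.
Qed.

(* The substitution diagonalising both quadratic forms is carried out one
   prime at a time: a form in [l] splits along a prime [p] as the form in
   [l0 + g p l1] plus [g p - g p ^ 2] times the form in [l1]. *)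
Lemma selberg_diag k ps Y :
  {in ps, forall p, 0 < p%:R - k} -> 0 < k ->
  pairsum (size ps) (selberg k ps Y) (selberg k ps Y) (maskwt (fun p => k / p%:R) ps)
  = sqfsum (fun p => k / (p%:R - k)) ps (fun n => Y n ^+ 2).
Proof.
move=> hk k0; elim: ps hk Y => [|p ps IH] hk Y.
  by rewrite /= /maskwt big_nil; ring.
have pk := hk p (mem_head _ _).
have hk' : {in ps, forall q, 0 < q%:R - k} by move=> q qs; apply: hk; rewrite inE qs orbT.
rewrite [size _]/= pairsum_step [RHS]/= -(IH hk') -(IH hk' (fun n => Y (p * n)%N)).
(* The terms in Y (p * n) cancel because (k / p) (p / (p - k)) = k / (p - k). The second form below
   gets the coefficient (g - g ^ 2) (p / (p - k)) ^ 2 = k / (p - k). *)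
rewrite [X in pairsum _ X X _ + _](_ : _ = selberg k ps Y); last first.
  apply: functional_extensionality => m /=; field.
  by apply/andP; split; apply/eqP; lra.
rewrite [X in _ + _ * pairsum _ X X _](_ : _ =
  fun m => - (p%:R / (p%:R - k)) * selberg k ps (fun n => Y (p * n)%N) m) //.
rewrite pairsumZlr; congr (_ + _); rewrite mulrA; congr (_ * _); field.
by apply/andP; split; apply/eqP; lra.
Qed.

Definition antitone Y := (forall n, 0 <= Y n) /\ (forall p n, (0 < p)%N -> Y (p * n)%N <= Y n).

Lemma antitone_dilate Y p : antitone Y -> antitone (fun n => Y (p * n)%N).
Proof. by case=> Y0 Yd; split=> // q n q0; rewrite mulnCA; apply: Yd. Qed.

Lemma antitone_lin Y Y' x : 0 <= x -> antitone Y -> antitone Y' ->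
  antitone (fun n => Y n + x * Y' n).
Proof.
move=> x0 [Y0 Yd] [Y0' Yd']; split=> [n|p n p0]; first by rewrite addr_ge0 ?mulr_ge0.
by rewrite lerD ?ler_wpM2l ?Yd ?Yd'.
Qed.

Lemma antitone_sqr Y : antitone Y -> antitone (fun n => Y n ^+ 2).
Proof.
case=> Y0 Yd; split=> [n|p n p0]; first exact: sqr_ge0.
by rewrite ler_sqr ?nnegrE ?Y0 // Yd.
Qed.

Lemma sqfsum_lin a ps G1 G2 x :
  sqfsum a ps (fun n => G1 n + x * G2 n) = sqfsum a ps G1 + x * sqfsum a ps G2.
Proof. elim: ps G1 G2 => [|p ps IH] G1 G2 //=; rewrite !IH; ring. Qed.

Lemma sqfsumZ a ps G x : sqfsum a ps (fun n => x * G n) = x * sqfsum a ps G.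
Proof. elim: ps G => [|p ps IH] G //=; rewrite !IH; ring. Qed.

Lemma ler_sqfsum a b ps G1 G2 :
  {in ps, forall p, 0 <= a p <= b p} -> (forall n, 0 <= G1 n <= G2 n) ->
  0 <= sqfsum a ps G1 <= sqfsum b ps G2.
Proof.
elim: ps G1 G2 => [|p ps IH] G1 G2 //= hab hG.
have hab' : {in ps, forall p, 0 <= a p <= b p} by move=> q qs; apply: hab; rewrite inE qs orbT.
have /andP[a0 ab] := hab p (mem_head _ _).
have /andP[u0 u1] := IH _ _ hab' hG.
have /andP[v0 v1] := IH _ _ hab' (fun n => hG (p * n)%N).
by rewrite addr_ge0 ?mulr_ge0 //= lerD // ler_pM.
Qed.

Lemma sqfsum_ge0 a ps G : {in ps, forall p, 0 <= a p} -> (forall n, 0 <= G n) ->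
  0 <= sqfsum a ps G.
Proof.
move=> ha hG; have /andP[] // : 0 <= sqfsum a ps G <= sqfsum a ps G.
by apply: ler_sqfsum => [p /ha ->|n]; rewrite ?hG lexx.
Qed.

Lemma ler_sqfsumG a ps G1 G2 : {in ps, forall p, 0 <= a p} ->
  (forall n, G1 n <= G2 n) -> sqfsum a ps G1 <= sqfsum a ps G2.
Proof.
move=> ha hG; rewrite -subr_ge0.
have -> : sqfsum a ps G2 - sqfsum a ps G1 = sqfsum a ps (fun n => G2 n + (-1) * G1 n).
  by rewrite sqfsum_lin; ring.
by apply: sqfsum_ge0 => // n; rewrite mulN1r subr_ge0.
Qed.

(* Only a lower bound is needed, and monotonicity of [Y] removes the
   coprimality conditions, at no cost in the main term. *)
Lemma selberg_prime_ge k ps Y :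
  {in ps, forall p, 0 < p%:R - k} -> 1 < k -> antitone Y ->
  sqfsum (fun p => (k - 1) / (p%:R - k)) ps
    (fun r => sqfsum (fun p => (p%:R - 1)^-1) ps (fun m => Y (r * m)%N) ^+ 2)
  <= pairsum (size ps) (selberg k ps Y) (selberg k ps Y)
       (maskwt (fun p => (k - 1) / (p%:R - 1)) ps).
Proof.
move=> hk k1; elim: ps hk Y => [|p ps IH] hk Y aY.
  by rewrite /= /maskwt big_nil mulr1 muln1 expr2.
have pk := hk p (mem_head _ _).
have hk' : {in ps, forall q, 0 < q%:R - k} by move=> q qs; apply: hk; rewrite inE qs orbT.
set Yp := fun n => Y (p * n)%N.
have p1 : 0 < p%:R - 1 :> R by lra.
have aYp : antitone Yp by exact: antitone_dilate.
rewrite [size _]/= pairsum_step.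
(* Here k / (p - k) - (k - 1) p / ((p - 1) (p - k)) = 1 / (p - 1): the terms in Y (p * n) leave
   exactly one step of the inner sum over m. *)
rewrite [X in _ <= pairsum _ X X _ + _](_ : _ =
    selberg k ps (fun n => Y n + (p%:R - 1)^-1 * Yp n)); last first.
  apply: functional_extensionality => m /=; rewrite selberg_lin -/Yp; field.
  by apply/andP; split; apply/eqP; lra.
rewrite [X in _ <= _ + _ * pairsum _ X X _](_ : _ =
  fun m => - (p%:R / (p%:R - k)) * selberg k ps Yp m) // pairsumZlr.
set g := (k - 1) / (p%:R - 1).
have -> : forall z : R, (g - g ^+ 2) * ((- (p%:R / (p%:R - k))) ^+ 2 * z)
    = ((k - 1) / (p%:R - k)) * ((p%:R / (p%:R - 1)) ^+ 2 * z).
  by move=> z; rewrite /g; field; apply/andP; split; apply/eqP; lra.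
apply: le_trans (lerD (IH hk' _ (antitone_lin _ aY aYp)) _); last first.
- apply: ler_wpM2l; first by rewrite divr_ge0; lra.
  by apply: ler_wpM2l (IH hk' _ aYp); exact: sqr_ge0.
- by rewrite invr_ge0; lra.
have ha : {in ps, forall q, 0 <= (k - 1) / (q%:R - k)}.
  by move=> q /hk' q0; rewrite divr_ge0; lra.
have hb : {in ps, forall q, 0 <= (q%:R - 1)^-1 :> R}.
  by move=> q /hk' q0; rewrite invr_ge0; lra.
rewrite /=; apply: lerD.
  rewrite le_eqVlt; apply/orP; left; apply/eqP; congr sqfsum; apply: functional_extensionality => r.
  rewrite sqfsum_lin; congr ((_ + _ * sqfsum _ _ _) ^+ 2).
  by apply: functional_extensionality => m; rewrite /Yp mulnCA.
apply: ler_wpM2l; first by rewrite divr_ge0; lra.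
rewrite -sqfsumZ.
apply: ler_sqfsumG => // n; rewrite -exprMn.
have -> : sqfsum (fun p0 => (p0%:R - 1)^-1) ps (fun m => Y (p * n * m)%N)
   = sqfsum (fun p0 => (p0%:R - 1)^-1) ps (fun m => Yp (n * m)%N).
  by congr sqfsum; apply: functional_extensionality => m; rewrite /Yp mulnA.
(* [B] comes from letting [p] occur in m as well as in r. The factor p / (p - 1) = 1 + 1 / (p - 1)
   on the right pays for it, since [B <= A]. *)
set A := sqfsum _ _ _; set B := sqfsum _ _ _.
have : 0 <= B <= A.
  apply: ler_sqfsum => [q qs|m]; first by rewrite hb // lexx.
  rewrite aY.1 (_ : p * n * (p * m) = p * (p * (n * m)))%N; last by lia.
  by apply: aYp.2; rewrite -(ltr0n R); lra.
move=> /andP[B0 BA].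
have i0 : 0 <= (p%:R - 1)^-1 :> R by rewrite invr_ge0; lra.
rewrite ler_sqr ?nnegrE.
- rewrite (_ : p%:R / (p%:R - 1) * A = A + (p%:R - 1)^-1 * A).
    by rewrite lerD2l ler_wpM2l.
  by field; apply/eqP; lra.
- by rewrite addr_ge0 ?mulr_ge0 //; lra.
- by apply: mulr_ge0 (le_trans B0 BA); rewrite mulr_ge0 ?ler0n.
Qed.

Lemma sqfsum_conv a b p ps G :
  sqfsum a (p :: ps) (fun r => sqfsum b (p :: ps) (fun m => G (r * m)%N))
  = sqfsum a ps (fun r => sqfsum b ps (fun m => G (r * m)%N))
  + (a p + b p) * sqfsum a ps (fun r => sqfsum b ps (fun m => G (p * (r * m))%N))
  + a p * b p * sqfsum a ps (fun r => sqfsum b ps (fun m => G (p * (p * (r * m)))%N)).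
Proof.
rewrite /= !sqfsum_lin.
have -> : (fun n => sqfsum b ps (fun m => G (n * (p * m))%N))
  = (fun r => sqfsum b ps (fun m => G (p * (r * m))%N)).
  apply: functional_extensionality => r; congr sqfsum.
  by apply: functional_extensionality => m; rewrite mulnCA.
have -> : (fun n => sqfsum b ps (fun m => G (p * n * m)%N))
  = (fun r => sqfsum b ps (fun m => G (p * (r * m))%N)).
  apply: functional_extensionality => r; congr sqfsum.
  by apply: functional_extensionality => m; rewrite mulnA.
have -> : (fun n => sqfsum b ps (fun m => G (p * n * (p * m))%N))
  = (fun r => sqfsum b ps (fun m => G (p * (p * (r * m)))%N)).
  apply: functional_extensionality => r; congr sqfsum.
  by apply: functional_extensionality => m; congr G; lia.
ring.
Qed.

(** A prime dividing both variables contributes [G] at p * p, which monotonicity bounds by [G] at p;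
    then the comparison is one of Euler factors. *)
Lemma sqfsum_conv_le a b c ps G : antitone G ->
  {in ps, forall p, [/\ (0 < p)%N, 0 <= a p, 0 <= b p & (1 + a p) * (1 + b p) <= 1 + c p]} ->
  sqfsum a ps (fun r => sqfsum b ps (fun m => G (r * m)%N)) <= sqfsum c ps G.
Proof.
elim: ps G => [|p ps IH] G aG h; first by rewrite /= muln1.
rewrite sqfsum_conv.
have [p0 a0 b0 abc] := h p (mem_head _ _).
have h' : {in ps, forall p, [/\ (0 < p)%N, 0 <= a p, 0 <= b p & (1 + a p) * (1 + b p) <= 1 + c p]}.
  by move=> q qs; apply: h; rewrite inE qs orbT.
have ha : {in ps, forall p, 0 <= a p} by move=> q /h' [].
have hb : {in ps, forall p, 0 <= b p} by move=> q /h' [].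
have aGp := antitone_dilate p aG.
have := IH _ aG h'; have := IH _ aGp h'; rewrite /=.
set X0 := sqfsum a ps (fun r => sqfsum b ps (fun m => G (r * m)%N)).
set X1 := sqfsum a ps (fun r => sqfsum b ps (fun m => G (p * (r * m))%N)).
set X2 := sqfsum a ps (fun r => sqfsum b ps (fun m => G (p * (p * (r * m)))%N)).
set V0 := sqfsum c ps G; set V1 := sqfsum c ps (fun n => G (p * n)%N).
have /andP[X20 X21] : 0 <= X2 <= X1.
  apply: ler_sqfsum => [q qs|n]; first by rewrite ha ?lexx.
  apply: ler_sqfsum => [q qs|m]; first by rewrite hb ?lexx.
  by rewrite aG.1 /= aGp.2.
move=> h1 h2.
have ab0 : 0 <= a p * b p by exact: mulr_ge0.
have e1 : a p * b p * X2 <= a p * b p * X1 by exact: ler_wpM2l.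
have e2 : (a p + b p + a p * b p) * X1 <= c p * V1.
  by apply: ler_pM => //; lra.
lra.
Qed.

(** The terms in which a prime divides both variables are nonnegative and are dropped, which leaves
    the Euler factor 1 + a + b. *)
Lemma sqfsum_conv_ge a b c ps G : (forall n, 0 <= G n) ->
  {in ps, forall p, [/\ 0 <= a p, 0 <= b p, 0 <= c p & c p <= a p + b p]} ->
  sqfsum c ps G <= sqfsum a ps (fun r => sqfsum b ps (fun m => G (r * m)%N)).
Proof.
elim: ps G => [|p ps IH] G G0 h; first by rewrite /= muln1.
rewrite sqfsum_conv.
have [a0 b0 c0 abc] := h p (mem_head _ _).
have h' : {in ps, forall p, [/\ 0 <= a p, 0 <= b p, 0 <= c p & c p <= a p + b p]}.
  by move=> q qs; apply: h; rewrite inE qs orbT.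
have ha : {in ps, forall p, 0 <= a p} by move=> q /h' [].
have hb : {in ps, forall p, 0 <= b p} by move=> q /h' [].
have hc : {in ps, forall p, 0 <= c p} by move=> q /h' [].
have := IH _ G0 h'; have := IH (fun n => G (p * n)%N) (fun n => G0 _) h'; rewrite /=.
set X0 := sqfsum a ps (fun r => sqfsum b ps (fun m => G (r * m)%N)).
set X1 := sqfsum a ps (fun r => sqfsum b ps (fun m => G (p * (r * m))%N)).
set X2 := sqfsum a ps (fun r => sqfsum b ps (fun m => G (p * (p * (r * m)))%N)).
set V0 := sqfsum c ps G; set V1 := sqfsum c ps (fun n => G (p * n)%N).
have X20 : 0 <= X2 by apply: sqfsum_ge0 => // n; apply: sqfsum_ge0.
have V10 : 0 <= V1 by apply: sqfsum_ge0.
move=> h1 h2.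
have e1 : 0 <= a p * b p * X2 by rewrite !mulr_ge0.
have e2 : c p * V1 <= (a p + b p) * X1 by apply: ler_pM.
lra.
Qed.

Lemma sqfsum_const a ps x : sqfsum a ps (fun=> x) = x * \prod_(p <- ps) (1 + a p).
Proof.
elim: ps => [|p ps IH] /=; first by rewrite big_nil mulr1.
by rewrite IH big_cons; ring.
Qed.

End SieveAlgebra.

(** * Bounds for sums over squarefree and smooth numbers *)

Section SieveBounds.
Local Open Scope ring_scope.
Variable R : realFieldType.
Implicit Types (a b c : nat -> R) (ps : seq nat) (l F : bitseq -> R) (G Y : nat -> R).

Definition maskprod ps (m : bitseq) : nat := \prod_(p <- mask m ps) p.

(** The mask of lcm(d, e). *)
Definition mor (m m' : bitseq) : bitseq := [seq x.1 || x.2 | x <- zip m m'].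

Lemma maskprod_true p ps m : maskprod (p :: ps) (true :: m) = (p * maskprod ps m)%N.
Proof. by rewrite /maskprod /= big_cons. Qed.

Lemma masksumZ n F (x : R) : masksum n (fun m => x * F m) = x * masksum n F.
Proof. by elim: n F => [|n IH] F //=; rewrite !IH mulrDr. Qed.

Lemma masksumD n F1 F2 : masksum n (fun m => F1 m + F2 m) = masksum n F1 + masksum n F2.
Proof. by elim: n F1 F2 => [|n IH] F1 F2 //=; rewrite !IH addrACA. Qed.

Lemma ler_masksum n F1 F2 : (forall m, size m = n -> F1 m <= F2 m) ->
  masksum n F1 <= masksum n F2.
Proof.
elim: n F1 F2 => [|n IH] F1 F2 h /=; first exact: h.
by apply: lerD; apply: IH => m sm; apply: h; rewrite /= sm.
Qed.

Lemma masksum_sqfsum a ps G :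
  masksum (size ps) (fun m => maskwt a ps m * G (maskprod ps m)) = sqfsum a ps G.
Proof.
elim: ps G => [|p ps IH] G /=.
  by rewrite /maskwt /maskprod /= !big_nil mul1r.
rewrite -!IH; congr (_ + _); rewrite -masksumZ; congr masksum.
by apply: functional_extensionality => m; rewrite maskwt_true maskprod_true mulrA.
Qed.

Lemma maskwt_const (x : R) ps m : size m = size ps ->
  maskwt (fun=> x) ps m = x ^+ count id m.
Proof.
elim: ps m => [|p ps IH] [|[] m] //= => [_|[sm]|[sm]].
- by rewrite /maskwt /= big_nil.
- by rewrite maskwt_true IH // exprS.
- by rewrite maskwt_false IH.
Qed.

Lemma maskwtM a b ps m : maskwt (fun p => a p * b p) ps m = maskwt a ps m * maskwt b ps m.
Proof. exact: big_split. Qed.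

Lemma maskwt_natV ps m : maskwt (fun p => p%:R^-1 : R) ps m = (maskprod ps m)%:R^-1.
Proof.
elim: ps m => [|p ps IH] [|[] m].
- 1-4: by rewrite /maskwt /maskprod /= ?mask0 !big_nil invr1.
- by rewrite maskwt_true maskprod_true IH natrM invfM.
- by rewrite maskwt_false IH.
Qed.

(** A prime of lcm(d, e) divides only d, only e, or both, with weights 2 + 2 + 4 = 8. *)
Lemma pairsum_le n l l' F F' :
  (forall m m', size m = n -> size m' = n ->
    `|l m * l' m' * F (mor m m')| <= 2 ^+ count id m * 2 ^+ count id m' * F' (mor m m')) ->
  `|pairsum n l l' F| <= masksum n (fun m => 8 ^+ count id m * F' m).
Proof.
elim: n l l' F F' => [|n IH] l l' F F' h /=.
  by have := h [::] [::] erefl erefl; rewrite /= !expr0 !mul1r.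
have step (b b' : bool) :
  `|pairsum n (fun m => l (b :: m)) (fun m => l' (b' :: m)) (fun m => F (b || b' :: m))|
  <= 2 ^+ (b + b') * masksum n (fun m => 8 ^+ count id m * F' (b || b' :: m)).
  rewrite -masksumZ [X in _ <= masksum n X](_ : _ = (fun m =>
    8 ^+ count id m * (2 ^+ (b + b') * F' (b || b' :: m)))); last first.
    by apply: functional_extensionality => m; rewrite mulrCA.
  apply: IH => m m' sm sm'.
  have := h (b :: m) (b' :: m'); rewrite /= sm sm' => /(_ erefl erefl).
  by move/le_trans; apply; rewrite !exprD le_eqVlt; apply/orP; left; apply/eqP; ring.
have := step false false; have := step false true; have := step true false.
have := step true true.
rewrite (_ : (fun m => 8 ^+ (true + count id m) * F' (true :: m))
   = (fun m => 8 * (8 ^+ count id m * F' (true :: m)))); last first.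
  by apply: functional_extensionality => m /=; rewrite add1n exprS mulrA.
rewrite masksumZ /= !expr1 expr0 => h11 h10 h01 h00.
rewrite (_ : (fun m => 8 ^+ (false + count id m) * F' (false :: m))
   = (fun m => 8 ^+ count id m * F' (false :: m))) //.
apply: le_trans (ler_normD _ _) _.
have := ler_normD (pairsum n (fun m => l (false :: m)) (fun m => l' (true :: m)) (fun m => F (true :: m))
  + pairsum n (fun m => l (true :: m)) (fun m => l' (false :: m)) (fun m => F (true :: m)))
  (pairsum n (fun m => l (true :: m)) (fun m => l' (true :: m)) (fun m => F (true :: m))).
have := ler_normD (pairsum n (fun m => l (false :: m)) (fun m => l' (true :: m)) (fun m => F (true :: m)))
  (pairsum n (fun m => l (true :: m)) (fun m => l' (false :: m)) (fun m => F (true :: m))).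
lra.
Qed.

(** Each prime of the mask contributes p / (p - k) <= 2, as 2 k <= p. The other primes produce the
    terms of the sum, which is completed to all of [ps] by positivity. *)
Lemma selberg_le k ps Y m : 0 < k -> {in ps, forall p, 2 * k <= p%:R} ->
  (forall n, 0 <= Y n) -> size m = size ps ->
  `|selberg k ps Y m| <= 2 ^+ count id m *
     sqfsum (fun p => k / (p%:R - k)) ps (fun n => Y (maskprod ps m * n)%N).
Proof.
move=> k0; elim: ps m Y => [|p ps IH] [|b m] //= Y hk Y0 => [_|[sm]].
  by rewrite expr0 mul1r /maskprod /= big_nil muln1 ger0_norm.
have pk := hk p (mem_head _ _).
have hk' : {in ps, forall q, 2 * k <= q%:R} by move=> q qs; apply: hk; rewrite inE qs orbT.
have hh : {in ps, forall q, 0 <= k / (q%:R - k)}.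
  by move=> q /hk' q0; rewrite divr_ge0; lra.
have h0 : 0 <= k / (p%:R - k) by rewrite divr_ge0; lra.
case: b => /=.
  have {IH} := IH m (fun n => Y (p * n)%N) hk' (fun n => Y0 _) sm.
  rewrite maskprod_true.
  have -> : (fun n => Y (p * (maskprod ps m * n))%N) = (fun n => Y (p * maskprod ps m * n)%N).
    by apply: functional_extensionality => n; rewrite mulnA.
  set S := sqfsum _ _ _ => IH.
  have : 0 <= sqfsum (fun p0 => k / (p0%:R - k)) ps (fun n => Y (p * maskprod ps m * (p * n))%N).
    exact: sqfsum_ge0.
  set S' := sqfsum _ _ _ => S'0.
  rewrite add1n exprS normrM normrN.
  have -> : `|p%:R / (p%:R - k)| = p%:R / (p%:R - k) by rewrite ger0_norm // divr_ge0 //; lra.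
  have h2 : p%:R / (p%:R - k) <= 2 by rewrite ler_pdivrMr; lra.
  have h3 : 0 <= p%:R / (p%:R - k) by rewrite divr_ge0 //; lra.
  apply: (le_trans (ler_pM h3 (normr_ge0 _) h2 IH)).
  rewrite mulrA ler_wpM2l ?mulr_ge0 ?exprn_ge0 // lerDl; exact: mulr_ge0.
apply: (le_trans (ler_normD _ _)); rewrite add0n mulrDr; apply: lerD.
  exact: IH.
rewrite normrM ger0_norm // mulrCA ler_wpM2l //.
apply: (le_trans (IH m (fun n => Y (p * n)%N) hk' (fun n => Y0 _) sm)).
rewrite (_ : maskprod (p :: ps) (false :: m) = maskprod ps m) //.
rewrite (_ : (fun n => Y (p * (maskprod ps m * n))%N) = (fun n => Y (maskprod ps m * (p * n))%N)) //.
by apply: functional_extensionality => n; rewrite mulnCA.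
Qed.

(** Since [G] vanishes beyond [K], the cofactor m keeps the full range up to [K], so that all
    iterated sums share one range. *)
Lemma sum_multiples K p (P : pred nat) G : (0 < p)%N -> (forall n, (K < n)%N -> G n = 0) ->
  \sum_(1 <= n < K.+1 | P n && (p %| n)%N) G n
  = \sum_(1 <= m < K.+1 | P (p * m)%N) G (p * m)%N.
Proof.
move=> p0 GK.
transitivity (\sum_(1 <= n < K.+1) \sum_(1 <= m < K.+1 | P n && (n == p * m)%N) G n).
  rewrite big_mkcond /= !big_nat; apply: eq_bigr => n /andP[n1 nK].
  case: (P n) => /=; last by rewrite big_pred0.
  case: ifPn => [/dvdnP[m nE]|pn].
    rewrite (eq_bigl (fun j => j == m)) ?big_nat1_eq; last first.
      by move=> j; rewrite nE mulnC eqn_pmul2l // eq_sym.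
    by case: ifPn => //; rewrite {}nE in n1 nK *; nia.
  rewrite big_pred0 // => m; apply/negbTE; apply: contra pn => /eqP ->.
  exact: dvdn_mulr.
under eq_bigr do rewrite big_mkcond /=.
rewrite exchange_big_nat /= [RHS]big_mkcond /= !big_nat; apply: eq_bigr => m /andP[m1 mK].
rewrite -big_mkcond /=.
rewrite big_nat1_cond_eq; case: (P _); rewrite ?andbF ?andbT //.
by case: ifPn => // h; rewrite GK //; nia.
Qed.

Definition smooth ps (n : nat) : bool := all (mem ps) (primes n).

Definition smoothsum K ps G : R := \sum_(1 <= n < K.+1 | smooth ps n) G n / n%:R.

(** Split by p | n. In n = p m the cofactor may again be divisible by [p], so [p] stays in the list
    on the right, in contrast to [sqfsum]. *)
Lemma smoothsum_cons K p ps G : prime p -> p \notin ps -> (forall n, (K < n)%N -> G n = 0) ->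
  smoothsum K (p :: ps) G = smoothsum K ps G + p%:R^-1 * smoothsum K (p :: ps) (fun n => G (p * n)%N).
Proof.
move=> pp pps GK; rewrite /smoothsum (bigID (fun n => p %| n)%N) /= addrC; congr (_ + _).
  rewrite big_nat_cond [RHS]big_nat_cond; apply: eq_bigl => n.
  case: (ltnP 0 n) => //= n0; case: (n < K.+1)%N => //=.
  apply/andP/allP => [[/allP h pn] q qn|h].
    have := h q qn; rewrite !inE => /orP[/eqP qE|//].
    by move: qn; rewrite qE mem_primes (negPf pn) !andbF.
  split; first by apply/allP => q /h; rewrite !inE => ->; rewrite orbT.
  by apply: contra pps => pn; apply: h; rewrite mem_primes pp n0.
rewrite (@sum_multiples K p (smooth (p :: ps)) (fun n => G n / n%:R)) ?prime_gt0 //; last first.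
  by move=> n /GK ->; rewrite mul0r.
rewrite mulr_sumr big_nat_cond [RHS]big_nat_cond; apply: eq_big => [m|m _].
  case: (ltnP 0 m) => //= m0; case: (m < K.+1)%N => //=.
  apply/allP/allP => h q.
    by move=> qm; apply: h; rewrite primesM ?(prime_gt0 pp) ?m0 // qm orbT.
  rewrite primesM ?(prime_gt0 pp) ?m0 // => /orP[|/h //].
  by rewrite primes_prime // !inE => ->.
by rewrite natrM invfM; ring.
Qed.

Lemma smoothsum_nil K G : (0 < K)%N -> smoothsum K [::] G = G 1%N.
Proof.
move=> K0; rewrite /smoothsum big_nat_cond (eq_bigl (fun n => (1 <= n < K.+1)%N && (n == 1)%N)).
  by rewrite -big_nat_cond big_nat1_eq ifT ?invr1 ?mulr1 // ltnS.
move=> n; case: (1 <= n < K.+1)%N /andP => //= -[n1 _].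
apply/idP/eqP => [|->] //.
rewrite /smooth; case E : (primes n) => [|q s] //= _.
have : (primes n == [::]) by rewrite E.
by rewrite primes_eq0; lia.
Qed.

Lemma smoothsum_ge0 K ps G : (forall n, 0 <= G n) -> 0 <= smoothsum K ps G.
Proof. by move=> G0; apply: sumr_ge0 => n _; rewrite divr_ge0. Qed.

Lemma ler_smoothsum K ps G1 G2 : (forall n, G1 n <= G2 n) ->
  smoothsum K ps G1 <= smoothsum K ps G2.
Proof. by move=> h; apply: ler_sum => n _; rewrite ler_wpM2r // invr_ge0. Qed.

Lemma sqfsum_smoothsum_le K ps G : (0 < K)%N -> uniq ps -> {in ps, forall p, prime p} ->
  (forall n, 0 <= G n) -> (forall n, (K < n)%N -> G n = 0) ->
  sqfsum (fun p => p%:R^-1) ps G <= smoothsum K ps G.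
Proof.
move=> K0; elim: ps G => [|p ps IH] G /=; first by rewrite smoothsum_nil.
move=> /andP[pps ups] hp G0 GK.
have hp' : {in ps, forall p, prime p} by move=> q qs; apply: hp; rewrite inE qs orbT.
have pp := hp p (mem_head _ _).
have GpK n : (K < n)%N -> G (p * n)%N = 0.
  by move=> h; apply: GK; have := prime_gt0 pp; nia.
rewrite smoothsum_cons //; apply: lerD; first exact: IH.
apply: ler_wpM2l; first by rewrite invr_ge0.
apply: (le_trans (IH _ ups hp' _ GpK)) => //.
by rewrite smoothsum_cons // lerDl mulr_ge0 ?invr_ge0 ?smoothsum_ge0.
Qed.

(** The powers of [p] weigh 1 / p + 1 / p ^ 2 + ... = 1 / (p - 1), with [G] at p ^ j n bounded by
    [G] at p n. In finite form: A = C + B / p and B <= A give (1 - 1 / p) A <= C. *)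
Lemma smoothsum_sqfsum_le K ps G : (0 < K)%N -> uniq ps -> {in ps, forall p, prime p} ->
  antitone G -> (forall n, (K < n)%N -> G n = 0) ->
  smoothsum K ps G <= sqfsum (fun p => (p%:R - 1)^-1) ps G.
Proof.
move=> K0; elim: ps G => [|p ps IH] G /=; first by rewrite smoothsum_nil.
move=> /andP[pps ups] hp aG GK.
have hp' : {in ps, forall p, prime p} by move=> q qs; apply: hp; rewrite inE qs orbT.
have pp := hp p (mem_head _ _).
have GpK n : (K < n)%N -> G (p * n)%N = 0.
  by move=> h; apply: GK; have := prime_gt0 pp; nia.
have aGp := antitone_dilate p aG.
have h1 := IH _ ups hp' aG GK.
have h2 := IH _ ups hp' aGp GpK.
have p2 : 2 <= p%:R :> R by rewrite ler_nat prime_gt1.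
have h3 : smoothsum K (p :: ps) (fun n => G (p * (p * n))%N)
    <= smoothsum K (p :: ps) (fun n => G (p * n)%N).
  by apply: ler_smoothsum => n; apply: aGp.2; exact: prime_gt0.
have h4 := smoothsum_cons pp pps GpK.
rewrite smoothsum_cons //.
move: h1 h2 h3 h4.
set A := smoothsum K (p :: ps) (fun n => G (p * n)%N).
set B := smoothsum K (p :: ps) (fun n => G (p * (p * n))%N).
set C := smoothsum K ps (fun n => G (p * n)%N); set D := smoothsum K ps G.
set U := sqfsum _ _ _; set V := sqfsum _ _ _ => h1 h2 h3 h4.
apply: lerD => //.
have pV : 0 < p%:R^-1 :> R by rewrite invr_gt0; lra.
have pVe : p%:R^-1 * p%:R = 1 :> R by rewrite mulVf //; apply/eqP; lra.
rewrite ler_pdivlMl; last by lra.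
have h5 : p%:R^-1 * B <= p%:R^-1 * A by rewrite ler_wpM2l // ltW.
have -> : (p%:R - 1) * (p%:R^-1 * A) = A - p%:R^-1 * A by rewrite mulrBl mul1r mulrA [p%:R * _]mulrC pVe mul1r.
lra.
Qed.

End SieveBounds.

(** * Bounds for the two quadratic forms and for the sieve error *)

Section SieveMain.
Local Open Scope ring_scope.
Variable R : realFieldType.
Implicit Types (a b c : nat -> R) (ps : seq nat) (l F : bitseq -> R) (G Y : nat -> R).

(** For supported [G], the j-th iterate at 1 is the sum of tau_j(m) G(m) / m, where tau_j is the
    j-fold divisor function restricted to smooth numbers. *)
Definition dilsum K ps G (r : nat) : R := smoothsum K ps (fun m => G (r * m)%N).

Definition supported (K : nat) G := forall n, ~~ (0 < n <= K)%N -> G n = 0.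

Lemma supported_above K G n : supported K G -> (K < n)%N -> G n = 0.
Proof. by move=> GK nK; apply: GK; lia. Qed.

Lemma supported_mul K G r : supported K G -> forall n, (K < n)%N -> G (r * n)%N = 0.
Proof.
move=> GK n nK; have [->|r0] := posnP r; first by rewrite mul0n GK.
exact: supported_above GK (leq_trans nK (leq_pmull _ r0)).
Qed.

Lemma dilsum_ge0 K ps G : (forall n, 0 <= G n) -> forall r, 0 <= dilsum K ps G r.
Proof. by move=> G0 r; apply: smoothsum_ge0. Qed.

Lemma iter_dilsum_ge0 K ps G j r : (forall n, 0 <= G n) -> 0 <= iter j (dilsum K ps) G r.
Proof. by move=> G0; elim: j r => [|j IH] r //=; apply: dilsum_ge0. Qed.

Lemma supported_dilsum K ps G : supported K G -> supported K (dilsum K ps G).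
Proof.
move=> GK r rK; rewrite /dilsum /smoothsum big_nat_cond big1 // => n /andP[/andP[n1 _] _].
have [r0|r0] := posnP r; first by rewrite r0 mul0n GK // mul0r.
rewrite (supported_above GK) ?mul0r //.
by apply: leq_trans (leq_pmulr _ n1); move: rK; rewrite r0 ltnNge.
Qed.

Lemma antitone_dilsum K ps G : antitone G -> antitone (dilsum K ps G).
Proof.
case=> G0 Gd; split=> [r|p r p0]; first exact: dilsum_ge0.
by apply: ler_smoothsum => m; rewrite -mulnA Gd.
Qed.

(** As (j + 1) / p = j / p + 1 / p, each unit of weight splits off one summation over smooth
    numbers. *)
Lemma sqfsum_iter_le K ps j G : (0 < K)%N -> uniq ps -> {in ps, forall p, prime p} ->
  (forall n, 0 <= G n) -> supported K G ->
  sqfsum (fun p => j%:R / p%:R) ps G <= iter j (dilsum K ps) G 1%N.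
Proof.
move=> K0 ups hp; elim: j G => [|j IH] G G0 GK.
  have -> : (fun p : nat => 0%:R / p%:R : R) = (fun=> 0).
    by apply: functional_extensionality => p; rewrite mul0r.
  by elim: ps {ups hp} => [|p ps IHp] //=; rewrite mul0r addr0.
rewrite iterSr.
apply: le_trans (IH _ (dilsum_ge0 K ps G0) (supported_dilsum ps GK)).
apply: (le_trans (sqfsum_conv_ge (a := fun p => j%:R / p%:R) (b := fun p => p%:R^-1) G0 _)).
  move=> p _; rewrite !divr_ge0 // invr_ge0 ler0n; split=> //.
  by rewrite -natr1 mulrDl mul1r.
apply: ler_sqfsumG => [p _|r]; first by rewrite divr_ge0.
by apply: sqfsum_smoothsum_le => //; exact: supported_mul.
Qed.

(** The Euler factor 1 + j / (p - 1 - j) = (p - 1) / (p - 1 - j) absorbs a further factor 1 + 1 / (p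
    - 1) when j grows by one. For j = k - 1 the weight is (k - 1) / (p - k), the outer weight of the
    prime sum. *)
Lemma iter_sqfsum_le K ps j G : (0 < K)%N -> uniq ps -> {in ps, forall p, prime p} ->
  {in ps, forall p, (j.+1 < p)%N} -> antitone G -> supported K G ->
  iter j (dilsum K ps) G 1%N <= sqfsum (fun p => j%:R / (p%:R - 1 - j%:R)) ps G.
Proof.
move=> K0 ups hp; elim: j G => [|j IH] G hj aG GK.
  have -> : (fun p : nat => 0%:R / (p%:R - 1 - 0%:R) : R) = (fun=> 0).
    by apply: functional_extensionality => p; rewrite mul0r.
  by elim: ps {ups hp hj} => [|p ps IHp] //=; rewrite mul0r addr0.
have hj' : {in ps, forall p, (j.+1 < p)%N} by move=> p /hj; lia.
have hjR p : p \in ps -> j%:R + 2 < p%:R :> R.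
  by move=> /hj; rewrite -(ltr_nat R) -(natr1 j.+1) -natr1; lra.
rewrite iterSr.
apply: (le_trans (IH _ hj' (antitone_dilsum K ps aG) (supported_dilsum ps GK))).
apply: le_trans (sqfsum_conv_le (a := fun p => j%:R / (p%:R - 1 - j%:R))
  (b := fun p => (p%:R - 1)^-1) aG _).
  apply: ler_sqfsumG => [p /hjR h|r]; first by rewrite divr_ge0 //; lra.
  apply: smoothsum_sqfsum_le => //; last exact: supported_mul.
  case: aG => G0 Gd; split=> // p n p0; by rewrite mulnCA Gd.
move=> p hps; have h := hjR p hps; have j0 : 0 <= j%:R :> R by [].
split; [by have := hj p hps; lia | by rewrite divr_ge0 //; lra | by rewrite invr_ge0; lra |].
rewrite -natr1.
have -> : (1 + j%:R / (p%:R - 1 - j%:R)) * (1 + (p%:R - 1)^-1) = p%:R / (p%:R - 1 - j%:R) :> R.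
  by field; apply/andP; split; apply/eqP; lra.
have -> : 1 + (j%:R + 1) / (p%:R - 1 - (j%:R + 1)) = (p%:R - 1) / (p%:R - 1 - (j%:R + 1)) :> R.
  by field; apply/eqP; lra.
rewrite ler_pdivrMr; last by lra.
rewrite mulrAC ler_pdivlMr; last by lra.
nra.
Qed.

(** The price of replacing k / (p - k) = k / p + k ^ 2 / (p (p - k)) by k / p; over primes beyond a
    large constant it is close to 1. *)
Definition lossfactor (k : R) ps : R := \prod_(p <- ps) (1 + k ^+ 2 / (p%:R * (p%:R - k))).

Lemma sqfsum_main_le K ps (k : nat) G : (0 < K)%N -> uniq ps -> {in ps, forall p, prime p} ->
  {in ps, forall p, (k < p)%N} -> antitone G -> supported K G ->
  sqfsum (fun p => k%:R / (p%:R - k%:R)) ps G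
  <= lossfactor k%:R ps * iter k (dilsum K ps) G 1%N.
Proof.
move=> K0 ups hp hk aG GK.
have hkR p : p \in ps -> k%:R < p%:R :> R by move=> /hk; rewrite ltr_nat.
have k0 : 0 <= k%:R :> R by [].
apply: (le_trans (sqfsum_conv_ge (a := fun p => k%:R ^+ 2 / (p%:R * (p%:R - k%:R)))
  (b := fun p => k%:R / p%:R) aG.1 _)).
  move=> p /hkR h; split.
  - by rewrite divr_ge0 ?exprn_ge0 ?mulr_ge0 //; lra.
  - by rewrite divr_ge0.
  - by rewrite divr_ge0 //; lra.
  rewrite le_eqVlt; apply/orP; left; apply/eqP; field.
  by apply/andP; split; apply/eqP; lra.
have hb p : p \in ps -> 0 <= k%:R ^+ 2 / (p%:R * (p%:R - k%:R)) :> R.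
  by move=> /hkR h; rewrite divr_ge0 ?exprn_ge0 ?mulr_ge0 //; lra.
set A := iter k _ _ _.
(* By monotonicity the variable that carries the excess weights is dropped from the argument of [G];
   its sum is then the full product. *)
apply: (le_trans (y := sqfsum (fun p => k%:R ^+ 2 / (p%:R * (p%:R - k%:R))) ps (fun=> A))); last first.
  by rewrite sqfsum_const mulrC.
apply: ler_sqfsumG => // r.
have [->|r0] := posnP r.
  have -> : (fun m => G (0 * m)%N) = (fun=> 0 * 1).
    by apply: functional_extensionality => m; rewrite mul0n GK // mul0r.
  by rewrite sqfsumZ mul0r; apply: iter_dilsum_ge0 aG.1.
apply: le_trans (sqfsum_iter_le _ K0 ups hp aG.1 GK).
apply: ler_sqfsumG => [p _|m]; first by rewrite divr_ge0.
exact: aG.2.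
Qed.

Lemma selberg_upper K ps (k : nat) Y : (0 < K)%N -> uniq ps -> {in ps, forall p, prime p} ->
  (0 < k)%N -> {in ps, forall p, (k < p)%N} -> antitone Y -> supported K Y ->
  pairsum (size ps) (selberg k%:R ps Y) (selberg k%:R ps Y) (maskwt (fun p => k%:R / p%:R) ps)
  <= lossfactor k%:R ps * iter k (dilsum K ps) (fun n => Y n ^+ 2) 1%N.
Proof.
move=> K0 ups hp k0 hk aY YK; rewrite selberg_diag ?ltr0n //; last first.
  by move=> p /hk; rewrite subr_gt0 ltr_nat.
apply: sqfsum_main_le => //; first exact: antitone_sqr.
by move=> n /YK ->; rewrite expr0n.
Qed.

(** Here the tuple has [k.+1] elements: one shift carries the prime, and the other [k] occupy a
    proportion k / (p - 1) of the residues left to it modulo p. *)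
Lemma selberg_lower K ps (k : nat) Y : (0 < K)%N -> uniq ps -> {in ps, forall p, prime p} ->
  (0 < k)%N -> {in ps, forall p, (k.+1 < p)%N} -> antitone Y -> supported K Y ->
  iter k (dilsum K ps) (fun n => dilsum K ps Y n ^+ 2) 1%N
  <= pairsum (size ps) (selberg k.+1%:R ps Y) (selberg k.+1%:R ps Y)
       (maskwt (fun p => k%:R / (p%:R - 1)) ps).
Proof.
move=> K0 ups hp k0 hk aY YK.
have hkR p : p \in ps -> k%:R + 1 < p%:R :> R by move=> /hk; rewrite -(ltr_nat R) -natr1.
have k1 : 1 <= k%:R :> R by rewrite ler1n.
have := @selberg_prime_ge R k.+1%:R ps Y _ _ aY; rewrite -natr1 addrK => h.
apply: le_trans (h _ _); last by lra.
  have -> : (fun p => k%:R / (p%:R - (k%:R + 1))) = (fun p : nat => k%:R / (p%:R - 1 - k%:R) : R).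
    by apply: functional_extensionality => p; congr (_ / _); ring.
  have aD := antitone_dilsum K ps aY.
  apply: (le_trans (iter_sqfsum_le K0 ups hp hk (antitone_sqr aD) _)).
    by move=> n /(supported_dilsum ps YK) ->; rewrite expr0n.
  apply: ler_sqfsumG => [p /hkR hp'|r]; first by rewrite divr_ge0 //; lra.
  have i0 p : p \in ps -> 0 <= (p%:R - 1)^-1 :> R by move=> /hkR hp'; rewrite invr_ge0; lra.
  rewrite ler_sqr ?nnegrE ?aD.1 //; last by apply: sqfsum_ge0 => // m; exact: aY.1.
  apply: smoothsum_sqfsum_le => //; last exact: supported_mul.
  by case: aY => Y0 Yd; split=> // p n p0; rewrite mulnCA Yd.
by move=> p /hkR h'; lra.
Qed.

Definition harmonic (X : nat) : R := \sum_(1 <= n < X.+1) n%:R^-1.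

(** For squarefree d, B ^ omega(d) counts the ordered factorisations of d into [B] factors, each at
    most [X] when d is. *)
Lemma mask_harmonic_le ps X B : (0 < X)%N -> uniq ps -> {in ps, forall p, prime p} ->
  masksum (size ps) (fun m => (maskprod ps m <= X)%:R * (B%:R ^+ count id m / (maskprod ps m)%:R))
  <= harmonic X ^+ B.
Proof.
move=> X0 ups hp.
pose G n : R := (0 < n <= X)%:R.
have GX : supported X G by move=> n /negbTE h; rewrite /G h.
apply: (le_trans (y := sqfsum (fun p => B%:R / p%:R) ps G)).
  rewrite -masksum_sqfsum; apply: ler_masksum => m sm.
  rewrite (maskwtM (fun=> B%:R)) maskwt_const // maskwt_natV mulrC /G.
  rewrite (_ : (0 < maskprod ps m)%N) //.
  rewrite /maskprod big_seq; elim/big_ind: _ => // [x y|p]; first by rewrite muln_gt0 => -> ->.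
  by move=> /mem_mask /hp /prime_gt0.
have G0 n : 0 <= G n by rewrite /G.
apply: (le_trans (sqfsum_iter_le B X0 ups hp G0 GX)).
have h r : 0 <= iter B (dilsum X ps) G r <= harmonic X ^+ B; last by case/andP: (h 1%N).
elim: B r => [|B IH] r.
  by rewrite /= /G expr0; case: (0 < r <= X)%N; rewrite ?lexx ?ler01.
rewrite dilsum_ge0 /=; last by move=> n; case/andP: (IH n).
rewrite exprS /dilsum /smoothsum /harmonic mulr_suml big_mkcond /=.
apply: ler_sum => n _; have /andP[h0 h1] := IH (r * n)%N.
case: ifP => _; last by apply: mulr_ge0 (le_trans h0 h1); rewrite invr_ge0.
by rewrite mulrC ler_wpM2l ?invr_ge0.
Qed.

(** Distinct masks have distinct products. The weight 1 / p, cancelled by the factor n in [G'], lets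
    the comparison with smooth numbers express this. *)
Lemma mask_sum_le ps X G : (0 < X)%N -> uniq ps -> {in ps, forall p, prime p} ->
  (forall n, 0 <= G n) ->
  masksum (size ps) (fun m => (maskprod ps m <= X)%:R * G (maskprod ps m))
  <= \sum_(1 <= n < X.+1) G n.
Proof.
move=> X0 ups hp G0.
pose G' n : R := (n <= X)%:R * n%:R * G n.
have E : masksum (size ps) (fun m => (maskprod ps m <= X)%:R * G (maskprod ps m))
   = sqfsum (fun p => p%:R^-1) ps G'.
  rewrite -masksum_sqfsum; congr masksum; apply: functional_extensionality => m.
  rewrite maskwt_natV /G'.
  have : (0 < maskprod ps m)%N.
    rewrite /maskprod big_seq; elim/big_ind: _ => // [x y|p]; first by rewrite muln_gt0 => -> ->.
    by move=> /mem_mask /hp /prime_gt0.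
  rewrite -(ltr0n R) => d0; field; exact: lt0r_neq0.
rewrite {}E; apply: (le_trans (sqfsum_smoothsum_le X0 ups hp _ _)).
- by move=> n; rewrite !mulr_ge0.
- by move=> n nX; rewrite /G' leqNgt nX !mul0r.
rewrite /smoothsum big_mkcond /= !big_nat; apply: ler_sum => n /andP[n1 nX].
rewrite /G' -ltnS nX mul1r; case: ifP => // _.
rewrite mulrAC divff ?mul1r //; by rewrite pnatr_eq0 -lt0n.
Qed.

(* [b <= T + b ^ 2 / T] trades the weights [B ^ omega] against the trivial
   bound for [e]. *)
Lemma mask_error_le ps X (B : nat) (e : nat -> R) (T V : R) :
  (0 < X)%N -> uniq ps -> {in ps, forall p, prime p} -> (forall n, 0 <= e n) -> 0 < T -> 0 <= V ->
  (forall m, size m = size ps -> (maskprod ps m <= X)%N ->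
     e (maskprod ps m) <= V * 2 ^+ count id m / (maskprod ps m)%:R) ->
  masksum (size ps) (fun m => (maskprod ps m <= X)%:R * (B%:R ^+ count id m * e (maskprod ps m)))
  <= T * \sum_(1 <= n < X.+1) e n + V / T * harmonic X ^+ (2 * B ^ 2).
Proof.
move=> X0 ups hp e0 T0 V0 he.
apply: le_trans (lerD (ler_wpM2l (ltW T0) (mask_sum_le X0 ups hp e0))
  (ler_wpM2l _ (mask_harmonic_le (2 * B ^ 2) X0 ups hp))); last by rewrite divr_ge0 // ltW.
rewrite -!masksumZ -masksumD; apply: ler_masksum => m sm.
case: leqP => [dX|_]; last by rewrite !mul0r !mulr0 addr0.
rewrite !mul1r natrM exprMn natrX -exprM.
set d := maskprod ps m in he dX *; set n := count id m.
have eV := he m sm dX; rewrite -/d -/n in eV.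
set b : R := B%:R ^+ n.
have -> : B%:R ^+ (2 * n) = b ^+ 2 :> R by rewrite /b -exprM mulnC.
have b0 : 0 <= b by rewrite exprn_ge0.
have h1 : b * e d <= T * e d + b ^+ 2 / T * e d.
  rewrite -mulrDl ler_wpM2r //.
  have -> : T + b ^+ 2 / T = (T ^+ 2 + b ^+ 2) / T by field; exact: lt0r_neq0.
  rewrite ler_pdivlMr //; nra.
apply: (le_trans h1); rewrite lerD2l.
have h2 : b ^+ 2 / T * e d <= b ^+ 2 / T * (V * 2 ^+ n / d%:R).
  by rewrite ler_wpM2l // divr_ge0 ?exprn_ge0 // ltW.
apply: (le_trans h2); rewrite le_eqVlt; apply/orP; left; apply/eqP.
by rewrite !mulrA; ring.
Qed.

Lemma maskprod_mor ps m m' : {in ps, forall p, (0 < p)%N} ->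
  size m = size ps -> size m' = size ps ->
  (maskprod ps (mor m m') <= maskprod ps m * maskprod ps m')%N.
Proof.
elim: ps m m' => [|p ps IH] [|b m] [|b' m'] //= hp => [_ _|[sm] [sm']].
  by rewrite /maskprod big_nil.
have hp' : {in ps, forall p, (0 < p)%N} by move=> q qs; apply: hp; rewrite inE qs orbT.
have p0 := hp p (mem_head _ _).
have := IH m m' hp' sm sm'; rewrite -[mor (_ :: _) _]/(b || b' :: mor m m').
have Ef u : maskprod (p :: ps) (false :: u) = maskprod ps u by [].
by case: b; case: b' => /=; rewrite ?maskprod_true ?Ef; nia.
Qed.

(** The coefficient lambda_d vanishes for d > K, so only moduli up to K ^ 2 occur. Otherwise it is
    at most [S] times 2 ^ omega(d), and [pairsum_le] turns these powers into 8 ^ omega of the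
    lcm. *)
Lemma selberg_error_le K ps (k : nat) Y F (S : R) : uniq ps -> {in ps, forall p, prime p} ->
  (0 < k)%N -> {in ps, forall p, (2 * k <= p)%N} -> antitone Y -> supported K Y ->
  sqfsum (fun p => k%:R / (p%:R - k%:R)) ps Y <= S ->
  `|pairsum (size ps) (selberg k%:R ps Y) (selberg k%:R ps Y) F|
  <= S ^+ 2 * masksum (size ps) (fun m => (maskprod ps m <= K ^ 2)%:R * (8 ^+ count id m * `|F m|)).
Proof.
move=> ups hp k0 hk aY YK hS.
have hkR : {in ps, forall p, 2 * k%:R <= p%:R :> R}.
  by move=> p /hk; rewrite -(ler_nat R) natrM.
have kR : 0 < k%:R :> R by rewrite ltr0n.
have S0 : 0 <= S.
  apply: le_trans hS; apply: sqfsum_ge0 aY.1 => p /hkR h; by rewrite divr_ge0; lra.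
have hl m : size m = size ps ->
    `|selberg k%:R ps Y m| <= 2 ^+ count id m * ((maskprod ps m <= K)%:R * S).
  move=> sm; apply: (le_trans (selberg_le kR hkR aY.1 sm)).
  apply: ler_wpM2l; first exact: exprn_ge0.
  case: leqP => dK /=.
    rewrite mul1r; apply: le_trans hS; apply: ler_sqfsumG => [p /hkR h|n].
      by rewrite divr_ge0; lra.
    apply: aY.2; rewrite /maskprod big_seq.
    elim/big_ind: _ => // [x y|p]; first by rewrite muln_gt0 => -> ->.
    by move=> /mem_mask /hp /prime_gt0.
  rewrite mul0r.
  have -> : (fun n => Y (maskprod ps m * n)%N) = (fun=> 0 * 1).
    apply: functional_extensionality => n; rewrite mul0r mulnC.
    exact: (supported_mul n YK dK).
  by rewrite sqfsumZ mul0r.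
have -> : S ^+ 2 * masksum (size ps) (fun m =>
    (maskprod ps m <= K ^ 2)%:R * (8 ^+ count id m * `|F m|))
  = masksum (size ps) (fun m => 8 ^+ count id m *
    ((maskprod ps m <= K ^ 2)%:R * S ^+ 2 * `|F m|)).
  rewrite -masksumZ; congr masksum; apply: functional_extensionality => m; ring.
apply: pairsum_le => m m' sm sm'; rewrite !normrM !mulrA ler_wpM2r //.
have hp0 : {in ps, forall p, (0 < p)%N} by move=> p /hp /prime_gt0.
have := maskprod_mor hp0 sm sm'; have := hl m sm; have := hl m' sm'.
case: (leqP (maskprod ps m)) => dK; case: (leqP (maskprod ps m')) => dK';
  rewrite ?mul1r ?mul0r ?mulr0.
- move=> h1 h2 h3; rewrite (_ : (maskprod ps (mor m m') <= K ^ 2)%N); last first.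
    by apply: (leq_trans h3); rewrite expnS expn1 leq_mul.
  apply: (le_trans (ler_pM (normr_ge0 _) (normr_ge0 _) h2 h1)).
  by rewrite mulr1 mulrACA !mulrA.
- 1-3: rewrite !normr_le0 => h1 h2 _.
- by rewrite (eqP h1) normr0 mulr0 !mulr_ge0 ?exprn_ge0.
- by rewrite (eqP h2) normr0 mul0r !mulr_ge0 ?exprn_ge0.
- by rewrite (eqP h2) normr0 mul0r !mulr_ge0 ?exprn_ge0.
Qed.

End SieveMain.

(** * Sums of powers of logarithms *)

Bind Scope ring_scope with R.
Arguments ln (_)%_ring_scope.

Section LogSums.
Local Open Scope ring_scope.
Implicit Types (x y u : R) (f g : R -> R) (P : pred nat) (zs : seq nat).

Lemma lnM x y : 0 < x -> 0 < y -> ln (x * y) = ln x + ln y.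
Proof. by move=> /RltP x0 /RltP y0; exact: ln_mult. Qed.

Lemma ler_ln x y : 0 < x -> x <= y -> ln x <= ln y.
Proof.
move=> x0; rewrite le_eqVlt => /orP[/eqP ->//|xy].
by apply/ltW/RltP/ln_increasing; apply/RltP.
Qed.

Lemma ltr_ln x y : 0 < x -> x < y -> ln x < ln y.
Proof. by move=> /RltP x0 /RltP xy; apply/RltP/ln_increasing. Qed.

Lemma ln_sub1 x : 0 < x -> ln x <= x - 1.
Proof.
move=> x0; have := exp_ineq1_le (ln x); rewrite exp_ln; last exact/RltP.
move=> /RleP h; have : 1 + ln x <= x by exact: h.
lra.
Qed.

Lemma ln1 : ln 1 = 0 :> R. Proof. exact: ln_1. Qed.

Lemma lnV x : 0 < x -> ln x^-1 = - ln x.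
Proof. by move=> /RltP x0; rewrite -RinvE ln_Rinv. Qed.

Lemma ln_succ m : (0 < m)%N ->
  m.+1%:R^-1 <= ln m.+1%:R - ln m%:R :> R /\ ln m.+1%:R - ln m%:R <= m%:R^-1 :> R.
Proof.
move=> m0; have m1 : 0 < m%:R :> R by rewrite ltr0n.
have m2 : 0 < m.+1%:R :> R by rewrite ltr0n.
have e : m.+1%:R = m%:R + 1 :> R by rewrite natr1.
split.
  have := @ln_sub1 (m%:R / m.+1%:R); rewrite divr_gt0 // => /(_ isT).
  rewrite lnM ?invr_gt0 // lnV //.
  have -> : m%:R / m.+1%:R - 1 = - m.+1%:R^-1 :> R by rewrite e; field; rewrite -e; exact: lt0r_neq0.
  by move: (ln m.+1%:R) (ln m%:R) m.+1%:R^-1 => a b i; lra.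
have := @ln_sub1 (m.+1%:R / m%:R); rewrite divr_gt0 // => /(_ isT).
rewrite lnM ?invr_gt0 // lnV //.
by have -> : m.+1%:R / m%:R - 1 = m%:R^-1 :> R by rewrite e; field; exact: lt0r_neq0.
Qed.

Lemma ln_nat_ge0 m : 0 <= ln m%:R :> R.
Proof.
case: m => [|m]; last by rewrite -ln1 ler_ln // ler1n.
(* At 0 the logarithm takes its default value 0. *)
by rewrite /ln; case: Rlt_dec => // h; have := Rlt_irrefl _ h.
Qed.

(** Normalised so that integration takes j to j + 1, and cut off at u < 0 so that a sum over m stops
    by itself at log m = u. In particular [logmon 0] is the indicator of u >= 0. *)
Definition logmon (j : nat) u : R := if 0 <= u then u ^+ j / (j`!)%:R else 0.

Lemma logmon_ge0 j u : 0 <= logmon j u.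
Proof. by rewrite /logmon; case: ifP => // u0; rewrite divr_ge0 ?exprn_ge0. Qed.

Lemma logmon_neg j u : u < 0 -> logmon j u = 0.
Proof. by rewrite /logmon leNgt => ->. Qed.

Lemma fact_gt0R j : 0 < (j`!)%:R :> R. Proof. by rewrite ltr0n fact_gt0. Qed.

Lemma factSR j : (j.+1`!)%:R = (j%:R + 1) * (j`!)%:R :> R.
Proof. by rewrite factS natrM natr1. Qed.

(** The mean value inequality for [logmon j.+1], whose derivative is [logmon j], in algebraic form
    and across the cut at 0. *)
Lemma logmon_step j x y : y <= x ->
  (x - y) * logmon j y <= logmon j.+1 x - logmon j.+1 y <= (x - y) * logmon j x.
Proof.
move=> yx; rewrite /logmon.
have j0 : 0 <= j%:R :> R by [].
have F0 := fact_gt0R j.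
case: (leP 0 y) => y0; last first.
  rewrite mulr0; case: (leP 0 x) => x0; last by rewrite mulr0 subr0 lexx.
  rewrite subr0 divr_ge0 ?exprn_ge0 //= factSR exprS.
  rewrite ler_pdivrMr ?mulr_gt0 //; last by lra.
  have -> : (x - y) * (x ^+ j / (j`!)%:R) * ((j%:R + 1) * (j`!)%:R) = (x - y) * (j%:R + 1) * x ^+ j.
    by field; exact: lt0r_neq0.
  rewrite ler_wpM2r ?exprn_ge0 //; nra.
have x0 : 0 <= x by exact: le_trans yx.
rewrite x0.
have key n : (n.+1)%:R * (x - y) * y ^+ n <= x ^+ n.+1 - y ^+ n.+1 <= (n.+1)%:R * (x - y) * x ^+ n.
  elim: n => [|n /andP[IH1 IH2]]; first by rewrite !expr1 !expr0 !mulr1 mul1r lexx.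
  have e : x ^+ n.+2 - y ^+ n.+2 = x * (x ^+ n.+1 - y ^+ n.+1) + (x - y) * y ^+ n.+1.
    by rewrite (exprS x n.+1) (exprS y n.+1); ring.
  have yn : y ^+ n <= x ^+ n by apply: lerXn2r; rewrite ?nnegrE.
  have yn1 : y ^+ n.+1 <= x ^+ n.+1 by apply: lerXn2r; rewrite ?nnegrE.
  have yn0 : 0 <= y ^+ n by exact: exprn_ge0.
  have d0 : 0 <= x - y by lra.
  have n0 : 0 <= n.+1%:R :> R by [].
  rewrite e -(natr1 n.+1); apply/andP; split.
    have h1 : y * (n.+1%:R * (x - y) * y ^+ n) <= x * (x ^+ n.+1 - y ^+ n.+1).
      by apply: ler_pM => //; rewrite !mulr_ge0.
    by move: h1; rewrite (exprS y n); lra.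
  have h1 : x * (x ^+ n.+1 - y ^+ n.+1) <= x * (n.+1%:R * (x - y) * x ^+ n) by apply: ler_wpM2l.
  have h2 : (x - y) * y ^+ n.+1 <= (x - y) * x ^+ n.+1 by apply: ler_wpM2l.
  by move: h1; rewrite [x ^+ n.+1 in X in _ -> _ <= X]exprS (exprS x n) in h2 *; lra.
have /andP[k1 k2] := key j.
have -> : x ^+ j.+1 / (j.+1`!)%:R - y ^+ j.+1 / (j.+1`!)%:R = (x ^+ j.+1 - y ^+ j.+1) / (j.+1`!)%:R.
  by rewrite mulrBl.
have F1 := fact_gt0R j.+1.
rewrite ler_pdivlMr // ler_pdivrMr // factSR natr1.
have E (t : R) : (x - y) * (t / (j`!)%:R) * (j.+1%:R * (j`!)%:R) = j.+1%:R * (x - y) * t.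
  by move: F0; move: (j`!)%:R j.+1%:R => a b a0; field; exact: lt0r_neq0.
by rewrite !E k1 k2.
Qed.

Lemma logmon_homo j x y : y <= x -> logmon j y <= logmon j x.
Proof.
case: j => [|j] yx; last first.
  have /andP[h _] := logmon_step j yx; rewrite -subr_ge0; apply: le_trans h.
  by rewrite mulr_ge0 ?logmon_ge0 // subr_ge0.
have h := logmon_ge0 0 x; rewrite /logmon in h *.
case: (leP 0 y) => y0 //; by rewrite (le_trans y0 yx).
Qed.

Lemma logmon_le j (L u : R) : u <= L -> 0 <= L -> logmon j u <= L ^+ j * logmon 0 u.
Proof.
move=> uL L0; rewrite /logmon; case: (leP 0 u) => u0; last by rewrite mulr0.
rewrite expr0 fact0 divr1 mulr1 ler_pdivrMr ?fact_gt0R //.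
apply: (le_trans (y := L ^+ j)); first by apply: lerXn2r; rewrite ?nnegrE.
by rewrite ler_peMr ?exprn_ge0 // ler1n fact_gt0.
Qed.

Definition logsum K P f u : R := \sum_(1 <= m < K.+1 | P m) f (u - ln m%:R) / m%:R.

Lemma ler_logsum K P f g u : (forall v, v <= u -> f v <= g v) ->
  logsum K P f u <= logsum K P g u.
Proof.
move=> h; apply: ler_sum => m _; rewrite ler_wpM2r ?invr_ge0 // h // lerBlDr lerDl.
exact: ln_nat_ge0.
Qed.

Lemma logsum_lin K P f g x u :
  logsum K P (fun v => f v + x * g v) u = logsum K P f u + x * logsum K P g u.
Proof. by rewrite /logsum mulr_sumr -big_split /=; apply: eq_bigr => m _; ring. Qed.

(** Comparison of sum and integral: log (m + 1) - log m lies between 1 / (m + 1) and 1 / m, so by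
    [logmon_step] both bounds telescope in [logmon j.+1] at u - log m. The only loss is the term m =
    1. *)
Lemma logsum_all K j u : (0 < K)%N -> u <= ln K%:R ->
  logmon j.+1 u <= logsum K predT (logmon j) u <= logmon j.+1 u + logmon j u.
Proof.
move=> K0 uK; rewrite /logsum; apply/andP; split.
  have e : logmon j.+1 u = \sum_(1 <= m < K.+1) (logmon j.+1 (u - ln m%:R) - logmon j.+1 (u - ln m.+1%:R)).
    pose F m := - logmon j.+1 (u - ln m%:R).
    rewrite (eq_bigr (fun m => F m.+1 - F m)); last by move=> m _; rewrite /F; ring.
    rewrite telescope_sumr // /F ln1 subr0 (@logmon_neg _ (u - ln K.+1%:R)); first by ring.
    rewrite subr_lt0; apply: le_lt_trans uK _; apply: ltr_ln; rewrite ?ltr0n // ltr_nat //.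
  rewrite e !big_nat; apply: ler_sum => m /andP[m1 mK].
  have [h1 h2] := ln_succ m1.
  have hm : 0 <= m.+1%:R^-1 :> R by rewrite invr_ge0.
  have d0 : u - ln m.+1%:R <= u - ln m%:R.
    by rewrite lerD2l lerN2 -subr_ge0; exact: le_trans h1.
  have /andP[_ h] := logmon_step j d0.
  apply: (le_trans h); rewrite mulrC ler_wpM2l ?logmon_ge0 // opprB addrC addrA subrK.
  exact: h2.
rewrite big_ltn ?ltnS // ln1 subr0 divr1 addrC lerD2r.
have e : logmon j.+1 u - logmon j.+1 (u - ln K%:R)
    = \sum_(1 <= m < K) (logmon j.+1 (u - ln m%:R) - logmon j.+1 (u - ln m.+1%:R)).
  pose F m := - logmon j.+1 (u - ln m%:R).
  rewrite (eq_bigr (fun m => F m.+1 - F m)); last by move=> m _; rewrite /F; ring.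
  by rewrite telescope_sumr // /F ln1 subr0; ring.
apply: (le_trans (y := logmon j.+1 u - logmon j.+1 (u - ln K%:R))); last first.
  by rewrite lerBlDr lerDl logmon_ge0.
rewrite e [leLHS]big_add1 /= !big_nat; apply: ler_sum => m /andP[m1 mK].
have [h1 h2] := ln_succ m1.
have hm : 0 <= m.+1%:R^-1 :> R by rewrite invr_ge0.
have d0 : u - ln m.+1%:R <= u - ln m%:R.
  by rewrite lerD2l lerN2 -subr_ge0; exact: le_trans h1.
have /andP[h _] := logmon_step j d0.
apply: le_trans h; rewrite mulrC ler_wpM2r ?logmon_ge0 // opprB addrC addrA subrK.
exact: h1.
Qed.

Definition coprimes zs (m : nat) : bool := all (fun z => ~~ (z %| m)%N) zs.

(** For distinct primes with product W this is phi(W) / W. *)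
Definition density zs : R := \prod_(z <- zs) (1 - z%:R^-1).

Lemma density_bounds zs : {in zs, forall z, prime z} -> 0 < density zs <= 1.
Proof.
rewrite /density; elim: zs => [|z zs IH] hz; first by rewrite big_nil ltr01 lexx.
rewrite big_cons.
have /andP[h0 h1] := IH (fun q qs => hz q (@mem_behead _ (z :: zs) q qs)).
have z2 : 2 <= z%:R :> R by rewrite ler_nat prime_gt1 // hz // mem_head.
have z0 : 0 < z%:R^-1 :> R by rewrite invr_gt0; lra.
have z1 : z%:R^-1 < 1 :> R by rewrite invf_lt1; lra.
rewrite mulr_gt0 //=; last by lra.
by apply: mulr_ile1 => //; [lra|exact: ltW|lra].
Qed.

(** One step of inclusion and exclusion: z m is coprime to [zs] exactly when m is, since z is a
    prime outside [zs]. *)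
Lemma logsum_cons K z zs f u : (0 < K)%N -> prime z -> z \notin zs ->
  {in zs, forall z, prime z} -> (forall v, v < 0 -> f v = 0) -> u <= ln K%:R ->
  logsum K (coprimes (z :: zs)) f u
  = logsum K (coprimes zs) f u - z%:R^-1 * logsum K (coprimes zs) f (u - ln z%:R).
Proof.
move=> K0 pz zzs hz f0 uK; rewrite /logsum.
rewrite [X in _ = X - _](bigID (fun m => z %| m)%N) /=.
rewrite (@sum_multiples _ K z (coprimes zs) (fun m => f (u - ln m%:R) / m%:R)) ?prime_gt0 //; last first.
  move=> n nK; rewrite f0 ?mul0r // subr_lt0; apply: le_lt_trans uK _.
  by apply: ltr_ln; rewrite ?ltr0n ?ltr_nat.
rewrite [X in _ = X + _ - _](_ : _ = z%:R^-1 * \sum_(1 <= m < K.+1 | coprimes zs m)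
    f (u - ln z%:R - ln m%:R) / m%:R).
  by rewrite addrAC subrr add0r; apply: eq_bigl => m; rewrite /= andbC.
rewrite mulr_sumr big_nat_cond [RHS]big_nat_cond; apply: eq_big => [m|m /andP[/andP[m1 _] _]].
  congr (_ && _); apply: eq_in_all => q qzs; congr (~~ _).
  rewrite Euclid_dvdM ?(hz q qzs) // dvdn_prime2 ?(hz q qzs) //.
  by case: eqP => // qz; rewrite -qz qzs in zzs.
rewrite natrM lnM ?ltr0n ?(prime_gt0 pz) ?m1 // opprD addrA invfM; ring.
Qed.

(** Sieving out one more z multiplies the main term by 1 - 1 / z, and replacing u - log z by u there
    costs log z times [logmon j], one degree lower. The indicator [logmon 0 u] is kept in the error
    so that the estimate can be iterated. *)
Lemma logsum_asymp zs : uniq zs -> {in zs, forall z, prime z} -> forall j, exists2 C : R, 0 <= C &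
  forall K u, (0 < K)%N -> u <= ln K%:R ->
  `|logsum K (coprimes zs) (logmon j) u - density zs * logmon j.+1 u|
    <= C * (ln K%:R ^+ j * logmon 0 u).
Proof.
move=> uz hz j; elim: zs uz hz => [|z zs IH] /=.
  move=> _ _; exists 1 => // K u K0 uK; have /andP[h1 h2] := logsum_all j K0 uK.
  rewrite /density big_nil !mul1r.
  have -> : logsum K (coprimes [::]) (logmon j) u = logsum K predT (logmon j) u by [].
  rewrite ger0_norm ?subr_ge0 // lerBlDl; apply: (le_trans h2); rewrite lerD2l.
  exact: logmon_le uK (ln_nat_ge0 _).
move=> /andP[zzs uz] hz.
have pz := hz z (mem_head _ _).
have hz' : {in zs, forall z, prime z} by move=> q qs; apply: hz; rewrite inE qs orbT.
have [C C0 hC] := IH uz hz'.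
(* One [C] for each of the two sums of [logsum_cons], and log z for the shift in the main term. *)
exists (2 * C + ln z%:R); first by rewrite addr_ge0 ?mulr_ge0 ?ln_nat_ge0.
move=> K u K0 uK.
have /andP[c0 c1] := density_bounds hz'.
have lz := ln_nat_ge0 z.
have z2 : 2 <= z%:R :> R by rewrite ler_nat prime_gt1.
have z0 : 0 < z%:R^-1 :> R by rewrite invr_gt0; lra.
have z1 : z%:R^-1 <= 1 :> R by rewrite invf_le1; lra.
rewrite logsum_cons //; last by move=> v; exact: logmon_neg.
have d0 : density (z :: zs) = (1 - z%:R^-1) * density zs by rewrite /density big_cons.
have u'K : u - ln z%:R <= ln K%:R by lra.
have := hC K u K0 uK; have := hC K (u - ln z%:R) K0 u'K.
have /andP[s1 s2] := @logmon_step j u (u - ln z%:R) ltac:(lra).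
have LK := ln_nat_ge0 K.
have m0 := logmon_ge0 0 u.
have LJ : 0 <= ln K%:R ^+ j :> R by exact: exprn_ge0.
have mono0 : ln K%:R ^+ j * logmon 0 (u - ln z%:R) <= ln K%:R ^+ j * logmon 0 u.
  by rewrite ler_wpM2l // logmon_homo //; lra.
have mj := logmon_le j uK LK.
rewrite d0.
set A := logsum _ _ _ _; set B := logsum _ _ _ _.
set D := ln K%:R ^+ j * logmon 0 u in mono0 mj *.
set D' := ln K%:R ^+ j * _ in mono0 *.
set f1 := logmon j.+1 (u - _) in s1 s2 *; set f2 := logmon j.+1 u in s1 s2 *.
set c := density zs in c0 c1 *.
have D0 : 0 <= D by exact: mulr_ge0.
have -> : forall t : R, B - t * A - (1 - t) * c * f2 = (B - c * f2) - t * (A - c * f1) + t * c * (f2 - f1).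
  by move=> t; ring.
move=> h1 h2.
have f12 : 0 <= f2 - f1.
  by apply: le_trans s1; rewrite mulr_ge0 ?logmon_ge0 //; lra.
have h3 : f2 - f1 <= ln z%:R * D.
  apply: (le_trans s2); rewrite (_ : u - (u - ln z%:R) = ln z%:R); last by ring.
  exact: ler_wpM2l.
apply: (le_trans (ler_normD _ _)).
have n1 := ler_normB (B - c * f2) (z%:R^-1 * (A - c * f1)).
have n2 : `|z%:R^-1 * (A - c * f1)| <= C * D.
  rewrite normrM gtr0_norm //; apply: (le_trans (y := 1 * `|A - c * f1|)).
    exact: ler_wpM2r.
  by rewrite mul1r; apply: (le_trans h1); exact: ler_wpM2l.
have n3 : `|z%:R^-1 * c * (f2 - f1)| <= ln z%:R * D.
  rewrite ger0_norm; last by rewrite !mulr_ge0 // ltW.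
  apply: le_trans h3; rewrite ler_piMl //; apply: mulr_ile1 => //; exact: ltW.
have -> : (2 * C + ln z%:R) * D = C * D + C * D + ln z%:R * D by ring.
lra.
Qed.

Lemma ler_iter_logsum K P i f g u : (forall v, v <= u -> f v <= g v) ->
  iter i (logsum K P) f u <= iter i (logsum K P) g u.
Proof.
elim: i u => [|i IH] u h /=; first exact: h.
by apply: ler_logsum => v vu; apply: IH => w wv; apply: h; exact: le_trans vu.
Qed.

Lemma iter_logsum_lin K P i f g x u :
  iter i (logsum K P) (fun v => f v + x * g v) u
  = iter i (logsum K P) f u + x * iter i (logsum K P) g u.
Proof.
elim: i u => [|i IH] u //=.
rewrite -logsum_lin /logsum; apply: eq_bigr => m _; by rewrite IH.
Qed.

Lemma iter_logsumZ K P i f x u :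
  iter i (logsum K P) (fun v => x * f v) u = x * iter i (logsum K P) f u.
Proof.
elim: i u => [|i IH] u //=.
by rewrite /logsum mulr_sumr; apply: eq_bigr => m _; rewrite IH mulrA.
Qed.

(** The factor log K on the left stands for an exponent i + j - 1 on the right. The innermost sum is
    expanded, and its error, a multiple of [logmon 0], goes through the remaining i sums, where the
    induction hypothesis for j = 0 bounds it. *)
Lemma iter_logsum_asymp zs : uniq zs -> {in zs, forall z, prime z} ->
  forall i j, exists2 C : R, 0 <= C & forall K u, (0 < K)%N -> 1 <= ln K%:R -> u <= ln K%:R ->
  ln K%:R * `|iter i (logsum K (coprimes zs)) (logmon j) u - density zs ^+ i * logmon (i + j) u|
    <= C * (ln K%:R ^+ (i + j) * logmon 0 u).
Proof.
move=> uz hz.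
have /andP[c0 c1] := density_bounds hz.
elim=> [|i IH] j.
  exists 0 => // K u K0 L1 uK.
  by rewrite /= expr0 mul1r subrr normr0 mulr0 mul0r.
have [C1 C10 h1] := IH j.+1.
have [C2 C20 h2] := IH 0%N.
have [C3 C30 h3] := logsum_asymp uz hz j.
exists (C1 + C3 * (C2 + 1)); first by rewrite addr_ge0 ?mulr_ge0 ?addr_ge0.
move=> K u K0 L1 uK; rewrite iterSr.
set T := logsum K (coprimes zs); set c := density zs in c0 c1 h1 h2 h3 *; set L := ln K%:R in L1 uK *.
have L0 : 0 <= L by lra.
have := h1 K u K0 L1 uK; rewrite addnS -/L -/T => e1.
have ci : 0 <= c ^+ i <= 1 by rewrite exprn_ge0 ?exprn_ile1 // ltW.
have e2 : L * iter i T (logmon 0) u <= (C2 + 1) * (L ^+ i.+1 * logmon 0 u).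
  have := h2 K u K0 L1 uK; rewrite addn0 -/L -/T => e.
  have hm := logmon_le i uK L0.
  have n : iter i T (logmon 0) u <= `|iter i T (logmon 0) u - c ^+ i * logmon i u| + c ^+ i * logmon i u.
    by rewrite -lerBlDr ler_norm.
  have q : c ^+ i * logmon i u <= L ^+ i * logmon 0 u.
    apply: le_trans hm; rewrite ler_piMl ?logmon_ge0 //; by case/andP: ci.
  have q' : L * (c ^+ i * logmon i u) <= L * (L ^+ i * logmon 0 u) by apply: ler_wpM2l.
  have n' := ler_wpM2l L0 n.
  have W : L ^+ i * logmon 0 u <= L ^+ i.+1 * logmon 0 u.
    by rewrite ler_wpM2r ?logmon_ge0 // exprS ler_peMl ?exprn_ge0.
  have W' := ler_wpM2l C20 W.
  move: n' q' e W'; rewrite exprS mulrDr; lra.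
have bnd v : v <= u -> `|T (logmon j) v - c * logmon j.+1 v| <= C3 * L ^+ j * logmon 0 v.
  by move=> vu; rewrite -mulrA; apply: h3 => //; exact: le_trans uK.
have up : iter i T (T (logmon j)) u <= c * iter i T (logmon j.+1) u + C3 * L ^+ j * iter i T (logmon 0) u.
  rewrite -iter_logsumZ -iter_logsum_lin; apply: ler_iter_logsum => v /bnd; rewrite ler_norml; lra.
have lo : c * iter i T (logmon j.+1) u - C3 * L ^+ j * iter i T (logmon 0) u <= iter i T (T (logmon j)) u.
  rewrite -iter_logsumZ -mulNr -iter_logsum_lin; apply: ler_iter_logsum => v /bnd; rewrite ler_norml; lra.
have e3 : L * (C3 * L ^+ j * iter i T (logmon 0) u) <= C3 * (C2 + 1) * (L ^+ (i + j).+1 * logmon 0 u).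
  have CL : 0 <= C3 * L ^+ j by rewrite mulr_ge0 ?exprn_ge0.
  have := ler_wpM2l CL e2.
  have -> : C3 * L ^+ j * ((C2 + 1) * (L ^+ i.+1 * logmon 0 u)) = C3 * (C2 + 1) * (L ^+ (i + j).+1 * logmon 0 u).
    by rewrite -addSn exprD; ring.
  by rewrite mulrCA.
move: e1; rewrite addSn.
set A := iter i T (T _) u in up lo *; set B := iter i T (logmon j.+1) u in up lo *.
set E := C3 * L ^+ j * _ in up lo e3 *; set m := logmon _ u => e1.
have hn : `|A - c ^+ i.+1 * m| <= `|B - c ^+ i * m| + E.
  have hc : `|c * (B - c ^+ i * m)| <= `|B - c ^+ i * m|.
    by rewrite normrM gtr0_norm // ler_piMl.
  have : `|A - c * B| <= E by rewrite ler_norml; lra.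
  have -> : A - c ^+ i.+1 * m = (A - c * B) + c * (B - c ^+ i * m) by rewrite exprS; ring.
  move=> hh; apply: (le_trans (ler_normD _ _)); lra.
have := ler_wpM2l L0 hn; rewrite mulrDr mulrDl; lra.
Qed.

End LogSums.

(** * Main terms of the sieve *)

Section MainTerms.
Local Open Scope ring_scope.
Implicit Types (x y u beta : R) (f g : R -> R) (P : pred nat) (zs ps : seq nat).

(** This is L P(u / L) for the linear polynomial P, cut off at u < 0; the scaling by L = log K
    clears the denominator. *)
Definition sievewt beta (L u : R) : R := L * logmon 0 u + beta * logmon 1 u.

(* Iterating [logsum] i times takes u ^ j / j! to about
   c ^ i u ^ (i + j) / (i + j)!; [Icoef] and [Jcoef] are the resulting leading
   coefficients for the squares of L + beta u and of its primitive. *)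
Definition Icoef (i : nat) beta : R :=
  (i`!)%:R^-1 + 2 * beta / (i.+1`!)%:R + 2 * beta ^+ 2 / (i.+2`!)%:R.

Definition Jcoef (i : nat) beta : R :=
  2 / (i.+2`!)%:R + 6 * beta / (i.+3`!)%:R + 6 * beta ^+ 2 / (i.+4`!)%:R.

Lemma logmon0E u : 0 <= u -> logmon 0 u = 1.
Proof. by rewrite /logmon => ->; rewrite expr0 fact0 divr1. Qed.

Lemma logmonE j u : 0 <= u -> logmon j u = u ^+ j / (j`!)%:R.
Proof. by rewrite /logmon => ->. Qed.

Lemma logmon_small u : 0 <= u -> [/\ logmon 1 u = u, logmon 2 u = u ^+ 2 / 2,
  logmon 3 u = u ^+ 3 / 6 & logmon 4 u = u ^+ 4 / 24].
Proof. by move=> u0; rewrite !logmonE // expr1 divr1; split. Qed.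

Lemma sievewt_sqr beta (L u : R) :
  sievewt beta L u ^+ 2
  = L ^+ 2 * logmon 0 u + (2 * beta * L) * logmon 1 u + (2 * beta ^+ 2) * logmon 2 u.
Proof.
rewrite /sievewt; case: (leP 0 u) => u0; last by rewrite !logmon_neg //; ring.
by have [-> -> _ _] := logmon_small u0; rewrite logmon0E //; field.
Qed.

Lemma iter_logsum_top zs : uniq zs -> {in zs, forall z, prime z} ->
  forall i j, exists2 C : R, 0 <= C & forall K (L := ln K%:R), (0 < K)%N -> 1 <= L ->
  `|L * iter i (logsum K (coprimes zs)) (logmon j) L
     - density zs ^+ i * L ^+ (i + j).+1 / ((i + j)`!)%:R| <= C * L ^+ (i + j).
Proof.
move=> uz hz i j; have [C C0 h] := iter_logsum_asymp uz hz i j.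
exists C => // K L K0 L1; have := h K L K0 L1 (lexx _); rewrite -/L.
have L0 : 0 <= L by lra.
rewrite logmon0E // mulr1 logmonE //; apply: le_trans.
rewrite le_eqVlt; apply/orP; left; apply/eqP.
have e x : L * `|x| = `|L * x| by rewrite normrM (ger0_norm L0).
by rewrite e mulrBr (exprS L (i + j)); congr `|_ - _|; rewrite mulrCA !mulrA.
Qed.

Lemma main_upper zs beta i : uniq zs -> {in zs, forall z, prime z} -> 0 <= beta ->
  exists2 C : R, 0 <= C & forall K (L := ln K%:R), (0 < K)%N -> 1 <= L ->
  L * iter i (logsum K (coprimes zs)) (fun u => sievewt beta L u ^+ 2) L
  <= density zs ^+ i * Icoef i beta * L ^+ (i + 3) + C * L ^+ (i + 2).
Proof.
move=> uz hz b0.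
have [C0 C00 h0] := iter_logsum_top uz hz i 0.
have [C1 C10 h1] := iter_logsum_top uz hz i 1.
have [C2 C20 h2] := iter_logsum_top uz hz i 2.
exists (C0 + 2 * beta * C1 + 2 * beta ^+ 2 * C2).
  by rewrite !addr_ge0 ?mulr_ge0 ?exprn_ge0.
move=> K L K0 L1.
have {h0} := h0 K K0 L1; have {h1} := h1 K K0 L1; have {h2} := h2 K K0 L1; rewrite -/L.
set T := logsum K (coprimes zs); set c := density zs.
have -> : (fun u => sievewt beta L u ^+ 2) = (fun u =>
  (L ^+ 2 * logmon 0 u + (2 * beta * L) * logmon 1 u) + (2 * beta ^+ 2) * logmon 2 u).
  by apply: functional_extensionality => u; rewrite sievewt_sqr.
rewrite !iter_logsum_lin iter_logsumZ !ler_norml addn0 addn1.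
set A0 := iter i T (logmon 0) L; set A1 := iter i T (logmon 1) L; set A2 := iter i T (logmon 2) L.
move=> /andP[_ h2] /andP[_ h1] /andP[_ h0].
have L0 : 0 <= L by lra.
have g0 := ler_wpM2l (exprn_ge0 2 L0) h0.
have bL : 0 <= 2 * beta * L by rewrite !mulr_ge0.
have g1 := ler_wpM2l bL h1.
have b2 : 0 <= 2 * beta ^+ 2 by rewrite mulr_ge0 ?exprn_ge0.
have g2 := ler_wpM2l b2 h2.
rewrite /Icoef.
have -> : L * (L ^+ 2 * A0 + 2 * beta * L * A1 + 2 * beta ^+ 2 * A2)
  = L ^+ 2 * (L * A0) + 2 * beta * L * (L * A1) + 2 * beta ^+ 2 * (L * A2) by ring.
rewrite !addnS !addn0 in g0 g1 g2 *; rewrite !exprS in g0 g1 g2 *.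
move: g0 g1 g2.
set F0 := (i`!)%:R^-1; set F1 := (i.+1`!)%:R^-1; set F2 := (i.+2`!)%:R^-1.
set X := L ^+ i; set ci := c ^+ i.
lra.
Qed.

(** Only the order of magnitude: this serves to bound the coefficients lambda_d in the error
    terms. *)
Lemma main_crude zs beta i : uniq zs -> {in zs, forall z, prime z} -> 0 <= beta ->
  exists2 C : R, 0 <= C & forall K (L := ln K%:R), (0 < K)%N -> 1 <= L ->
  iter i (logsum K (coprimes zs)) (sievewt beta L) L <= C * L ^+ i.+1.
Proof.
move=> uz hz b0.
have [C0 C00 h0] := iter_logsum_top uz hz i 0.
have [C1 C10 h1] := iter_logsum_top uz hz i 1.
have /andP[c0 c1] := density_bounds hz.
exists (C0 + 1 + beta * (C1 + 1)); first by rewrite !addr_ge0 ?mulr_ge0 ?addr_ge0.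
move=> K L K0 L1.
have {h0} := h0 K K0 L1; have {h1} := h1 K K0 L1; rewrite -/L.
set T := logsum K (coprimes zs); set c := density zs in c0 c1 *.
rewrite -[sievewt beta L]/(fun u => L * logmon 0 u + beta * logmon 1 u).
rewrite !iter_logsum_lin iter_logsumZ !ler_norml addn0 addn1.
set A0 := iter i T (logmon 0) L; set A1 := iter i T (logmon 1) L.
move=> /andP[_ h1] /andP[_ h0].
have L0 : 0 <= L by lra.
have ci : c ^+ i <= 1 by rewrite exprn_ile1 // ltW.
have ci0 : 0 <= c ^+ i by rewrite exprn_ge0 // ltW.
have fle n x : 0 <= x -> c ^+ i * x / (n`!)%:R <= x.
  move=> x0; rewrite ler_pdivrMr ?fact_gt0R //.
  apply: (le_trans (y := 1 * x)); first exact: ler_wpM2r.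
  by rewrite mul1r ler_peMr // ler1n fact_gt0.
have e0 := fle i _ (exprn_ge0 i.+1 L0).
have e1 := fle i.+1 _ (exprn_ge0 i.+2 L0).
have p1 : L ^+ i <= L ^+ i.+1 by rewrite exprS ler_peMl ?exprn_ge0.
have p2 : L ^+ i.+1 <= L ^+ i.+2 by rewrite (exprS L i.+1) ler_peMl ?exprn_ge0.
have q1 : L * A0 <= (C0 + 1) * L ^+ i.+1.
  have := ler_wpM2l C00 p1; lra.
have q2 : L * A1 <= (C1 + 1) * L ^+ i.+2.
  have := ler_wpM2l C10 p2; lra.
have q3 : A1 <= (C1 + 1) * L ^+ i.+1.
  rewrite -(ler_pM2l (x := L)); last by lra.
  by apply: (le_trans q2); rewrite (exprS L i.+1); lra.
have := ler_wpM2l b0 q3; lra.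
Qed.

(** The inner sum t is known only to be at least c Q - E L, which may be negative. Still t ^ 2 >= c
    Q (c Q - 2 E L) always, since the right side is at most 0 when c Q <= E L. This bound is a
    combination of [logmon]s, to which the i outer sums apply. *)
Lemma main_lower zs beta i : uniq zs -> {in zs, forall z, prime z} -> 0 <= beta ->
  exists2 C : R, 0 <= C & forall K (L := ln K%:R) (T := logsum K (coprimes zs)),
  (0 < K)%N -> 1 <= L ->
  density zs ^+ (i + 2) * Jcoef i beta * L ^+ (i + 5) - C * L ^+ (i + 4)
  <= L * iter i T (fun u => T (sievewt beta L) u ^+ 2) L.
Proof.
move=> uz hz b0.
have [C1 C10 h1] := iter_logsum_top uz hz i 1.
have [C2 C20 h2] := iter_logsum_top uz hz i 2.
have [C3 C30 h3] := iter_logsum_top uz hz i 3.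
have [C4 C40 h4] := iter_logsum_top uz hz i 4.
have [D0 D00 k0] := logsum_asymp uz hz 0.
have [D1 D10 k1] := logsum_asymp uz hz 1.
have /andP[c0 c1] := density_bounds hz.
set c := density zs in c0 c1 h1 h2 h3 h4 k0 k1 *.
set E := D0 + beta * D1.
have E0 : 0 <= E by rewrite addr_ge0 ?mulr_ge0.
exists (c ^+ 2 * (2 * C2 + 6 * beta * C3 + 6 * beta ^+ 2 * C4)
   + 2 * c * E * ((c ^+ i + C1) + beta * (c ^+ i + C2))).
  by do ?[exact: ltW|done|apply: exprn_ge0|apply: addr_ge0|apply: mulr_ge0].
move=> K L T K0 L1.
have {h1} := h1 K K0 L1; have {h2} := h2 K K0 L1; have {h3} := h3 K K0 L1; have {h4} := h4 K K0 L1.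
rewrite -/L -/T !ler_norml.
set A1 := iter i T (logmon 1) L; set A2 := iter i T (logmon 2) L.
set A3 := iter i T (logmon 3) L; set A4 := iter i T (logmon 4) L.
move=> /andP[h4 _] /andP[h3 _] /andP[h2 h2'] /andP[h1 h1'].
have L0 : 0 <= L by lra.
(* With Q = L u + beta u ^ 2 / 2, the first three terms are c ^ 2 Q ^ 2 = c ^ 2 (L ^ 2 u ^ 2 + beta
   L u ^ 3 + beta ^ 2 u ^ 4 / 4) in factorial normalisation: hence the 2, 6, 6 of [Jcoef]. *)
have pw u : u <= L ->
  ((c ^+ 2 * (2 * L ^+ 2)) * logmon 2 u + (c ^+ 2 * (6 * beta * L)) * logmon 3 u
    + (c ^+ 2 * (6 * beta ^+ 2)) * logmon 4 u) + (- (2 * c * E * L ^+ 2)) * logmon 1 u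
    + (- (2 * c * E * L * beta)) * logmon 2 u
  <= T (sievewt beta L) u ^+ 2.
  move=> uL; case: (leP 0 u) => u0; last first.
    by rewrite !logmon_neg // !mulr0 !addr0 sqr_ge0.
  have := k0 K u K0 uL; have := k1 K u K0 uL; rewrite -/L -/T expr0 expr1 logmon0E // mul1r !mulr1.
  rewrite !ler_norml => /andP[t1 _] /andP[t0 _].
  have TE : T (sievewt beta L) u = L * T (logmon 0) u + beta * T (logmon 1) u.
    rewrite -[sievewt beta L]/(fun u => L * logmon 0 u + beta * logmon 1 u) /T logsum_lin.
    by congr (_ + _); exact: (iter_logsumZ _ _ 1).
  have m0 : 0 <= T (logmon 0) u by apply: sumr_ge0 => m _; rewrite divr_ge0 ?logmon_ge0.
  have m1 : 0 <= T (logmon 1) u by apply: sumr_ge0 => m _; rewrite divr_ge0 ?logmon_ge0.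
  set t := T (sievewt beta L) u in TE *.
  have t00 : 0 <= t by rewrite TE addr_ge0 ?mulr_ge0.
  pose Q := L * logmon 1 u + beta * logmon 2 u.
  have Q0 : 0 <= Q by rewrite addr_ge0 ?mulr_ge0 ?logmon_ge0.
  have tQ : c * Q - E * L <= t.
    have s0 := ler_wpM2l L0 t0; have s1 := ler_wpM2l b0 t1.
    by rewrite TE /Q /E; lra.
  have -> : c ^+ 2 * (2 * L ^+ 2) * logmon 2 u + c ^+ 2 * (6 * beta * L) * logmon 3 u
    + c ^+ 2 * (6 * beta ^+ 2) * logmon 4 u + - (2 * c * E * L ^+ 2) * logmon 1 u
    + - (2 * c * E * L * beta) * logmon 2 u = (c * Q) * (c * Q - 2 * (E * L)).
    by rewrite /Q; have [-> -> -> ->] := logmon_small u0; field.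
  have cQ : 0 <= c * Q by rewrite mulr_ge0 // ltW.
  have EL : 0 <= E * L by rewrite mulr_ge0.
  case: (leP (c * Q) (E * L)) => hQ.
    apply: (le_trans (y := 0)); last exact: sqr_ge0.
    by apply: mulr_ge0_le0 => //; lra.
  have : (c * Q - E * L) ^+ 2 <= t ^+ 2 by rewrite ler_sqr ?nnegrE //; lra.
  by have := sqr_ge0 (E * L); lra.
have := @ler_iter_logsum K (coprimes zs) i _ _ L pw.
rewrite !iter_logsum_lin !iter_logsumZ -/T -/A1 -/A2 -/A3 -/A4 => main.
have {main} main := ler_wpM2l L0 main; apply: le_trans main.
have ci0 : 0 <= c ^+ i by rewrite exprn_ge0 // ltW.
have c20 : 0 <= c ^+ 2 by rewrite sqr_ge0.
have g2 : 2 * L ^+ 2 * (c ^+ i * L ^+ (i + 2).+1 / ((i + 2)`!)%:R - C2 * L ^+ (i + 2))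
   <= 2 * L ^+ 2 * (L * A2) by rewrite ler_wpM2l ?mulr_ge0 ?exprn_ge0 //; lra.
have g3 : 6 * beta * L * (c ^+ i * L ^+ (i + 3).+1 / ((i + 3)`!)%:R - C3 * L ^+ (i + 3))
   <= 6 * beta * L * (L * A3) by rewrite ler_wpM2l ?mulr_ge0 //; lra.
have g4 : 6 * beta ^+ 2 * (c ^+ i * L ^+ (i + 4).+1 / ((i + 4)`!)%:R - C4 * L ^+ (i + 4))
   <= 6 * beta ^+ 2 * (L * A4) by rewrite ler_wpM2l ?mulr_ge0 ?exprn_ge0 //; lra.
have fle n x : 0 <= x -> c ^+ i * x / (n`!)%:R <= c ^+ i * x.
  move=> x0; rewrite ler_pdivrMr ?fact_gt0R // ler_peMr ?mulr_ge0 // ler1n fact_gt0 //.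
have p1 : L * A1 <= (c ^+ i + C1) * L ^+ i.+2.
  have := fle (i + 1)%N _ (exprn_ge0 (i + 1).+1 L0).
  have : C1 * L ^+ i.+1 <= C1 * L ^+ i.+2.
    by rewrite ler_wpM2l // (exprS L i.+1) ler_peMl ?exprn_ge0.
  by move: h1'; rewrite !addn1; lra.
have p2 : L * A2 <= (c ^+ i + C2) * L ^+ i.+3.
  have := fle (i + 2)%N _ (exprn_ge0 (i + 2).+1 L0).
  have : C2 * L ^+ i.+2 <= C2 * L ^+ i.+3.
    by rewrite ler_wpM2l // (exprS L i.+2) ler_peMl ?exprn_ge0.
  by move: h2'; rewrite !addn2; lra.
have cE : 0 <= 2 * c * E by rewrite !mulr_ge0 // ltW.
have q1 := ler_wpM2l (mulr_ge0 cE (exprn_ge0 2 L0)) p1.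
have q2 := ler_wpM2l (mulr_ge0 (mulr_ge0 cE L0) b0) p2.
have G := ler_wpM2l c20 (lerD (lerD g2 g3) g4).
move: G q1 q2; rewrite /Jcoef (exprD c) !addnS !addn0.
set F2 := (i.+2`!)%:R^-1; set F3 := (i.+3`!)%:R^-1; set F4 := (i.+4`!)%:R^-1.
rewrite !(exprS L); set X := L ^+ i; set ci := c ^+ i; set cc := c ^+ 2.
rewrite expr0.
clear -b0 => G q1 q2; lra.
Qed.

End MainTerms.

(** * Asymptotic bounds for the forms with logarithmic weights *)

Section SieveEstimates.
Local Open Scope ring_scope.
Implicit Types (x y u beta : R) (f g : R -> R) (P : pred nat) (zs ps : seq nat).

Definition primes_in D K : seq nat := [seq p <- index_iota D.+1 K.+1 | prime p].

Lemma mem_primes_in D K p : (p \in primes_in D K) = prime p && (D < p <= K)%N.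
Proof. by rewrite mem_filter mem_index_iota ltnS. Qed.

Lemma primes_in_uniq D K : uniq (primes_in D K).
Proof. by rewrite filter_uniq // iota_uniq. Qed.

Lemma primes_in_prime D K : {in primes_in D K, forall p, prime p}.
Proof. by move=> p; rewrite mem_primes_in => /andP[]. Qed.

Lemma smooth_coprimes D K m : (0 < m <= K)%N ->
  smooth (primes_in D K) m = coprimes (primes_in 0 D) m.
Proof.
move=> /andP[m0 mK]; apply/allP/allP => h p.
  rewrite mem_primes_in => /andP[pp pD]; apply/negP => pm.
  have := h p; rewrite mem_primes pp m0 pm => /(_ isT).
  by rewrite inE mem_primes_in; lia.
rewrite mem_primes => /and3P[pp _ pm]; rewrite inE mem_primes_in pp /=.
have := h p; rewrite mem_primes_in pp pm prime_gt0 //= => hh.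
have := dvdn_leq m0 pm => pm'.
by rewrite (leq_trans pm' mK) andbT ltnNge; apply/negP => pD; have := hh pD.
Qed.

(** Turns a function of u = log (K / n) into a function of n; under it [logsum] becomes [dilsum]. *)
Definition loglift K f (n : nat) : R := if (0 < n)%N then f (ln K%:R - ln n%:R) else 0.

Lemma dilsum_lift D K f :
  dilsum K (primes_in D K) (loglift K f) = loglift K (logsum K (coprimes (primes_in 0 D)) f).
Proof.
apply: functional_extensionality => r; rewrite /dilsum /smoothsum /loglift.
have [->|r0] := posnP r; first by rewrite big1 // => m _; rewrite mul0n mul0r.
rewrite /logsum big_nat_cond [RHS]big_nat_cond; apply: eq_big => [m|m /andP[/andP[m0 _] _]].
  case: (boolP (0 < m < K.+1)%N) => //=; rewrite ltnS => /smooth_coprimes; exact.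
by rewrite muln_gt0 r0 m0 natrM lnM ?ltr0n // opprD addrA.
Qed.

Lemma iter_dilsum_lift D K j f :
  iter j (dilsum K (primes_in D K)) (loglift K f)
  = loglift K (iter j (logsum K (coprimes (primes_in 0 D))) f).
Proof. by elim: j => [|j IH] //=; rewrite IH dilsum_lift. Qed.

Lemma lift1 K f : loglift K f 1 = f (ln K%:R).
Proof. by rewrite /loglift ln1 subr0. Qed.

(** With p = m + 1 and 2 k <= m one has k ^ 2 / (p (p - k)) <= 2 k ^ 2 (1 / m - 1 / (m + 1)), which
    telescopes over all integers beyond [D]. Induction carries the bound 1 for the product times one
    minus the partial sum. *)
Lemma lossfactor_le (k D K : nat) : (0 < k)%N -> (2 * k <= D)%N ->
  lossfactor k%:R (primes_in D K) * (1 - 2 * k%:R ^+ 2 / D%:R) <= 1 :> R.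
Proof.
move=> k0 kD; set a : R := 2 * k%:R ^+ 2.
have a0 : 0 <= a by rewrite mulr_ge0 ?sqr_ge0.
have D0 : (0 < D)%N by lia.
case: (leqP K D) => KD.
  rewrite /lossfactor /primes_in /index_iota (_ : K.+1 - D.+1 = 0)%N; last by lia.
  by rewrite /= big_nil mul1r lerBlDr lerDl divr_ge0.
suff h n : lossfactor k%:R (primes_in D (D + n)) * (1 - a * (D%:R^-1 - (D + n)%:R^-1)) <= 1
   /\ 0 <= lossfactor k%:R (primes_in D (D + n)) :> R.
  have [h1 h2] := h (K - D)%N; rewrite subnKC in h1 h2; last exact: ltnW.
  apply: le_trans h1; apply: ler_wpM2l => //.
  by rewrite lerD2l lerN2 ler_wpM2l // lerBlDr lerDl invr_ge0.
elim: n => [|n [IH1 IH2]].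
  rewrite addn0 subrr mulr0 subr0 mulr1 /lossfactor /primes_in /index_iota subnn /= big_nil.
  by rewrite ler01 lexx.
have E : lossfactor k%:R (primes_in D (D + n.+1)) = lossfactor k%:R (primes_in D (D + n))
   * (if prime (D + n.+1) then 1 + k%:R ^+ 2 / ((D + n.+1)%:R * ((D + n.+1)%:R - k%:R)) else 1) :> R.
  rewrite /lossfactor /primes_in !big_filter addnS big_mkcond big_nat_recr /=; last by lia.
  by rewrite -big_mkcond.
set m := (D + n)%N in IH1 IH2 E *.
have m2k : 2 * k%:R <= m%:R :> R by rewrite -natrM ler_nat /m; lia.
have kR : 1 <= k%:R :> R by rewrite ler1n.
have Em : (D + n.+1)%:R = m%:R + 1 :> R by rewrite addnS natr1.
have DV : 0 < D%:R^-1 :> R by rewrite invr_gt0 ltr0n.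
have mD : m%:R^-1 <= D%:R^-1 :> R by rewrite lef_pV2 ?posrE ?ltr0n ?ler_nat /m //; lia.
rewrite {}E Em; set x := (if _ then _ else _).
have y0 : m%:R^-1 - (m%:R + 1)^-1 = (m%:R * (m%:R + 1))^-1 :> R.
  by field; apply/andP; split; apply/eqP; lra.
have [x1 x2] : 1 <= x /\ x - 1 <= a * (m%:R^-1 - (m%:R + 1)^-1).
  rewrite y0 /x; case: ifP => _; last first.
    by rewrite subrr; split=> //; rewrite mulr_ge0 // invr_ge0 mulr_ge0; lra.
  split.
    by rewrite lerDl divr_ge0 ?sqr_ge0 // mulr_ge0; lra.
  rewrite addrAC subrr add0r /a -mulrA mulrCA ler_wpM2l ?sqr_ge0 //.
  have q1 : 0 < (m%:R + 1) * (m%:R + 1 - k%:R) :> R by apply: mulr_gt0; lra.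
  have q2 : 0 < m%:R * (m%:R + 1) :> R by apply: mulr_gt0; lra.
  rewrite -[leLHS]mul1r ler_pdivrMr // mulrAC ler_pdivlMr // mul1r.
  by rewrite [leLHS]mulrC mulrCA ler_wpM2l; lra.
split; last by apply: mulr_ge0 => //; lra.
apply: le_trans IH1; rewrite -mulrA; apply: ler_wpM2l => //.
set s := a * (D%:R^-1 - m%:R^-1); set y := a * _ in x2.
have s0 : 0 <= s by rewrite mulr_ge0 // subr_ge0.
have -> : a * (D%:R^-1 - (m%:R + 1)^-1) = s + y by rewrite /s /y; ring.
have : 0 <= (x - 1) * s by rewrite mulr_ge0 //; lra.
have : 0 <= (x - 1) * y by rewrite mulr_ge0 //; lra.
lra.
Qed.

Lemma primes_in_gt k D K p : (2 * k <= D)%N -> p \in primes_in D K -> (2 * k <= p)%N.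
Proof. by rewrite mem_primes_in; lia. Qed.

Section Fixed.
Variables (k D : nat) (beta : R).
Hypotheses (k0 : (0 < k)%N) (kD : (2 * k <= D)%N) (beta0 : 0 <= beta).

Definition sieveY K : nat -> R := loglift K (sievewt beta (ln K%:R)).

Lemma sievewt_homo (L x y : R) : 0 <= L -> y <= x -> sievewt beta L y <= sievewt beta L x.
Proof. by move=> L0 yx; rewrite lerD // ler_wpM2l ?logmon_homo. Qed.

Lemma sieveY_antitone K : antitone (sieveY K).
Proof.
have LK := ln_nat_ge0 K.
split=> [n|p n p0]; rewrite /sieveY /loglift.
  by case: ifP => // _; rewrite addr_ge0 ?mulr_ge0 ?logmon_ge0.
rewrite muln_gt0 p0 /=; case: ifP => // n0; apply: sievewt_homo => //.
rewrite natrM lnM ?ltr0n // lerD2l lerN2 lerDr; exact: ln_nat_ge0.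
Qed.

Lemma sieveY_supported K : (0 < K)%N -> supported K (sieveY K).
Proof.
move=> K0 n; rewrite /sieveY /loglift; case: ltnP => //= n0; rewrite -ltnNge => Kn.
have neg : ln K%:R - ln n%:R < 0 by rewrite subr_lt0 ltr_ln ?ltr0n ?ltr_nat.
by rewrite /sievewt !logmon_neg // !mulr0 addr0.
Qed.

Definition lam K := selberg k%:R (primes_in D K) (sieveY K).

Let uz := primes_in_uniq 0 D.
Let hz := @primes_in_prime 0 D.

Lemma sieve_upper : 2 * k%:R ^+ 2 < D%:R :> R -> exists2 C : R, 0 <= C &
  forall K (L := ln K%:R), (0 < K)%N -> 1 <= L ->
  L * pairsum (size (primes_in D K)) (lam K) (lam K) (maskwt (fun p => k%:R / p%:R) (primes_in D K))
   * (1 - 2 * k%:R ^+ 2 / D%:R)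
  <= density (primes_in 0 D) ^+ k * Icoef k beta * L ^+ (k + 3) + C * L ^+ (k + 2).
Proof.
move=> k2D; have [C C0 h] := main_upper k uz hz beta0.
exists C => // K L K0 L1.
apply: le_trans (h K K0 L1); rewrite -/L.
have L0 : 0 <= L by lra.
rewrite -mulrA; apply: ler_wpM2l => //.
have hk : {in primes_in D K, forall p, (k < p)%N} by move=> p /(primes_in_gt kD); lia.
have up := selberg_upper K0 (primes_in_uniq D K) (@primes_in_prime D K) k0 hk
  (sieveY_antitone K) (sieveY_supported K0).
have sE : (fun n => sieveY K n ^+ 2) = loglift K (fun u => sievewt beta L u ^+ 2).
  by apply: functional_extensionality => n; rewrite /sieveY /loglift; case: ifP => // _; rewrite expr0n.
rewrite sE iter_dilsum_lift lift1 -/L in up.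
have D0 : 0 < D%:R :> R by rewrite ltr0n; lia.
have l0 : 0 <= 1 - 2 * k%:R ^+ 2 / D%:R :> R by rewrite subr_ge0 ler_pdivrMr // mul1r ltW.
apply: (le_trans (ler_wpM2r l0 up)).
rewrite mulrAC -[leRHS]mul1r; apply: ler_wpM2r; last exact: lossfactor_le.
have : 0 <= iter k (dilsum K (primes_in D K)) (fun n => sieveY K n ^+ 2) 1.
  by apply: iter_dilsum_ge0 => n; exact: sqr_ge0.
by rewrite sE iter_dilsum_lift lift1.
Qed.

(** Supplies the [S] of [selberg_error_le] as a power of log K. *)
Lemma sieve_norm : 2 * k%:R ^+ 2 < D%:R :> R -> exists2 C : R, 0 <= C &
  forall K (L := ln K%:R), (0 < K)%N -> 1 <= L ->
  sqfsum (fun p => k%:R / (p%:R - k%:R)) (primes_in D K) (sieveY K) <= C * L ^+ k.+1.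
Proof.
move=> k2D; have [C C0 h] := main_crude k uz hz beta0.
have D0 : 0 < D%:R :> R by rewrite ltr0n; lia.
set l : R := 1 - 2 * k%:R ^+ 2 / D%:R.
have l0 : 0 < l by rewrite subr_gt0 ltr_pdivrMr // mul1r.
exists (C / l); first by rewrite divr_ge0 // ltW.
move=> K L K0 L1.
have hk : {in primes_in D K, forall p, (k < p)%N} by move=> p /(primes_in_gt kD); lia.
have up := sqfsum_main_le K0 (primes_in_uniq D K) (@primes_in_prime D K) hk
  (sieveY_antitone K) (sieveY_supported K0).
apply: (le_trans up); rewrite /sieveY iter_dilsum_lift lift1 -/L.
have := h K K0 L1; rewrite -/L; set A := iter _ _ _ _ => hA.
rewrite mulrAC ler_pdivlMr // mulrAC.
apply: le_trans hA; rewrite -[leRHS]mul1r; apply: ler_wpM2r; last exact: lossfactor_le.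
have : 0 <= iter k (dilsum K (primes_in D K)) (sieveY K) 1.
  by apply: iter_dilsum_ge0; exact: (sieveY_antitone K).1.
by rewrite /sieveY iter_dilsum_lift lift1.
Qed.

Lemma sieve_lower i : k = i.+1 -> (0 < i)%N -> exists2 C : R, 0 <= C &
  forall K (L := ln K%:R), (0 < K)%N -> 1 <= L ->
  density (primes_in 0 D) ^+ (i + 2) * Jcoef i beta * L ^+ (i + 5) - C * L ^+ (i + 4)
  <= L * pairsum (size (primes_in D K)) (lam K) (lam K)
       (maskwt (fun p => i%:R / (p%:R - 1)) (primes_in D K)).
Proof.
move=> ki i0; have [C C0 h] := main_lower i uz hz beta0.
exists C => // K L K0 L1.
apply: (le_trans (h K K0 L1)); rewrite -/L.
have L0 : 0 <= L by lra.
apply: ler_wpM2l => //.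
have hk : {in primes_in D K, forall p, (i.+1 < p)%N} by move=> p /(primes_in_gt kD); lia.
have := selberg_lower K0 (primes_in_uniq D K) (@primes_in_prime D K) i0 hk
  (sieveY_antitone K) (sieveY_supported K0).
rewrite -ki -/(lam K) /sieveY dilsum_lift.
rewrite (_ : (fun n => loglift K _ n ^+ 2) = loglift K (fun u =>
  logsum K (coprimes (primes_in 0 D)) (sievewt beta L) u ^+ 2)); last first.
  by apply: functional_extensionality => n; rewrite /loglift; case: ifP => // _; rewrite expr0n.
by rewrite iter_dilsum_lift lift1.
Qed.

End Fixed.

Lemma harmonic_le X : (0 < X)%N -> harmonic R X <= 1 + ln X%:R.
Proof.
move=> X0; have /andP[_ h] := logsum_all 0 X0 (lexx _).
have l0 := ln_nat_ge0 X; have [l1 _ _ _] := logmon_small l0.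
rewrite l1 logmon0E // addrC in h; apply: le_trans h.
rewrite /harmonic /logsum !big_nat le_eqVlt; apply/orP; left; apply/eqP.
apply: eq_bigr => m /andP[m1 mX]; rewrite logmon0E ?mul1r // subr_ge0.
by apply: ler_ln; rewrite ?ltr0n // ler_nat.
Qed.

End SieveEstimates.

(** * Residue classes and sums over arithmetic progressions *)

Section Residues.
Implicit Types (hs ps : seq nat) (m : bitseq).

Definition hits hs n p : bool := has (fun h => p %| n + h) hs.

Lemma dvdn_shift_inj p n h h' D : h <= D -> h' <= D -> D < p ->
  p %| n + h -> p %| n + h' -> h = h'.
Proof.
move=> hD hD' pD; wlog le_hh : h h' hD hD' / h <= h'.
  by move=> H; case: (leqP h h') => hh d1 d2; [|apply: esym]; apply: H => //; exact: ltnW.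
move=> d1 d2; have := dvdn_sub d2 d1; rewrite subnDl => d.
case: (posnP (h' - h)) => [|h0]; first by lia.
by have := dvdn_leq h0 d; lia.
Qed.

Lemma hits_sum hs n p D : uniq hs -> {in hs, forall h, h <= D} -> D < p ->
  (hits hs n p : nat) = \sum_(h <- hs) (p %| n + h).
Proof.
move=> uh hD pD; elim: hs uh hD => [|h hs IH] /=; first by rewrite big_nil.
move=> /andP[hhs uh] hD; rewrite big_cons -IH //; last first.
  by move=> h' h'hs; apply: hD; rewrite inE h'hs orbT.
rewrite /hits /=; case: (boolP (p %| n + h)) => //= ph; case: hasP => // -[h' h'hs ph'].
suff E : h = h' by rewrite E h'hs in hhs.
apply: (dvdn_shift_inj _ _ pD ph ph'); first by apply: hD; rewrite mem_head.
by apply: hD; rewrite inE h'hs orbT.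
Qed.

Lemma maskprod_gt0 ps m : {in ps, forall p, prime p} -> 0 < maskprod ps m.
Proof.
move=> hp; rewrite /maskprod big_seq; elim/big_ind: _ => // [x y|p].
  by rewrite muln_gt0 => -> ->.
by move=> /mem_mask /hp /prime_gt0.
Qed.

Lemma coprime_maskprod p ps m : prime p -> {in ps, forall q, prime q} -> p \notin ps ->
  coprime p (maskprod ps m).
Proof.
move=> pp hp pps; rewrite /maskprod big_seq; elim/big_ind: _ => [|x y cx cy|q /mem_mask qs].
- exact: coprimen1.
- by rewrite coprimeMr cx cy.
rewrite prime_coprime // dvdn_prime2 ?(hp q qs) //; by apply: contra pps => /eqP ->.
Qed.

(** Chinese remainders, one prime of the mask at a time: p | n + h fixes n modulo p, so each prime
    multiplies the number of classes by [size hs]. By the last clause a shift h' outside [hs] stays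
    prime to the modulus, because no p > D divides both n + h and n + h'; this is what makes (A)
    applicable to n + h'. *)
Lemma residue_system hs D W b ps m : uniq hs -> {in hs, forall h, h <= D} ->
  0 < W -> b < W -> uniq ps -> {in ps, forall p, [/\ prime p, D < p & coprime p W]} ->
  size m = size ps ->
  exists rs : seq nat, [/\ size rs = size hs ^ count id m,
    {in rs, forall a, a < W * maskprod ps m},
    forall n, ((n %% W == b) && all (hits hs n) (mask m ps) : nat)
      = \sum_(a <- rs) (n %% (W * maskprod ps m) == a) &
    forall h', h' <= D -> h' \notin hs -> coprime (b + h') W ->
      {in rs, forall a, coprime (a + h') (W * maskprod ps m)}].
Proof.
move=> uh hD W0 bW; elim: ps m => [|p ps IH] [|c m] //= ups hp => [_|[sm]].
  exists [:: b]; rewrite /maskprod /= big_nil muln1; split => // [a|n|h' _ _ cb a].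
  - by rewrite inE => /eqP ->.
  - by rewrite big_seq1 andbT.
  - by rewrite inE => /eqP ->.
case/andP: ups => pps ups.
have hp' : {in ps, forall p, [/\ prime p, D < p & coprime p W]}.
  by move=> q qs; apply: hp; rewrite inE qs orbT.
have [pp pD pW] := hp p (mem_head _ _).
have hpr : {in ps, forall p, prime p} by move=> q /hp' [].
have [rs [s1 s2 s3 s4]] := IH m ups hp' sm.
case: c => /=; last by exists rs; split.
rewrite maskprod_true; set q := W * maskprod ps m in s2 s3 s4.
have -> : W * (p * maskprod ps m) = q * p by rewrite /q mulnCA mulnC.
have q0 : 0 < q by rewrite muln_gt0 W0 maskprod_gt0.
have p0 := prime_gt0 pp.
have qp0 : 0 < q * p by rewrite muln_gt0 q0.
have cqp : coprime q p.
  by rewrite coprime_sym /q coprimeMr pW coprime_maskprod.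
(* [h * p.-1] represents -h modulo p. *)
pose r a h := chinese q p a (h * p.-1) %% (q * p).
have rE n a h : a < q -> (n %% (q * p) == r a h) = (n %% q == a) && (p %| n + h).
  move=> aq; rewrite /r chinese_remainder //.
  rewrite chinese_modl // chinese_modr // (modn_small aq); congr (_ && _).
  rewrite -(eqn_modDr h) (_ : h * p.-1 + h = h * p); last by rewrite -mulnSr prednK.
  by rewrite modnMl.
exists [seq r a h | a <- rs, h <- hs]; split.
- by rewrite size_allpairs s1 expnS mulnC.
- by move=> x /allpairsP[[a h] [_ _ ->]]; rewrite ltn_mod.
- move=> n; rewrite big_allpairs_dep big_seq.
  rewrite (eq_bigr (fun a => (n %% q == a) * hits hs n p)); last first.
    move=> a /s2 aq; rewrite (hits_sum n uh hD pD) big_distrr /=.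
    by apply: eq_bigr => h _; rewrite rE // mulnb.
  by rewrite -big_seq -big_distrl /= -s3 mulnb -andbA; congr (nat_of_bool (_ && _)); rewrite andbC.
move=> h' hD' hhs cb x /allpairsP[[a h] [/= ars hhs' ->]].
have aq := s2 a ars.
have /andP[/eqP e1 e2] : (r a h %% q == a) && (p %| r a h + h).
  by rewrite -rE // modn_mod.
rewrite coprimeMr; apply/andP; split.
  by rewrite -coprime_modl -modnDml e1 coprime_modl; exact: s4.
rewrite coprime_sym prime_coprime //; apply/negP => e3.
have E := dvdn_shift_inj (hD h hhs') hD' pD e2 e3.
by rewrite -E hhs' in hhs.
Qed.

(** The ceiling of (x - a) / q, written so as to stay correct for x < a. *)
Lemma count_residue q a x : a < q -> \sum_(0 <= n < x) (n %% q == a) = (x + (q - a).-1) %/ q.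
Proof.
move=> aq; have q0 : 0 < q by lia.
elim: x => [|x IH]; first by rewrite big_geq // divn_small //; lia.
rewrite big_nat_recr //= IH addSn divnS // addnC; congr (nat_of_bool _ + _).
rewrite (_ : (x + (q - a).-1).+1 = x + (q - a)); last by lia.
have -> : (x %% q == a) = (x == a %[mod q]) by rewrite (modn_small aq).
by rewrite -(eqn_modDr (q - a)) subnKC ?modnn // ltnW.
Qed.

End Residues.

(** * Sums of 1, log p and lambda over a residue class *)

Section ClassSums.
Local Open Scope ring_scope.
Implicit Types (hs ps : seq nat) (m : bitseq) (w : nat -> R).

Lemma flP (x : R) : 0 <= x -> (fl x)%:R <= x < (fl x)%:R + 1.
Proof.
move=> x0; rewrite /fl; have [h1 h2] := base_Int_part x.
have z0 : Z.le 0 (Int_part x).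
  apply/Z.lt_succ_r/lt_IZR; rewrite succ_IZR.
  by move/RleP: x0 => x0; move: h1 h2; rewrite -R0E in x0; Lra.lra.
have e : (Z.to_nat (Int_part x))%:R = IZR (Int_part x).
  by rewrite -INRE INR_IZR_INZ Znat.Z2Nat.id.
rewrite e; apply/andP; split; first exact/RleP.
apply/RltP; rewrite -[(_ + 1)]/(Rplus _ 1) -R1E; Lra.lra.
Qed.

Lemma fl_addn (x : R) n : 0 <= x -> fl (x + n%:R) = (fl x + n)%N.
Proof.
move=> x0; have /andP[a1 a2] := flP x0.
have /andP[b1 b2] := flP (addr_ge0 x0 (ler0n _ n)).
apply/eqP; rewrite eqn_leq -ltnS -[X in _ && X]ltnS -!(ltr_nat R) -!natr1 natrD.
by apply/andP; split; lra.
Qed.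

Lemma bigRmax_ge (I : eqType) (r : seq I) (P : pred I) (F : I -> R) i :
  i \in r -> P i -> F i <= \big[Rmax/0]_(j <- r | P j) F j.
Proof.
elim: r => [|j r IH] //; rewrite inE big_cons => /orP[/eqP <- ->|ir Pi].
  by rewrite RmaxE le_max lexx.
by case: ifP => _; rewrite ?RmaxE ?le_max IH ?orbT.
Qed.

Lemma bigRmax_le (I : Type) (r : seq I) (P : pred I) (F : I -> R) x :
  0 <= x -> (forall i, P i -> F i <= x) -> \big[Rmax/0]_(j <- r | P j) F j <= x.
Proof.
move=> x0 h; elim/big_rec: _ => // i y Pi yx.
by rewrite RmaxE ge_max h.
Qed.

Lemma bigRmax_ge0 (I : Type) (r : seq I) (P : pred I) (F : I -> R) :
  0 <= \big[Rmax/0]_(j <- r | P j) F j.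
Proof. by elim/big_rec: _ => // i y _ y0; rewrite RmaxE le_max y0 orbT. Qed.

Definition logprime (n : nat) : R := if prime n then ln n%:R else 0.

Lemma logprime_ge0 n : 0 <= logprime n.
Proof. by rewrite /logprime; case: ifP => // _; exact: ln_nat_ge0. Qed.

Lemma theta_apE N q a :
  theta_ap N q a = \sum_(0 <= x < (fl N).+1 | (x %% q == a)%N) logprime x.
Proof.
rewrite /theta_ap big_mkord big_mkcondl /=; apply: eq_bigr => i _.
by rewrite /logprime INRE.
Qed.

Lemma lambda_apE y q a : lambda_ap y q a = \sum_(1 <= x < y.+1 | (x %% q == a)%N) liouville x.
Proof. by []. Qed.

Lemma liouville_norm n : `|liouville n| = 1.
Proof. by rewrite /liouville RpowE normrX normrN1 expr1n. Qed.

Lemma count_residue_bounds q a x : (a < q)%N ->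
  x%:R / q%:R - 1 <= \sum_(0 <= n < x | (n %% q == a)%N) (1 : R) <= x%:R / q%:R + 1.
Proof.
move=> aq; have q0 : 0 < q%:R :> R by rewrite ltr0n; lia.
have -> : \sum_(0 <= n < x | (n %% q == a)%N) (1 : R) = ((x + (q - a).-1) %/ q)%N%:R.
  rewrite -count_residue // natr_sum big_mkcond /=; apply: eq_bigr => n _.
  by case: eqP.
set s := (q - a).-1; have sq : (s < q)%N by rewrite /s; lia.
set c := ((x + s) %/ q)%N.
have e1 : (c * q <= x + s)%N by exact: leq_trunc_div.
have e2 : (x + s < c.+1 * q)%N by rewrite ltn_ceil //; lia.
have e1' : c%:R * q%:R <= x%:R + q%:R :> R by rewrite -natrM -natrD ler_nat; lia.
have e2' : x%:R <= (c%:R + 1) * q%:R :> R by rewrite natr1 -natrM ler_nat; lia.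
rewrite lerBlDr ler_pdivrMr // e2' /= -(ler_pM2r q0) mulrDl divfK ?mul1r //.
exact: lt0r_neq0.
Qed.

Lemma maskwt_bool (b : pred nat) ps m :
  maskwt (fun p => (b p)%:R : R) ps m = (all b (mask m ps))%:R.
Proof.
elim: ps m => [|p ps IH] [|c m].
- 1-3: by rewrite /maskwt ?mask0 ?mask0s /= ?big_nil.
case: c; last by rewrite maskwt_false IH.
by rewrite maskwt_true IH /= -natrM mulnb.
Qed.

(** The condition that d, the product of the mask, divides the product of the n + h is written as a
    product of 0-1 factors, the shape required by [pairsum_square]. *)
Definition classsum M0 M w W b hs ps m : R :=
  \sum_(M0 <= n < M.+1 | (n %% W == b)%N) w n * maskwt (fun p => (hits hs n p)%:R) ps m.

Lemma classsum_residues M0 M w W b hs ps m (rs : seq nat) q :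
  (forall n, ((n %% W == b) && all (hits hs n) (mask m ps) : nat)
     = \sum_(a <- rs) (n %% q == a))%N ->
  classsum M0 M w W b hs ps m = \sum_(a <- rs) \sum_(M0 <= n < M.+1 | (n %% q == a)%N) w n.
Proof.
move=> h; rewrite /classsum.
under [RHS]eq_bigr do rewrite big_mkcond /=.
rewrite exchange_big /= big_mkcond /=; apply: eq_bigr => n _.
rewrite maskwt_bool.
transitivity (w n * ((n %% W == b)%N && all (hits hs n) (mask m ps))%:R).
  by case: eqP => _ /=; rewrite ?mulr0.
rewrite h natr_sum mulr_sumr; apply: eq_bigr => a _; case: eqP => _; by rewrite ?mulr1 ?mulr0.
Qed.

Lemma sum_geq_nat (M0 M : nat) (P : pred nat) w : (M0 <= M)%N ->
  \sum_(0 <= n < M | P n) w n = \sum_(0 <= n < M0 | P n) w n + \sum_(M0 <= n < M | P n) w n.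
Proof. by move=> h; rewrite (big_cat_nat (n := M0)). Qed.

Lemma class_count M0 (N : R) q a : 0 <= N -> (M0 <= (fl N).+1)%N -> (a < q)%N ->
  `|\sum_(M0 <= n < (fl N).+1 | (n %% q == a)%N) (1 : R) - N / q%:R| <= M0%:R + 2.
Proof.
move=> N0 M0M aq; have /andP[f1 f2] := flP N0.
have q1 : 1 <= q%:R :> R by rewrite ler1n; lia.
have /andP[h1 h2] := count_residue_bounds (fl N).+1 aq.
have /(_ (fun=> 1)) := sum_geq_nat (fun n => (n %% q == a)%N) _ M0M.
move: h1 h2; set A := \sum_(0 <= n < _ | _) _; set B := \sum_(0 <= n < M0 | _) _.
set C := \sum_(M0 <= n < _ | _) _ => h1 h2 e.
have B1 : 0 <= B <= M0%:R.
  rewrite sumr_ge0 //=; apply: (le_trans (y := \sum_(0 <= n < M0) (1 : R))).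
    by rewrite /B big_mkcond; apply: ler_sum => i _; case: ifP.
  by rewrite big_const_nat subn0 iter_addr_0.
have NV : (fl N).+1%:R / q%:R - 1 <= N / q%:R <= (fl N).+1%:R / q%:R.
  have i0 : 0 <= q%:R^-1 :> R by rewrite invr_ge0; lra.
  have i1 : q%:R^-1 <= 1 :> R by rewrite invf_le1; lra.
  rewrite -natr1; apply/andP; split; last by rewrite ler_wpM2r // ltW.
  by rewrite mulrDl mul1r; have := ler_wpM2r i0 f1; lra.
rewrite ler_norml; lra.
Qed.

Lemma class_shift M0 M q a h w : (a < q)%N ->
  \sum_(M0 <= n < M.+1 | (n %% q == a)%N) w (n + h)%N
  = \sum_(M0 + h <= x < (M + h).+1 | (x %% q == (a + h) %% q)%N) w x.
Proof.
move=> aq; rewrite -addSn big_addn addnK; apply: eq_bigl => n.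
by rewrite eqn_modDr (modn_small aq).
Qed.

Lemma class_theta M0 (N : R) q a h : 0 <= N -> (M0 <= (fl N).+1)%N -> (a < q)%N ->
  `|\sum_(M0 <= n < (fl N).+1 | (n %% q == a)%N) logprime (n + h)
    - theta_ap (N + h%:R) q ((a + h) %% q)%N| <= \sum_(0 <= x < M0 + h) logprime x.
Proof.
move=> N0 M0M aq; rewrite class_shift // theta_apE fl_addn //.
rewrite (@sum_geq_nat (M0 + h) (fl N + h).+1 _ logprime); last by lia.
rewrite opprD addrA addrAC subrr add0r normrN ger0_norm; last first.
  by apply: sumr_ge0 => n _; exact: logprime_ge0.
by rewrite big_mkcond; apply: ler_sum => n _; case: ifP => // _; exact: logprime_ge0.
Qed.

(** An interval sum is a difference of two initial sums, and the maximum over y in (B) covers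
    both. *)
Lemma class_lambda M0 (N : R) q a h : 0 <= N -> (0 < M0 <= (fl N).+1)%N -> (a < q)%N ->
  `|\sum_(M0 <= n < (fl N).+1 | (n %% q == a)%N) liouville (n + h)|
  <= `|lambda_ap (fl N + h) q ((a + h) %% q)%N| + `|lambda_ap (M0 + h).-1 q ((a + h) %% q)%N|.
Proof.
move=> N0 M0M aq; rewrite class_shift // !lambda_apE prednK; last by lia.
rewrite (@big_cat_nat _ _ _ (M0 + h) 1 (fl N + h).+1) /=; [|lia|lia].
set A := \sum_(1 <= i < _ | _) _; set B := \sum_(_ <= i < _ | _) _.
have := ler_normB (A + B) A; rewrite (_ : A + B - A = B) //; ring.
Qed.

Lemma theta_ap_triv (N : R) q a : 1 <= N -> (a < q)%N ->
  0 <= theta_ap N q a <= ln N * (N / q%:R + 2).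
Proof.
move=> N1 aq; rewrite theta_apE; have N0 : 0 <= N by lra.
have /andP[f1 f2] := flP N0.
have q1 : 1 <= q%:R :> R by rewrite ler1n; lia.
have lN : 0 <= ln N by rewrite -ln1 ler_ln.
rewrite sumr_ge0 /=; last by move=> i _; exact: logprime_ge0.
apply: (le_trans (y := ln N * \sum_(0 <= n < (fl N).+1 | (n %% q == a)%N) (1 : R))).
  rewrite mulr_sumr big_nat_cond [leRHS]big_nat_cond; apply: ler_sum => n /andP[/andP[_ nN] _].
  rewrite mulr1 /logprime; case: ifP => // pn.
  apply: ler_ln; first by rewrite ltr0n prime_gt0.
  by apply: le_trans f1; rewrite ler_nat.
apply: ler_wpM2l => //; have /andP[_ h2] := count_residue_bounds (fl N).+1 aq.
apply: (le_trans h2); rewrite -natr1 mulrDl mul1r.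
have i0 : 0 <= q%:R^-1 :> R by rewrite invr_ge0; lra.
have i1 : q%:R^-1 <= 1 :> R by rewrite invf_le1; lra.
by have := ler_wpM2r i0 f1; lra.
Qed.

Lemma lambda_ap_triv (N : R) y q a : y%:R <= N -> (a < q)%N ->
  `|lambda_ap y q a| <= N / q%:R + 2.
Proof.
move=> yN aq; rewrite lambda_apE.
have q1 : 1 <= q%:R :> R by rewrite ler1n; lia.
apply: (le_trans (ler_norm_sum _ _ _)).
rewrite (eq_bigr (fun=> 1)); last by move=> n _; exact: liouville_norm.
have /andP[_ h2] := count_residue_bounds y.+1 aq.
have h3 := @sum_geq_nat 1 y.+1 (fun n => (n %% q == a)%N) (fun=> 1) isT.
have h4 : 0 <= \sum_(0 <= n < 1 | (n %% q == a)%N) (1 : R) by apply: sumr_ge0.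
have i0 : 0 <= q%:R^-1 :> R by rewrite invr_ge0; lra.
have i1 : q%:R^-1 <= 1 :> R by rewrite invf_le1; lra.
have h5 := ler_wpM2r i0 yN.
by move: h2; rewrite h3 -natr1 mulrDl mul1r; lra.
Qed.

End ClassSums.

(** * Expansion of the sieve sums *)

Section Expansion.
Local Open Scope ring_scope.
Implicit Types (hs ps : seq nat) (m : bitseq) (w : nat -> R).

Lemma sumr_const_seq (T : Type) (s : seq T) (x : R) : \sum_(a <- s) x = (size s)%:R * x.
Proof. by rewrite big_const_seq count_predT iter_addr_0 mulr_natl. Qed.

Definition errA (N : R) q : R :=
  \big[Rmax/0]_(a < q | coprime a q) Rabs (theta_ap N q a - N / INR (totient q)).

Definition errB (N : R) q : R :=
  \big[Rmax/0]_(y < (fl N).+1) \big[Rmax/0]_(a < q) Rabs (lambda_ap y q a).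

Lemma errA_ge (N : R) q a : (a < q)%N -> coprime a q ->
  `|theta_ap N q a - N / (totient q)%:R| <= errA N q.
Proof.
move=> aq caq; rewrite -RabsE -INRE.
exact: (@bigRmax_ge _ _ (fun a : 'I_q => coprime a q)
  (fun a : 'I_q => Rabs (theta_ap N q a - N / INR (totient q))) (Ordinal aq) (mem_index_enum _)).
Qed.

Lemma errB_ge (N : R) q a y : (y <= fl N)%N -> (a < q)%N -> `|lambda_ap y q a| <= errB N q.
Proof.
move=> yN aq; rewrite -RabsE.
apply: (le_trans (y := \big[Rmax/0]_(a < q) Rabs (lambda_ap y q a))).
  exact: (@bigRmax_ge _ _ xpredT (fun a : 'I_q => Rabs (lambda_ap y q a)) (Ordinal aq)
    (mem_index_enum _)).
have yN' : (y < (fl N).+1)%N by [].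
exact: (@bigRmax_ge _ _ xpredT (fun y : 'I_(fl N).+1 => \big[Rmax/0]_(a < q) Rabs (lambda_ap y q a))
  (Ordinal yN') (mem_index_enum _)).
Qed.

Lemma totient_maskprod W ps m : uniq ps -> {in ps, forall p, prime p && coprime p W} ->
  size m = size ps ->
  (totient (W * maskprod ps m))%:R = (totient W)%:R * maskwt (fun p => p%:R - 1) ps m :> R.
Proof.
elim: ps m => [|p ps IH] [|c m] //= ups hp => [_|[sm]].
  by rewrite /maskprod /maskwt /= !big_nil muln1 mulr1.
case/andP: ups => pps ups.
have hp' : {in ps, forall p, prime p && coprime p W}.
  by move=> q qs; apply: hp; rewrite inE qs orbT.
have /andP[pp pW] := hp p (mem_head _ _).
case: c; last by rewrite maskwt_false -IH.
rewrite maskprod_true maskwt_true mulnCA totient_coprime ?natrM ?IH //; last first.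
  by rewrite coprimeMr pW coprime_maskprod // => q /hp' /andP[].
rewrite totient_prime // -subn1 natrB ?prime_gt0 //; ring.
Qed.

Lemma leq_addn_pred x y z : (x <= y.+1)%N -> ((x + z).-1 <= y + z)%N.
Proof. lia. Qed.

Section Fixed.
Variables (hs : seq nat) (D : nat) (beta : R) (K M0 : nat) (N : R) (b : nat).
Let k := size hs.
Let ps := primes_in D K.
Let W := (\prod_(p <- primes_in 0 D) p)%N.
Let L : R := ln K%:R.
Hypotheses (uh : uniq hs) (hD : {in hs, forall h, (h <= D)%N}) (k2 : (2 <= k)%N)
  (kD : (2 * k <= D)%N) (beta0 : 0 <= beta) (K0 : (0 < K)%N)
  (N0 : 0 <= N) (M01 : (0 < M0)%N) (M0N : (M0 <= (fl N).+1)%N) (bW : (b < W)%N)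
  (cb : {in hs, forall h, coprime (b + h) W}).

Let k0 : (0 < k)%N. Proof. exact: leq_trans k2. Qed.

Definition sieveweight n : R :=
  masksum (size ps) (fun m => lam k D beta K m * maskwt (fun p => (hits hs n p)%:R) ps m) ^+ 2.

Let W0 : (0 < W)%N.
Proof.
rewrite /W big_seq; elim/big_ind: _ => // [x y|p]; first by rewrite muln_gt0 => -> ->.
by move=> /primes_in_prime /prime_gt0.
Qed.

Let psP p : p \in ps -> [/\ prime p, (D < p)%N & coprime p W].
Proof.
rewrite mem_primes_in => /and3P[pp pD _]; split=> //.
rewrite /W big_seq; elim/big_ind: _ => [|x y cx cy|q].
- exact: coprimen1.
- by rewrite coprimeMr cx cy.
rewrite mem_primes_in => /and3P[pq _ qD]; rewrite prime_coprime // dvdn_prime2 //.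
by rewrite neq_ltn (leq_ltn_trans qD pD) orbT.
Qed.

Let ps_prime : {in ps, forall p, prime p}. Proof. exact: primes_in_prime. Qed.
Let ps_uniq : uniq ps. Proof. exact: primes_in_uniq. Qed.

Lemma sieve_square w :
  \sum_(M0 <= n < (fl N).+1 | (n %% W == b)%N) w n * sieveweight n
  = pairsum (size ps) (lam k D beta K) (lam k D beta K) (classsum M0 (fl N) w W b hs ps).
Proof.
rewrite /classsum pairsum_sum; apply: eq_bigr => n _; rewrite pairsumZ; congr (_ * _).
by rewrite pairsum_square // => p _; rewrite -natrM mulnb andbb.
Qed.

(** Common form of the three sums: x g(d) is the expected value of the class sum for d, and e(d)
    bounds the error of each of its at most k ^ omega(d) residue classes. Together with the 8 ^
    omega(d) from pairs with given lcm, this makes the weight (8 k) ^ omega(d). *)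
Lemma sieve_expand (F : bitseq -> R) g (x S T V : R) (e : nat -> R) :
  sqfsum (fun p => k%:R / (p%:R - k%:R)) ps (sieveY beta K) <= S ->
  0 < T -> 0 <= V -> (forall n, 0 <= e n) ->
  (forall m, size m = size ps ->
    `|F m - x * maskwt g ps m| <= k%:R ^+ count id m * e (maskprod ps m)) ->
  (forall m, size m = size ps -> (maskprod ps m <= K ^ 2)%N ->
     e (maskprod ps m) <= V * 2 ^+ count id m / (maskprod ps m)%:R) ->
  `|pairsum (size ps) (lam k D beta K) (lam k D beta K) F
    - x * pairsum (size ps) (lam k D beta K) (lam k D beta K) (maskwt g ps)|
  <= S ^+ 2 * (T * \sum_(1 <= n < (K ^ 2).+1) e n
       + V / T * harmonic R (K ^ 2) ^+ (2 * (8 * k) ^ 2)).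
Proof.
move=> hS T0 V0 e0 he hV.
have -> : pairsum (size ps) (lam k D beta K) (lam k D beta K) F
    - x * pairsum (size ps) (lam k D beta K) (lam k D beta K) (maskwt g ps)
  = pairsum (size ps) (lam k D beta K) (lam k D beta K) (fun m => F m + (- x) * maskwt g ps m).
  by rewrite pairsum_lin mulNr.
have hk : {in ps, forall p, (2 * k <= p)%N} by move=> p; exact: (primes_in_gt kD).
rewrite /lam -/ps.
have E := selberg_error_le (fun m => F m + (- x) * maskwt g ps m) ps_uniq ps_prime k0 hk
  (sieveY_antitone beta0 K) (sieveY_supported beta K0) hS.
apply: (le_trans E).
apply: ler_wpM2l; first exact: sqr_ge0.
have X0 : (0 < K ^ 2)%N by rewrite expn_gt0 K0.
apply: le_trans (mask_error_le (8 * k) X0 ps_uniq ps_prime e0 T0 V0 hV).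
apply: ler_masksum => m sm; apply: ler_wpM2l => //.
rewrite natrM exprMn -mulrA; apply: ler_wpM2l; first exact: exprn_ge0.
by rewrite mulNr; exact: he.
Qed.

Let maskd0 m : 0 < (maskprod ps m)%:R :> R.
Proof. by rewrite ltr0n maskprod_gt0. Qed.

Lemma class_one m : size m = size ps ->
  `|classsum M0 (fl N) (fun=> 1) W b hs ps m - N / W%:R * maskwt (fun p => k%:R / p%:R) ps m|
  <= k%:R ^+ count id m * (M0%:R + 2).
Proof.
move=> sm; have [rs [s1 s2 s3 _]] := residue_system uh hD W0 bW ps_uniq (@psP) sm.
rewrite (classsum_residues _ _ _ s3).
have -> : N / W%:R * maskwt (fun p => k%:R / p%:R) ps m
    = \sum_(a <- rs) N / (W * maskprod ps m)%:R.
  rewrite sumr_const_seq s1 (maskwtM (fun=> k%:R)) maskwt_const // maskwt_natV natrX.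
  by rewrite natrM invfM -/k; ring.
rewrite -sumrB; apply: (le_trans (ler_norm_sum _ _ _)).
have -> : k%:R ^+ count id m * (M0%:R + 2) = \sum_(a <- rs) (M0%:R + 2) :> R.
  by rewrite sumr_const_seq s1 natrX.
by rewrite big_seq [leRHS]big_seq; apply: ler_sum => a /s2 aq; exact: class_count.
Qed.

(** The main term is zero and is written as a multiple [0 * ...] to fit [sieve_expand]. *)
Lemma class_liouville m h : size m = size ps ->
  `|classsum M0 (fl N) (fun n => liouville (n + h)) W b hs ps m - 0 * maskwt (fun=> 1) ps m|
  <= k%:R ^+ count id m * (2 * errB (N + h%:R) (W * maskprod ps m)).
Proof.
move=> sm; have [rs [s1 s2 s3 _]] := residue_system uh hD W0 bW ps_uniq (@psP) sm.
rewrite (classsum_residues _ _ _ s3) mul0r subr0; apply: (le_trans (ler_norm_sum _ _ _)).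
set q := (W * maskprod ps m)%N in s2 s3 *.
have -> : k%:R ^+ count id m * (2 * errB (N + h%:R) q) = \sum_(a <- rs) (2 * errB (N + h%:R) q).
  by rewrite sumr_const_seq s1 natrX.
rewrite big_seq [leRHS]big_seq; apply: ler_sum => a /s2 aq.
have q0 : (0 < q)%N by exact: leq_ltn_trans aq.
have aq' : ((a + h) %% q < q)%N by rewrite ltn_mod.
apply: (le_trans (class_lambda h N0 _ aq)); first by rewrite M01.
have -> : forall z : R, 2 * z = z + z by move=> z; ring.
by apply: lerD; apply: errB_ge => //; rewrite fl_addn // leq_addn_pred.
Qed.

(** When n + h is prime, a prime p divides it only if n + h = p. So [h] is first removed from the
    tuple, after which n + h runs through classes prime to the modulus and (A) applies ([A1]).
    Removing [h] costs one n, namely p - h, for each prime p of the mask, with log p <= L ([A2]).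
    The number of these primes is at most 2 ^ omega(d) <= k ^ omega(d), so this fits the same error
    shape. *)
Lemma class_logprime m h : size m = size ps -> h \in hs ->
  `|classsum M0 (fl N) (fun n => logprime (n + h)) W b hs ps m
    - (N + h%:R) / (totient W)%:R * maskwt (fun p => k.-1%:R / (p%:R - 1)) ps m|
  <= k%:R ^+ count id m * (errA (N + h%:R) (W * maskprod ps m)
        + (\sum_(0 <= x < M0 + h) logprime x + L)).
Proof.
move=> sm hhs; pose hs' := rem h hs.
have uh' : uniq hs' by exact: rem_uniq.
have hD' : {in hs', forall h, (h <= D)%N} by move=> x /mem_rem; exact: hD.
have hhs' : h \notin hs' by rewrite mem_rem_uniqF.
have s' : size hs' = k.-1 by rewrite size_rem.
have [rs [s1 s2 s3 s4]] := residue_system uh' hD' W0 bW ps_uniq (@psP) sm.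
set q := (W * maskprod ps m)%N in s2 s3 s4 *.
set Th := \sum_(0 <= x < M0 + h) logprime x.
have Th0 : 0 <= Th by apply: sumr_ge0 => x _; exact: logprime_ge0.
have L0 : 0 <= L by exact: ln_nat_ge0.
have q0 : (0 < q)%N by rewrite muln_gt0 W0 maskprod_gt0.
have A1 : `|classsum M0 (fl N) (fun n => logprime (n + h)) W b hs' ps m
    - (N + h%:R) / (totient W)%:R * maskwt (fun p => k.-1%:R / (p%:R - 1)) ps m|
  <= k.-1%:R ^+ count id m * (errA (N + h%:R) q + Th).
  rewrite (classsum_residues _ _ _ s3).
  have -> : (N + h%:R) / (totient W)%:R * maskwt (fun p => k.-1%:R / (p%:R - 1)) ps m
      = \sum_(a <- rs) (N + h%:R) / (totient q)%:R.
    rewrite sumr_const_seq s1 s' natrX (maskwtM (fun=> k.-1%:R)) maskwt_const //.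
    rewrite /q totient_maskprod // => [|p /psP[-> _ ->] //].
    rewrite (_ : maskwt (fun p => (p%:R - 1)^-1) ps m = (maskwt (fun p => p%:R - 1) ps m)^-1).
      by rewrite invfM; ring.
    by rewrite /maskwt; elim: (mask m ps) => [|p s IH]; rewrite ?big_nil ?invr1 // !big_cons IH invfM.
  rewrite -sumrB; apply: (le_trans (ler_norm_sum _ _ _)).
  have -> : k.-1%:R ^+ count id m * (errA (N + h%:R) q + Th)
     = \sum_(a <- rs) (errA (N + h%:R) q + Th).
    by rewrite sumr_const_seq s1 s' natrX.
  rewrite big_seq [leRHS]big_seq; apply: ler_sum => a ars; have aq := s2 a ars.
  have t1 := class_theta h N0 M0N aq.
  have t2 : `|theta_ap (N + h%:R) q ((a + h) %% q)%N - (N + h%:R) / (totient q)%:R| <= errA (N + h%:R) q.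
    apply: errA_ge; first by rewrite ltn_mod.
    by rewrite coprime_modl; apply: s4 => //; [exact: hD|exact: cb].
  set X := \sum_(_ <= n < _ | _) _ in t1 *; set Y := theta_ap _ _ _ in t1 t2.
  have := ler_normD (X - Y) (Y - (N + h%:R) / (totient q)%:R).
  by rewrite addrA subrK /Th; lra.
have A2 : 0 <= classsum M0 (fl N) (fun n => logprime (n + h)) W b hs ps m
    - classsum M0 (fl N) (fun n => logprime (n + h)) W b hs' ps m <= 2 ^+ count id m * L.
  rewrite /classsum -sumrB.
  have pw n : 0 <= maskwt (fun p => (hits hs n p)%:R : R) ps m - maskwt (fun p => (hits hs' n p)%:R) ps m
      <= \sum_(p <- mask m ps) (p %| n + h)%N%:R.
    rewrite !maskwt_bool; elim: (mask m ps) => [|p s IH] /=; first by rewrite big_nil subrr lexx.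
    rewrite big_cons.
    have hE : hits hs n p = (p %| n + h)%N || hits hs' n p.
      apply/hasP/orP => [[x xs px]|[px|/hasP[x xs px]]].
      - case: (eqVneq x h) => [<-|xh]; [by left|right]; apply/hasP; exists x => //.
        by rewrite mem_rem_uniq // inE xh.
      - by exists h.
      - by exists x => //; exact: mem_rem xs.
    have S0 : 0 <= \sum_(j <- s) (j %| n + h)%N%:R :> R by exact: sumr_ge0.
    rewrite hE; move: IH S0; set S := \sum_(j <- s) _ => /andP[i1 i2] S0.
    case: (hits hs' n p); rewrite ?orbT ?orbF /=.
      rewrite i1 /=; apply: (le_trans i2); by rewrite lerDr.
    rewrite subr0; case: (p %| n + h)%N => /=; last by rewrite add0r lexx S0.
    by case: (all _ s); rewrite ?lexx ?ler01 /=; lra.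
  apply/andP; split.
    apply: sumr_ge0 => n _; rewrite -mulrBr mulr_ge0 ?logprime_ge0 //.
    by case/andP: (pw n).
  apply: (le_trans (y := \sum_(p <- mask m ps) \sum_(M0 <= n < (fl N).+1) logprime (n + h) * (p %| n + h)%N%:R)).
    rewrite exchange_big /= big_mkcond /=; apply: ler_sum => n _.
    rewrite -mulr_sumr; case: ifP => _; last first.
      by rewrite mulr_ge0 ?logprime_ge0 // sumr_ge0.
    rewrite -mulrBr ler_wpM2l ?logprime_ge0 //; by case/andP: (pw n).
  apply: (le_trans (y := \sum_(p <- mask m ps) L)).
    rewrite big_seq [leRHS]big_seq; apply: ler_sum => p /mem_mask pps.
    have [pp pD _] := psP pps.
    rewrite (eq_bigr (fun n => if (n == p - h)%N then logprime (n + h) * (p %| n + h)%N%:R else 0)); last first.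
      move=> n _; case: eqP => // nE; rewrite /logprime; case: ifP => pn; last by rewrite mul0r.
      rewrite dvdn_prime2 //; case: eqP => [pE|_]; last by rewrite mulr0.
      by case: nE; rewrite pE addnK.
    rewrite -big_mkcond big_nat1_eq; case: ifP => // _.
    rewrite /logprime; case: ifP => pn; last by rewrite mul0r.
    rewrite (_ : p - h + h = p)%N; last by rewrite subnK // (leq_trans (hD hhs)) // ltnW.
    rewrite dvdnn mulr1; apply: ler_ln; first by rewrite ltr0n prime_gt0.
    by move: pps; rewrite mem_primes_in ler_nat => /and3P[].
  rewrite sumr_const_seq ler_wpM2r //.
  rewrite size_mask // -natrX ler_nat; exact: ltnW (ltn_expl _ _).
have kk1 : k.-1%:R ^+ count id m <= k%:R ^+ count id m :> R.
  by apply: lerXn2r; rewrite ?nnegrE // ler_nat leq_pred.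
have k2k : 2 ^+ count id m <= k%:R ^+ count id m :> R.
  by apply: lerXn2r; rewrite ?nnegrE // ler_nat.
have eA0 : 0 <= errA (N + h%:R) q by exact: bigRmax_ge0.
have B1 := ler_wpM2r (addr_ge0 eA0 Th0) kk1.
have B2 := ler_wpM2r L0 k2k.
move: A1 A2; set X := classsum _ _ _ _ _ hs _ _; set Y := classsum _ _ _ _ _ hs' _ _.
set Z := _ / _ * _ => A1 /andP[A2 A3].
have := ler_normD (X - Y) (Y - Z); rewrite addrA subrK (ger0_norm A2).
lra.
Qed.

(** The factor 2 ^ omega(d) comes from N / phi(q), as p - 1 >= p / 2. The rounding error 2 in the
    count of a class is at most 2 N' / d, since d <= K ^ 2 <= N. *)
Lemma errA_triv m h : size m = size ps -> (maskprod ps m <= K ^ 2)%N -> (K ^ 2)%:R <= N -> 1 <= N ->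
  errA (N + h%:R) (W * maskprod ps m)
  <= (3 * (N + h%:R) * ln (N + h%:R) + (N + h%:R)) * 2 ^+ count id m / (maskprod ps m)%:R.
Proof.
move=> sm dK KN N1; set N' := N + h%:R.
have N'1 : 1 <= N' by rewrite /N'; have := ler0n R h; lra.
have lN : 0 <= ln N' by rewrite -ln1 ler_ln.
set d := maskprod ps m in dK *; set q := (W * d)%N.
have d0 : 0 < d%:R :> R by exact: maskd0.
have q0 : (0 < q)%N by rewrite muln_gt0 W0 -(ltr0n R).
have dN : d%:R <= N'.
  apply: (le_trans (y := (K ^ 2)%:R)); first by rewrite ler_nat.
  by rewrite /N'; have := ler0n R h; lra.
have p1 : 1 <= 2 ^+ count id m :> R by rewrite exprn_ege1 // ler1n.
have N'0 : 0 <= N' by lra.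
apply: bigRmax_le => [|a ca].
  by rewrite !mulr_ge0 ?invr_ge0 ?exprn_ge0 // ?ltW //; have := mulr_ge0 N'0 lN; lra.
rewrite RabsE INRE; have /andP[t0 t1] := theta_ap_triv N'1 (ltn_ord a).
have phi : N' / (totient q)%:R <= N' * 2 ^+ count id m / d%:R.
  rewrite -mulrA ler_wpM2l // /q totient_maskprod // => [|p /psP[-> _ ->] //].
  have tW : 1 <= (totient W)%:R :> R by rewrite ler1n totient_gt0.
  have half : d%:R / 2 ^+ count id m <= maskwt (fun p => p%:R - 1) ps m :> R.
    rewrite -(maskwt_const 2 sm) /d /maskprod /maskwt natr_prod.
    have : {in mask m ps, forall p, prime p} by move=> p /mem_mask /ps_prime.
    elim: (mask m ps) => [|p s IH] hp; first by rewrite !big_nil invr1 mulr1.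
    rewrite !big_cons invfM mulrACA.
    have p2 : 2 <= p%:R :> R by rewrite ler_nat prime_gt1 // hp ?mem_head.
    apply: ler_pM; [by lra| |by lra|].
      by rewrite divr_ge0 // prodr_ge0.
    by apply: IH => x xs; apply: hp; rewrite inE xs orbT.
  have hq : 0 < d%:R / 2 ^+ count id m :> R by rewrite divr_gt0 // exprn_gt0.
  have m0 : 0 < maskwt (fun p => p%:R - 1) ps m :> R by exact: lt_le_trans half.
  have -> : 2 ^+ count id m / d%:R = (d%:R / 2 ^+ count id m)^-1 :> R by rewrite invfM invrK mulrC.
  rewrite lef_pV2 ?posrE //; last first.
    by rewrite mulr_gt0 //; lra.
  by apply: (le_trans half); rewrite ler_peMl // ltW.
have h1 : N' / q%:R <= N' / d%:R.
  rewrite ler_wpM2l // lef_pV2 ?posrE ?ltr0n //; last by rewrite -(ltr0n R).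
  by rewrite ler_nat leq_pmull.
have h2 : 2 <= 2 * (N' / d%:R) by rewrite ler_peMr // ler_pdivlMr // mul1r.
have h3 : theta_ap N' q a <= 3 * N' * ln N' * 2 ^+ count id m / d%:R.
  apply: (le_trans t1); apply: (le_trans (y := ln N' * (3 * (N' / d%:R)))).
    by apply: ler_wpM2l => //; lra.
  have X0 : 0 <= 3 * N' * ln N' / d%:R by rewrite !mulr_ge0 ?invr_ge0 ?ler0n // ltW.
  have -> : ln N' * (3 * (N' / d%:R)) = 3 * N' * ln N' / d%:R by ring.
  apply: (le_trans (ler_peMr X0 p1)).
  by rewrite [3 * N' * ln N' / _ * _]mulrAC.
have n0 : 0 <= N' / (totient q)%:R by rewrite divr_ge0.
have b0 : 0 <= 3 * N' * ln N' * 2 ^+ count id m / d%:R by exact: le_trans h3.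
have c0 : 0 <= N' * 2 ^+ count id m / d%:R by exact: le_trans phi.
have -> : (3 * N' * ln N' + N') * 2 ^+ count id m / d%:R
  = 3 * N' * ln N' * 2 ^+ count id m / d%:R + N' * 2 ^+ count id m / d%:R by ring.
rewrite ler_norml; lra.
Qed.

Lemma errB_triv m h : size m = size ps -> (maskprod ps m <= K ^ 2)%N -> (K ^ 2)%:R <= N ->
  errB (N + h%:R) (W * maskprod ps m)
  <= 3 * (N + h%:R) * 2 ^+ count id m / (maskprod ps m)%:R.
Proof.
move=> sm dK KN; set N' := N + h%:R.
set d := maskprod ps m in dK *; set q := (W * d)%N.
have d0 : 0 < d%:R :> R by exact: maskd0.
have N'0 : 0 <= N' by rewrite addr_ge0.
have dN : d%:R <= N'.
  apply: (le_trans (y := (K ^ 2)%:R)); first by rewrite ler_nat.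
  by rewrite /N'; have := ler0n R h; lra.
have p1 : 1 <= 2 ^+ count id m :> R by rewrite exprn_ege1 // ler1n.
have X0 : 0 <= 3 * N' / d%:R by rewrite !mulr_ge0 ?invr_ge0 // ltW.
have X1 : 3 * N' / d%:R <= 3 * N' * 2 ^+ count id m / d%:R by rewrite [leRHS]mulrAC ler_peMr.
have h1 : N' / q%:R <= N' / d%:R.
  rewrite ler_wpM2l // lef_pV2 ?posrE ?ltr0n //; last 2 first.
    by rewrite muln_gt0 W0 -(ltr0n R).
    by rewrite -(ltr0n R).
  by rewrite ler_nat leq_pmull.
have h2 : 2 <= 2 * (N' / d%:R) by rewrite ler_peMr // ler_pdivlMr // mul1r.
apply: bigRmax_le => [|y _]; first exact: le_trans X1.
apply: bigRmax_le => [|a _]; first exact: le_trans X1.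
have yN : y%:R <= N'.
  have /andP[f1 _] := flP N'0; apply: le_trans f1; by rewrite ler_nat -ltnS ltn_ord.
rewrite RabsE; apply: (le_trans (lambda_ap_triv yN (ltn_ord a))).
by apply: le_trans X1; rewrite -mulrA; lra.
Qed.

End Fixed.
End Expansion.

(** * Error terms *)

Arguments exp (_)%_ring_scope.

Section Asymptotics.
Local Open Scope ring_scope.

Definition eventually (P : nat -> Prop) := exists K1, forall K, (K1 <= K)%N -> P K.

Lemma eventually_and P Q : eventually P -> eventually Q -> eventually (fun K => P K /\ Q K).
Proof.
move=> [a ha] [b hb]; exists (maxn a b) => K; rewrite geq_max => /andP[aK bK].
by split; [exact: ha|exact: hb].
Qed.

Lemma eventually_imp (P Q : nat -> Prop) : eventually P -> (forall K, P K -> Q K) -> eventually Q.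
Proof. by move=> [a ha] h; exists a => K /ha /h. Qed.

Lemma exp_gt0 (x : R) : 0 < exp x. Proof. by apply/RltP; exact: exp_pos. Qed.

Lemma exp_ge1D (x : R) : 1 + x <= exp x.
Proof. by have /RleP := exp_ineq1_le x. Qed.

Lemma expRD (x y : R) : exp (x + y) = exp x * exp y.
Proof. by rewrite Rstruct.expRD. Qed.

Lemma expRn (x : R) n : exp (n%:R * x) = exp x ^+ n.
Proof. by rewrite Rstruct.expRX mulr_natl. Qed.

Lemma ln_nat_unbounded (x : R) : eventually (fun K => x <= ln K%:R).
Proof.
have e0 := exp_gt0 x.
have /andP[_ h] := flP (ltW e0).
exists (fl (exp x)).+1 => K hK.
have -> : x = ln (exp x) by rewrite ln_exp.
apply: ler_ln => //; apply: (le_trans (ltW h)).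
by rewrite natr1 ler_nat.
Qed.

(** With a = g / (n + 1), exp (g x) is the power n + 1 of exp (a x) >= a x; the spare factor x beats
    [C]. *)
Lemma exp_dominates (g C : R) n : 0 < g -> exists x0 : R, forall x, x0 <= x -> C * x ^+ n <= exp (g * x).
Proof.
move=> g0; pose a : R := g / n.+1%:R.
have a0 : 0 < a by rewrite divr_gt0 ?ltr0n.
exists (Num.max 0 (C / a ^+ n.+1)) => x; rewrite ge_max => /andP[x0 xC].
have -> : g * x = n.+1%:R * (a * x).
  by rewrite /a mulrA [n.+1%:R * _]mulrC divfK // pnatr_eq0.
rewrite expRn; apply: (le_trans (y := (a * x) ^+ n.+1)).
  rewrite exprMn (exprS x) mulrA; apply: ler_wpM2r; first exact: exprn_ge0.
  by move: xC; rewrite ler_pdivrMr ?exprn_gt0 // mulrC.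
have ax : 0 <= a * x by rewrite mulr_ge0 // ltW.
apply: lerXn2r; rewrite ?nnegrE ?(ltW (exp_gt0 _)) //.
by have := exp_ge1D (a * x); lra.
Qed.

(* The real N with N ^ t0 = K ^ 2, so that K is the sieve level. *)
Definition Nof (t0 : R) K : R := exp (2 / t0 * ln K%:R).

Section Fixed.
Variable t0 : R.
Hypothesis t00 : 0 < t0 < 1.

Let g0 : 0 < 2 / t0 - 2.
Proof.
have /andP[a b] := t00; rewrite subr_gt0 ltr_pdivlMr //; lra.
Qed.

Lemma ln_Nof K : ln (Nof t0 K) = 2 / t0 * ln K%:R.
Proof. by rewrite /Nof ln_exp. Qed.

Lemma Nof_split K : (0 < K)%N -> Nof t0 K = (K ^ 2)%:R * exp ((2 / t0 - 2) * ln K%:R).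
Proof.
move=> K0; have KR : 0 < K%:R :> R by rewrite ltr0n.
have -> : (K ^ 2)%:R = exp (2 * ln K%:R).
  by rewrite (expRn _ 2) exp_ln ?natrX //; exact/RltP.
by rewrite -expRD /Nof; congr exp; ring.
Qed.

(** As t0 < 1, N exceeds K ^ 2 by a positive power of K, which beats every power of log K. *)
Lemma square_small (C : R) n : eventually (fun K => (K ^ 2)%:R * (C * ln K%:R ^+ n) <= Nof t0 K).
Proof.
have [x0 hx] := exp_dominates C n g0.
have [K1 hK] := ln_nat_unbounded x0.
exists K1.+1 => K hK1; rewrite Nof_split; last by lia.
apply: ler_wpM2l => //; apply: hx; apply: hK; lia.
Qed.

Lemma sum_dilate_le (f : nat -> R) W X : (0 < W)%N -> (forall n, 0 <= f n) ->
  \sum_(1 <= n < X.+1) f (W * n)%N <= \sum_(1 <= q < (W * X).+1) f q.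
Proof.
move=> W0 f0; pose G q := if (q <= W * X)%N then f q else 0.
have XW : (X <= W * X)%N by rewrite leq_pmull.
have G0 q : 0 <= G q by rewrite /G; case: ifP.
apply: (le_trans (y := \sum_(1 <= m < (W * X).+1 | predT (W * m)%N) G (W * m)%N)).
  rewrite (@big_cat_nat _ _ _ X.+1 1 (W * X).+1) //=.
  rewrite -[leLHS]addr0; apply: lerD; last by apply: sumr_ge0.
  rewrite !big_nat; apply: ler_sum => n /andP[_ nX].
  by rewrite /G leq_pmul2l // -ltnS nX.
rewrite -(@sum_multiples _ (W * X) W predT G) //; last first.
  by move=> n nX; rewrite /G leqNgt nX.
rewrite big_mkcond /= !big_nat; apply: ler_sum => n /andP[_ nX].
by case: ifP => _; rewrite // /G -ltnS nX.
Qed.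

Lemma Nof_ge K : 0 <= ln K%:R :> R -> 1 <= Nof t0 K.
Proof.
move=> L0; have := exp_ge1D (2 / t0 * ln K%:R); rewrite -/(Nof t0 K).
have /andP[a _] := t00.
have : 0 <= 2 / t0 * ln K%:R by rewrite !mulr_ge0 // invr_ge0 ltW.
lra.
Qed.

(* Every error term of the sieve is [O(N)] once [e] satisfies a bound of
   Bombieri-Vinogradov type and a trivial bound [V = O(N log N)]. *)
Lemma error_small (k E : nat) (Sc : R) (e : nat -> nat -> R) (V : nat -> R) :
  0 <= Sc -> (forall A, exists C : R, eventually (fun K =>
    (\sum_(1 <= n < (K ^ 2).+1) e K n) * ln K%:R ^+ A <= C * Nof t0 K)) ->
  (exists2 C : R, 0 <= C & eventually (fun K => V K <= C * (Nof t0 K * ln K%:R))) ->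
  exists t : nat, exists C : R, eventually (fun K =>
    (Sc * ln K%:R ^+ k) ^+ 2 * (ln K%:R ^+ t * \sum_(1 <= n < (K ^ 2).+1) e K n
       + V K / ln K%:R ^+ t * harmonic R (K ^ 2) ^+ E) <= C * Nof t0 K).
Proof.
(* Division by L ^ t must compensate the 2 k logarithms of the lambda_d, the one in V and the E of
   the harmonic sum. The average bound is then taken with 2 k + t logarithms to spare. *)
move=> Sc0 he [CV CV0 hV]; pose t := (2 * k + 1 + E)%N; exists t.
have [C1 h1] := he (2 * k + t)%N.
exists (Sc ^+ 2 * (C1 + CV * 3 ^+ E)).
have := eventually_and (eventually_and h1 hV) (eventually_and (ln_nat_unbounded 1) (ex_intro _ 1%N (fun K h => h))).
move=> /eventually_imp; apply => K [[{}h1 {}hV] [L1 K0]].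
set L := ln K%:R in L1 h1 hV *; set N := Nof t0 K in h1 hV *; set s := \sum_(_ <= n < _) _ in h1 *.
have L0 : 0 <= L by lra.
have N1 : 1 <= N by exact: Nof_ge.
have KX : (0 < K ^ 2)%N by rewrite expn_gt0 K0.
have hl : harmonic R (K ^ 2) <= 3 * L.
  apply: (le_trans (harmonic_le KX)); rewrite natrX expr2 lnM ?ltr0n // -/L; lra.
have h0 : 0 <= harmonic R (K ^ 2) by apply: sumr_ge0 => n _; rewrite invr_ge0.
have hE : harmonic R (K ^ 2) ^+ E <= 3 ^+ E * L ^+ E.
  by rewrite -exprMn; apply: lerXn2r; rewrite ?nnegrE // mulr_ge0.
have Lt : 0 < L ^+ t by rewrite exprn_gt0 //; lra.
have p1 : V K / L ^+ t * harmonic R (K ^ 2) ^+ E <= CV * 3 ^+ E * N / L ^+ (2 * k).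
  have q1 : V K / L ^+ t <= CV * (N * L) / L ^+ t by rewrite ler_wpM2r // invr_ge0 ltW.
  have q2 : 0 <= CV * (N * L) / L ^+ t.
    by rewrite !mulr_ge0 ?invr_ge0 ?(ltW Lt) //; lra.
  apply: (le_trans (ler_wpM2r (exprn_ge0 E h0) q1)).
  apply: (le_trans (ler_wpM2l q2 hE)).
  rewrite le_eqVlt; apply/orP; left; apply/eqP; rewrite /t !exprD expr1; field.
  by rewrite !expf_neq0; apply/eqP; lra.
have Lk : 0 < L ^+ (2 * k) by rewrite exprn_gt0 //; lra.
have p2 : L ^+ t * s <= C1 * N / L ^+ (2 * k).
  rewrite ler_pdivlMr //; apply: le_trans h1; rewrite exprD.
  by rewrite le_eqVlt; apply/orP; left; apply/eqP; ring.
apply: (le_trans (ler_wpM2l (sqr_ge0 _) (lerD p2 p1))).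
rewrite exprMn -exprM mulnC le_eqVlt; apply/orP; left; apply/eqP; field.
exact: lt0r_neq0.
Qed.

Lemma const_small (c : R) A : exists C : R, eventually (fun K =>
   (\sum_(1 <= n < (K ^ 2).+1) (c + ln K%:R)) * ln K%:R ^+ A <= C * Nof t0 K).
Proof.
exists 1; have := eventually_and (square_small (`|c| + 1) A.+1) (ln_nat_unbounded 1).
move=> /eventually_imp; apply=> K [h L1].
rewrite sumr_const_nat subn1 /= mul1r; apply: le_trans h.
set L := ln K%:R in L1 *; rewrite -[X in X * _ <= _]mulr_natl -mulrA.
apply: ler_wpM2l => //; rewrite exprS mulrA; apply: ler_wpM2r; first by rewrite exprn_ge0 //; lra.
have := ler_norm c; have := normr_ge0 c; nra.
Qed.

Variables (theta : R) (W h : nat).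
Hypotheses (t0t : t0 < theta) (W0 : (0 < W)%N).

Let eps : R := (theta - t0) / 2.
Let eps0 : 0 < eps. Proof. by rewrite divr_gt0 // subr_gt0. Qed.

(** Since theta - eps is the midpoint of t0 and theta, N ^ (theta - eps) is K ^ 2 times a positive
    power of K, and this power exceeds the constant [W]. *)
Lemma level_ok : eventually (fun K =>
  (W * K ^ 2 <= fl (Rpower (Nof t0 K + h%:R) (theta - eps)))%N).
Proof.
have /andP[a0 a1] := t00.
have g1 : 0 < 2 * eps / t0 by rewrite divr_gt0 // mulr_gt0.
have [x0 hx] := exp_dominates W%:R 0 g1.
have := eventually_and (eventually_and (ln_nat_unbounded x0) (ln_nat_unbounded 0)) (ex_intro _ 1%N (fun K h => h)).
move=> /eventually_imp; apply=> K [[xL L0] K0].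
have := hx _ xL; rewrite expr0 mulr1 => hW.
have N1 := Nof_ge L0.
set L := ln K%:R in xL L0 hW *.
have h0 : 0 <= h%:R :> R by [].
have N'0 : 0 < Nof t0 K + h%:R by lra.
have lev : (W * K ^ 2)%:R <= Rpower (Nof t0 K + h%:R) (theta - eps).
  rewrite /Rpower.
  apply: (le_trans (y := exp ((theta - eps) * ln (Nof t0 K)))); last first.
    have : (theta - eps) * ln (Nof t0 K) <= (theta - eps) * ln (Nof t0 K + h%:R).
      apply: ler_wpM2l; last by apply: ler_ln; lra.
      have mid (a b : R) : 0 < a -> a < b -> 0 <= b - (b - a) / 2 by move=> *; lra.
      exact: mid.
    rewrite le_eqVlt => /orP[/eqP ->//|lt]; apply/ltW/RltP/exp_increasing; exact/RltP.
  rewrite ln_Nof -/L (_ : (theta - eps) * (2 / t0 * L) = 2 * L + 2 * eps / t0 * L); last first.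
    by rewrite /eps; field; apply/eqP; lra.
  rewrite expRD natrM mulrC; apply: ler_pM => //.
  by rewrite (expRn _ 2) exp_ln ?natrX //; apply/RltP; rewrite ltr0n.
have p0 : 0 <= Rpower (Nof t0 K + h%:R) (theta - eps) by exact: ltW (exp_gt0 _).
have /andP[_ f] := flP p0.
by rewrite -ltnS -(ltr_nat R) -natr1; exact: le_lt_trans f.
Qed.

Lemma bv_small (err : R -> nat -> R) : (forall N q, 0 <= err N q) ->
  (forall e A : R, 0 < e -> 0 < A -> exists C N0 : R, forall N : R, N0 <= N ->
    \sum_(1 <= q < (fl (Rpower N (theta - e))).+1) err N q <= C * (N / Rpower (ln N) A)) ->
  forall A : nat, exists C : R, eventually (fun K =>
   (\sum_(1 <= n < (K ^ 2).+1) err (Nof t0 K + h%:R) (W * n)%N) * ln K%:R ^+ A <= C * Nof t0 K).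
Proof.
move=> err0 hbv A; have /andP[a0 a1] := t00.
have A0 : 0 < A.+1%:R :> R by rewrite ltr0n.
(* [A.+1] and not [A], because the conditions ask for a positive exponent; the extra logarithm is
   given away at the end. *)
have [C [N0 hC]] := hbv eps A.+1%:R eps0 A0.
exists (`|C| * (1 + h%:R)).
have := eventually_and level_ok (eventually_and (ln_nat_unbounded 1) (ln_nat_unbounded N0)).
move=> /eventually_imp; apply=> K [lev [L1 LN]].
set L := ln K%:R in L1 LN *; set N := Nof t0 K in lev *; set N' := N + h%:R in lev *.
have h0 : 0 <= h%:R :> R by [].
have L0 : 0 <= L by lra.
have t1 : 1 <= 2 / t0 by rewrite ler_pdivlMr //; lra.
have tL : L <= 2 / t0 * L by rewrite ler_peMl.
have N1 : 1 <= N by exact: Nof_ge.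
have NL : L <= N by rewrite /N /Nof -/L; have := exp_ge1D (2 / t0 * L); lra.
have lnN' : L <= ln N'.
  apply: (le_trans tL); rewrite -[2 / t0 * L]ln_Nof; apply: ler_ln; rewrite -/N /N'; lra.
have N'N0 : N0 <= N' by rewrite /N'; lra.
have {}hC := hC N' N'N0.
have lp : 0 < ln N' by lra.
have pE : Rpower (ln N') A.+1%:R = ln N' ^+ A.+1.
  by rewrite -INRE Rpower_pow ?RpowE //; exact/RltP.
rewrite pE in hC.
have s1 : \sum_(1 <= n < (K ^ 2).+1) err N' (W * n)%N <= `|C| * (N' / L ^+ A.+1).
  apply: (le_trans (sum_dilate_le _ W0 (err0 N'))).
  apply: (le_trans (y := \sum_(1 <= q < (fl (Rpower N' (theta - eps))).+1) err N' q)).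
    rewrite [leRHS](@big_cat_nat _ _ _ (W * K ^ 2).+1) //= lerDl; exact: sumr_ge0.
  apply: (le_trans hC).
  have x0 : 0 <= N' / ln N' ^+ A.+1 by rewrite divr_ge0 ?exprn_ge0 //; rewrite /N'; lra.
  apply: (le_trans (ler_wpM2r x0 (ler_norm C))).
  apply: ler_wpM2l => //; apply: ler_wpM2l; first by rewrite /N'; lra.
  rewrite lef_pV2 ?posrE ?exprn_gt0 //; last by lra.
  by apply: lerXn2r; rewrite ?nnegrE //; lra.
have LA : 0 < L ^+ A by rewrite exprn_gt0 //; lra.
apply: (le_trans (ler_wpM2r (ltW LA) s1)).
have -> : `|C| * (N' / L ^+ A.+1) * L ^+ A = `|C| * (N' / L).
  have L' : L != 0 by apply/eqP; lra.
  rewrite exprS invfM -!mulrA; congr (_ * (_ * _)).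
  by rewrite mulVf ?mulr1 // expf_neq0.
rewrite -mulrA; apply: ler_wpM2l => //; rewrite ler_pdivrMr; last by lra.
rewrite /N'; have : h%:R <= h%:R * N by exact: ler_peMr.
have : (1 + h%:R) * N <= (1 + h%:R) * N * L.
  by apply: ler_peMr => //; apply: mulr_ge0; lra.
lra.
Qed.

End Fixed.
End Asymptotics.

(** * The three weighted sums over n, each up to O(N) *)

Section Contradiction.
Local Open Scope ring_scope.

Definition modulus D : nat := (\prod_(p <- primes_in 0 D) p)%N.

Lemma modulus_gt0 D : (0 < modulus D)%N.
Proof.
rewrite /modulus big_seq; elim/big_ind: _ => // [x y|p]; first by rewrite muln_gt0 => -> ->.
by move=> /primes_in_prime /prime_gt0.
Qed.

Lemma totient_modulus D : (totient (modulus D))%:R = (modulus D)%:R * density (primes_in 0 D) :> R.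
Proof.
have := @totient_maskprod 1 (primes_in 0 D) (nseq (size (primes_in 0 D)) true).
rewrite size_nseq /maskprod /maskwt mask_true // mul1n => ->; last by [].
- rewrite /modulus /density natr_prod mul1r -big_split big_seq [RHS]big_seq /=.
  apply: eq_bigr => p /primes_in_prime /prime_gt0; rewrite -(ltr0n R) => p0.
  by rewrite mulrBr mulr1 divff // lt0r_neq0.
- exact: primes_in_uniq.
- by move=> p /primes_in_prime ->; rewrite coprimen1.
Qed.

Section Fixed.
Variables (hs : seq nat) (D : nat) (beta t0 theta : R) (M0 H b i : nat).
Let k := size hs.
Let W := modulus D.
Hypotheses (uh : uniq hs) (hD : {in hs, forall h, (h <= D)%N}) (ki : k = i.+1) (i0 : (0 < i)%N)
  (kD : (2 * k <= D)%N) (k2D : 2 * k%:R ^+ 2 < D%:R :> R) (beta0 : 0 <= beta)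
  (t01 : 0 < t0 < 1) (t0t : t0 < theta) (M01 : (0 < M0)%N) (bW : (b < W)%N)
  (cb : {in hs, forall h, coprime (b + h) W}).

Let k2 : (2 <= k)%N. Proof. by rewrite ki. Qed.
Let k0 : (0 < k)%N. Proof. by rewrite ki. Qed.

Let quad K F := pairsum (size (primes_in D K)) (lam k D beta K) (lam k D beta K) F.

(** Combines [sieve_expand], with T a power of log K, and [error_small]: what remains per sum is a
    bound per residue class, on average ([he]) and trivially ([V]). *)
Lemma sieve_error (F : nat -> bitseq -> R) g (x : nat -> R) (e : nat -> nat -> R) (V : nat -> R) :
  (forall K n, 0 <= e K n) -> (forall K, 0 <= V K) ->
  eventually (fun K => forall m, size m = size (primes_in D K) ->
    `|F K m - x K * maskwt g (primes_in D K) m|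
      <= k%:R ^+ count id m * e K (maskprod (primes_in D K) m)) ->
  eventually (fun K => forall m, size m = size (primes_in D K) ->
    (maskprod (primes_in D K) m <= K ^ 2)%N ->
     e K (maskprod (primes_in D K) m) <= V K * 2 ^+ count id m / (maskprod (primes_in D K) m)%:R) ->
  (forall A, exists C : R, eventually (fun K =>
    (\sum_(1 <= n < (K ^ 2).+1) e K n) * ln K%:R ^+ A <= C * Nof t0 K)) ->
  (exists2 C : R, 0 <= C & eventually (fun K => V K <= C * (Nof t0 K * ln K%:R))) ->
  exists C : R, eventually (fun K =>
    `|quad K (F K) - x K * quad K (maskwt g (primes_in D K))| <= C * Nof t0 K).
Proof.
move=> e0 V0 hF hV he hVN.
have [Sc Sc0 hS] := sieve_norm k0 kD beta0 k2D.
have [t [C hC]] := error_small t01 k.+1 (2 * (8 * k) ^ 2) Sc0 he hVN.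
exists C.
have := eventually_and (eventually_and hF hV) (eventually_and hC
  (eventually_and (ln_nat_unbounded 1) (ex_intro _ 1%N (fun K h => h)))).
move=> /eventually_imp; apply=> K [[{}hF {}hV] [{}hC [L1 K0]]].
apply: le_trans hC.
have T0 : 0 < ln K%:R ^+ t :> R by rewrite exprn_gt0 //; lra.
exact: (sieve_expand k2 kD beta0 K0 (hS K K0 L1) T0 (V0 K) (e0 K) hF hV).
Qed.

Let range_ok : eventually (fun K => [/\ (0 < K)%N, 1 <= ln K%:R :> R, (K ^ 2)%:R <= Nof t0 K,
  1 <= Nof t0 K & (M0 <= (fl (Nof t0 K)).+1)%N]).
Proof.
have := eventually_and (eventually_and (square_small t01 1 0) (square_small t01 M0%:R 0))
  (eventually_and (ln_nat_unbounded 1) (ex_intro _ 1%N (fun K h => h))).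
move=> /eventually_imp; apply=> K [[h1 h2] [L1 K0]].
rewrite !expr0 !mulr1 in h1 h2.
have N1 : 1 <= Nof t0 K by apply: Nof_ge => //; lra.
split=> //.
have N0 : 0 <= Nof t0 K by lra.
have /andP[_ f] := flP N0.
rewrite -(ler_nat R) -natr1; apply: le_trans (ltW f); apply: le_trans h2.
by rewrite ler_peMl // ler1n expn_gt0 K0.
Qed.

Lemma sum_one_estimate : exists C : R, eventually (fun K =>
  `|\sum_(M0 <= n < (fl (Nof t0 K)).+1 | (n %% W == b)%N) 1 * sieveweight hs D beta K n
    - Nof t0 K / W%:R * quad K (maskwt (fun p => k%:R / p%:R) (primes_in D K))| <= C * Nof t0 K).
Proof.
pose c : R := M0%:R + 2.
have c0 : 0 <= c by rewrite addr_ge0.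
suff [C hC] : exists C : R, eventually (fun K =>
   `|quad K (classsum M0 (fl (Nof t0 K)) (fun=> 1) W b hs (primes_in D K))
     - Nof t0 K / W%:R * quad K (maskwt (fun p => k%:R / p%:R) (primes_in D K))| <= C * Nof t0 K).
  by exists C; apply: (eventually_imp hC) => K; rewrite sieve_square.
(* The error per class is the constant [c]; log K is added so that [const_small] serves here as well
   as in the prime sum. *)
apply: (@sieve_error _ _ (fun K => Nof t0 K / W%:R) (fun K _ => c + ln K%:R)
  (fun K => (c + ln K%:R) * (K ^ 2)%:R)
  (fun K _ => addr_ge0 c0 (ln_nat_ge0 K)) (fun K => mulr_ge0 (addr_ge0 c0 (ln_nat_ge0 K)) (ler0n _ _))
  _ _ (const_small t01 c)).
- move: range_ok => /eventually_imp; apply=> K [K0 L1 KN N1 M0N] m sm.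
  have N0 : 0 <= Nof t0 K by lra.
  apply: (le_trans (class_one uh hD N0 M0N bW sm)); apply: ler_wpM2l; first exact: exprn_ge0.
  by rewrite lerDl; lra.
- move: range_ok => /eventually_imp; apply=> K [K0 L1 KN N1 M0N] m sm dK.
  have d0 : 0 < (maskprod (primes_in D K) m)%:R :> R.
    by rewrite ltr0n maskprod_gt0 //; exact: primes_in_prime.
  have cL : 0 <= c + ln K%:R by lra.
  rewrite ler_pdivlMr // -mulrA; apply: ler_wpM2l => //.
  apply: (le_trans (y := (K ^ 2)%:R)); first by rewrite ler_nat.
  by rewrite ler_peMr // exprn_ege1 // ler1n.
- exists 1 => //.
  have := eventually_and (square_small t01 (c + 1) 1) range_ok.
  move=> /eventually_imp; apply=> K [h [K0 L1 KN N1 M0N]].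
  rewrite expr1 in h; rewrite mul1r mulrC.
  apply: (le_trans (y := (K ^ 2)%:R * ((c + 1) * ln K%:R))).
    apply: ler_wpM2l => //; have : c <= c * ln K%:R by exact: ler_peMr.
    by lra.
  apply: (le_trans h); apply: ler_peMr => //; lra.
Qed.

Lemma sum_liouville_estimate : condB theta -> exists C : R, eventually (fun K =>
  `|\sum_(M0 <= n < (fl (Nof t0 K)).+1 | (n %% W == b)%N)
      liouville (n + H) * sieveweight hs D beta K n| <= C * Nof t0 K).
Proof.
move=> cB.
have eB0 N q : 0 <= 2 * errB N q by rewrite mulr_ge0 // bigRmax_ge0.
have bv : forall e A : R, 0 < e -> 0 < A -> exists C N0 : R, forall N : R, N0 <= N ->
    \sum_(1 <= q < (fl (Rpower N (theta - e))).+1) (2 * errB N q) <= C * (N / Rpower (ln N) A).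
  move=> e A /RltP e0 /RltP A0; have [C [N0 h]] := cB e A e0 A0.
  exists (2 * C), N0 => N /RleP NN; have /RleP h' := h N NN.
  by rewrite -mulr_sumr -mulrA; apply: ler_wpM2l.
have V0 K : 0 <= 6 * (Nof t0 K + H%:R) by rewrite mulr_ge0 // addr_ge0 // ltW // exp_gt0.
suff [C hC] : exists C : R, eventually (fun K =>
   `|quad K (classsum M0 (fl (Nof t0 K)) (fun n => liouville (n + H)) W b hs (primes_in D K))
     - 0 * quad K (maskwt (fun=> 1) (primes_in D K))| <= C * Nof t0 K).
  by exists C; apply: (eventually_imp hC) => K; rewrite sieve_square mul0r subr0.
apply: (@sieve_error _ _ (fun=> 0) (fun K n => 2 * errB (Nof t0 K + H%:R) (W * n)%N)
  (fun K => 6 * (Nof t0 K + H%:R)) (fun K n => eB0 _ _) V0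
  _ _ (bv_small t01 H t0t (modulus_gt0 D) eB0 bv)).
- move: range_ok => /eventually_imp; apply=> K [K0 L1 KN N1 M0N] m sm.
  have N0 : 0 <= Nof t0 K by lra.
  exact: (class_liouville uh hD N0 M01 M0N bW H sm).
- move: range_ok => /eventually_imp; apply=> K [K0 L1 KN N1 M0N] m sm dK.
  have N0 : 0 <= Nof t0 K by lra.
  have := errB_triv N0 H sm dK KN.
  rewrite -/(modulus D) -/W.
  set X := errB _ _; set Y := _ / _ => h; rewrite (_ : _ / _ = 2 * Y); last by rewrite /Y; ring.
  exact: ler_wpM2l.
- exists (6 * (1 + H%:R)); first by rewrite mulr_ge0 // addr_ge0.
  move: range_ok => /eventually_imp; apply=> K [K0 L1 KN N1 M0N].
  have h1 : H%:R <= H%:R * Nof t0 K by exact: ler_peMr.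
  have N0 : 0 <= Nof t0 K by lra.
  have h2 : (1 + H%:R) * Nof t0 K <= (1 + H%:R) * Nof t0 K * ln K%:R.
    by apply: ler_peMr => //; apply: mulr_ge0 => //; rewrite addr_ge0.
  by rewrite -!mulrA in h2 *; lra.
Qed.

Lemma sum_prime_estimate : condA theta -> forall h, h \in hs -> exists C : R, eventually (fun K =>
  `|\sum_(M0 <= n < (fl (Nof t0 K)).+1 | (n %% W == b)%N)
      logprime (n + h) * sieveweight hs D beta K n
    - (Nof t0 K + h%:R) / (totient W)%:R
      * quad K (maskwt (fun p => i%:R / (p%:R - 1)) (primes_in D K))| <= C * Nof t0 K).
Proof.
move=> cA h hhs.
pose c : R := \sum_(0 <= x < M0 + h) logprime x.
have c0 : 0 <= c by apply: sumr_ge0 => x _; exact: logprime_ge0.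
have eA0 N q : 0 <= errA N q by exact: bigRmax_ge0.
have bv : forall e A : R, 0 < e -> 0 < A -> exists C N0 : R, forall N : R, N0 <= N ->
    \sum_(1 <= q < (fl (Rpower N (theta - e))).+1) errA N q <= C * (N / Rpower (ln N) A).
  move=> e A /RltP e0 /RltP A0; have [C [N0 hh]] := cA e A e0 A0.
  by exists C, N0 => N /RleP NN; apply/RleP; exact: hh.
have cL K : 0 <= c + ln K%:R by rewrite addr_ge0 ?ln_nat_ge0.
have h0 : 0 <= h%:R :> R by [].
(* [sieve_error] asks for 0 <= V at every K, hence the maximum with 0. The last summand is the
   trivial bound for the constant part of the error, using d <= K ^ 2. *)
pose V K : R := 3 * (Nof t0 K + h%:R) * Num.max 0 (ln (Nof t0 K + h%:R)) + (Nof t0 K + h%:R)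
  + (c + ln K%:R) * (K ^ 2)%:R.
have V0 K : 0 <= V K.
  have N0 : 0 <= Nof t0 K + h%:R by rewrite addr_ge0 // ltW // exp_gt0.
  rewrite !addr_ge0 ?mulr_ge0 ?cL ?le_max ?lexx //; exact: ltW (exp_gt0 _).
have lnN' K : 1 <= Nof t0 K -> 0 <= ln (Nof t0 K + h%:R).
  by move=> N1; rewrite -ln1; apply: ler_ln; lra.
suff [C hC] : exists C : R, eventually (fun K =>
   `|quad K (classsum M0 (fl (Nof t0 K)) (fun n => logprime (n + h)) W b hs (primes_in D K))
     - (Nof t0 K + h%:R) / (totient W)%:R
       * quad K (maskwt (fun p => i%:R / (p%:R - 1)) (primes_in D K))| <= C * Nof t0 K).
  by exists C; apply: (eventually_imp hC) => K; rewrite sieve_square.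
apply: (@sieve_error _ _ (fun K => (Nof t0 K + h%:R) / (totient W)%:R)
  (fun K n => errA (Nof t0 K + h%:R) (W * n)%N + (c + ln K%:R)) V
  (fun K n => addr_ge0 (eA0 _ _) (cL K)) V0).
- move: range_ok => /eventually_imp; apply=> K [K0 L1 KN N1 M0N] m sm.
  have N0 : 0 <= Nof t0 K by lra.
  have := class_logprime uh hD k2 N0 M0N bW cb sm hhs.
  by rewrite -/k ki.
- move: range_ok => /eventually_imp; apply=> K [K0 L1 KN N1 M0N] m sm dK.
  have N0 : 0 <= Nof t0 K by lra.
  have := errA_triv h sm dK KN N1.
  rewrite -/(modulus D) -/W => hA.
  have d0 : 0 < (maskprod (primes_in D K) m)%:R :> R.
    by rewrite ltr0n maskprod_gt0 //; exact: primes_in_prime.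
  rewrite /V (max_r (lnN' K N1)) mulrDl [X in _ <= X]mulrDl; apply: lerD => //.
  rewrite ler_pdivlMr // -mulrA; apply: ler_wpM2l; first exact: cL.
  apply: (le_trans (y := (K ^ 2)%:R)); first by rewrite ler_nat.
  by rewrite ler_peMr // exprn_ege1 // ler1n.
- move=> A; have [C1 h1] := bv_small t01 h t0t (modulus_gt0 D) eA0 bv A.
  have [C2 h2] := const_small t01 c A.
  exists (C1 + C2); move: (eventually_and h1 h2) => /eventually_imp; apply=> K [{}h1 {}h2].
  by rewrite big_split /= mulrDl [X in _ <= X]mulrDl; exact: lerD.
- exists (3 * (1 + h%:R) * (2 / t0 + 1) + (1 + h%:R) + 1).
    have /andP[a0 _] := t01.
    by rewrite !addr_ge0 ?mulr_ge0 ?addr_ge0 ?mulr_ge0 ?invr_ge0 // ltW.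
  have := eventually_and (square_small t01 (c + 1) 1) (eventually_and range_ok (square_small t01 h%:R 0)).
  move=> /eventually_imp; apply=> K [hc [[K0 L1 KN N1 M0N] hN]].
  rewrite expr1 in hc; rewrite expr0 mulr1 in hN.
  rewrite /V (max_r (lnN' K N1)).
  set N := Nof t0 K in hc hN N1 *; set L := ln K%:R in L1 hc *.
  have N0 : 0 <= N by lra.
  have L0 : 0 <= L by lra.
  have hh : h%:R <= N.
    by apply: le_trans hN; rewrite ler_peMl // ler1n expn_gt0 K0.
  have l1 : ln (N + h%:R) <= (2 / t0 + 1) * L.
    apply: (le_trans (y := ln (2 * N))); first by apply: ler_ln; lra.
    rewrite lnM //; last by lra.
    rewrite ln_Nof -/L; have := @ln_sub1 2 ltac:(by []); lra.
  have h1 : N + h%:R <= (1 + h%:R) * N by have : h%:R <= h%:R * N by [exact: ler_peMr]; lra.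
  have p1 : 3 * (N + h%:R) * ln (N + h%:R) <= 3 * ((1 + h%:R) * N) * ((2 / t0 + 1) * L).
    apply: ler_pM => //; first by rewrite mulr_ge0 // addr_ge0.
    - exact: lnN'.
    - exact: ler_wpM2l.
  have NL : N <= N * L by exact: ler_peMr.
  have p2 : N + h%:R <= (1 + h%:R) * (N * L).
    apply: (le_trans h1); apply: ler_wpM2l => //; exact: addr_ge0.
  have p3 : (c + L) * (K ^ 2)%:R <= N * L.
    apply: le_trans NL; apply: le_trans hc; rewrite mulrC; apply: ler_wpM2l => //.
    by have : c <= c * L by [exact: ler_peMr]; lra.
  have -> : (3 * (1 + h%:R) * (2 / t0 + 1) + (1 + h%:R) + 1) * (N * L)
    = 3 * ((1 + h%:R) * N) * ((2 / t0 + 1) * L) + (1 + h%:R) * (N * L) + N * L by ring.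
  lra.
Qed.

End Fixed.
End Contradiction.

(** * The contradiction *)

Section Final.
Local Open Scope ring_scope.

(** The limit K -> infinity as pure algebra: L = log K, Z = L ^ (k + 2), Q1 and Q2 are the forms of
    the weights and of the primes, w = W, c = phi(W) / W, a = c ^ k and l = 1 - 2 k ^ 2 / D. Cleared
    of denominators, the leading terms have order L ^ 2 Z and differ by [dl], while [Cs] collects
    everything of order L Z; so dl L <= Cs, which fails for large L. *)
Lemma leading_terms_contradiction (kk l t a I J c w Cl C2 Cu C13 : R) :
  0 < kk -> 0 < l -> 0 < t -> 0 < a -> 0 < c -> 0 < w -> 0 <= I ->
  0 <= Cl -> 0 <= C2 -> 0 <= Cu -> 0 <= C13 -> I < kk * J * t * l ->
  exists x0 : R, forall L Z Q1 Q2 : R, x0 <= L -> 1 <= L -> L <= Z ->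
   L * Q1 * l <= a * I * (L * Z) + Cu * Z ->
   c * a * J * (L * (L * Z)) - Cl * (L * Z) <= L * Q2 ->
   kk * (Q2 / (w * c) - C2) <= (2 / t * L + 1) / 2 * (Q1 / w + C13) -> False.
Proof.
move=> k0 l0 t0 a0 c0 w0 I0 Cl0 C20 Cu0 C130 gap.
pose Cs := kk * l * t * Cl / c + kk * l * t * w * C2 + Cu + l * w * C13
  + t / 2 * (a * I + Cu + l * w * C13).
pose dl := (kk * J * t * l - I) * a.
have dl0 : 0 < dl by rewrite mulr_gt0 // subr_gt0.
exists ((Cs + 1) / dl) => L Z Q1 Q2 Lx L1 LZ hQ1 hQ2 h.
have L0 : 0 < L by lra.
have Z0 : 0 < Z by lra.
have step1 : kk * (L * Q2 / (w * c) - C2 * L) <= (L / t + 2^-1) * (L * Q1 / w + C13 * L).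
  have := ler_wpM2l (ltW L0) h.
  rewrite (_ : L * (kk * (Q2 / (w * c) - C2)) = kk * (L * Q2 / (w * c) - C2 * L)); last by ring.
  by rewrite (_ : L * ((2 / t * L + 1) / 2 * (Q1 / w + C13))
    = (L / t + 2^-1) * (L * Q1 / w + C13 * L)) //; field; apply/andP; split; exact: lt0r_neq0.
have wlt : 0 < w * l * t by rewrite !mulr_gt0.
have step2 := ler_wpM2l (ltW wlt) step1.
have E1 : w * l * t * (kk * (L * Q2 / (w * c) - C2 * L))
    = kk * l * t / c * (L * Q2) - kk * l * t * w * C2 * L.
  by field; apply/andP; split; exact: lt0r_neq0.
have E2 : w * l * t * ((L / t + 2^-1) * (L * Q1 / w + C13 * L))
    = (L + t / 2) * (L * Q1 * l + l * w * C13 * L).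
  by field; apply/andP; split; exact: lt0r_neq0.
rewrite E1 E2 in step2.
have klc : 0 <= kk * l * t / c by rewrite !mulr_ge0 ?invr_ge0 // ltW.
have s3 := ler_wpM2l klc hQ2.
have E3 : kk * l * t / c * (c * a * J * (L * (L * Z)) - Cl * (L * Z))
   = kk * J * t * l * a * (L * (L * Z)) - kk * l * t * Cl / c * (L * Z).
  by field; exact: lt0r_neq0.
rewrite E3 in s3.
have Lt : 0 <= L + t / 2 by rewrite addr_ge0 ?divr_ge0 // ltW.
have s4 : (L + t / 2) * (L * Q1 * l + l * w * C13 * L)
   <= (L + t / 2) * (a * I * (L * Z) + Cu * Z + l * w * C13 * L).
  by apply: ler_wpM2l => //; lra.
have ZLZ : Z <= L * Z by rewrite ler_peMl // ltW.
have LLZ : L <= L * Z by rewrite ler_peMr //; lra.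
have L2 : L * L <= L * Z by rewrite ler_wpM2l // ltW.
have lw : 0 <= l * w * C13 by rewrite !mulr_ge0 // ltW.
have t2 : 0 <= t / 2 by rewrite divr_ge0 // ltW.
have c2 : 0 <= kk * l * t * w * C2 by rewrite !mulr_ge0 // ltW.
have aI : 0 <= a * I by rewrite mulr_ge0 // ltW.
have u1 := ler_wpM2l c2 LLZ.
have u2 := ler_wpM2l lw L2.
have u3 := ler_wpM2l (mulr_ge0 t2 Cu0) ZLZ.
have u4 := ler_wpM2l (mulr_ge0 t2 lw) LLZ.
have main : dl * (L * (L * Z)) <= Cs * (L * Z).
  rewrite /dl /Cs; lra.
have LZ0 : 0 < L * Z by rewrite mulr_gt0.
have : dl * L <= Cs.
  by rewrite -(ler_pM2r LZ0) -mulrA.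
move: Lx; rewrite ler_pdivrMr // mulrC; lra.
Qed.

Lemma eventually_all (s : seq nat) (X : nat -> nat -> R) (N : nat -> R) : (forall K, 0 <= N K) ->
  {in s, forall h, exists C : R, eventually (fun K => X h K <= C * N K)} ->
  exists2 C : R, 0 <= C & eventually (fun K => {in s, forall h, X h K <= C * N K}).
Proof.
move=> N0; elim: s => [|h s IH] hX; first by exists 0 => //; exists 0%N.
have [C C0 hC] := IH (fun x xs => hX x (@mem_behead _ (h :: s) x xs)).
have [C' hC'] := hX h (mem_head _ _).
exists (C + `|C'|); first by rewrite addr_ge0.
move: (eventually_and hC hC') => /eventually_imp; apply=> K [a1 a2] x.
rewrite inE => /orP[/eqP ->|xs].
  apply: (le_trans a2); apply: ler_wpM2r => //.
  by apply: (le_trans (ler_norm _)); rewrite lerDr.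
by apply: (le_trans (a1 x xs)); apply: ler_wpM2r => //; rewrite lerDl.
Qed.

Lemma sieve_false (hs : seq nat) (D : nat) (beta t0 theta : R) (M0 H b i : nat) :
  uniq hs -> {in hs, forall h, (h <= D)%N} -> {in hs, forall h, (h <= H)%N} ->
  size hs = i.+1 -> (0 < i)%N -> (2 * size hs <= D)%N ->
  2 * (size hs)%:R ^+ 2 < D%:R :> R -> 0 <= beta -> 0 < t0 < 1 -> t0 < theta -> (0 < M0)%N ->
  (b < modulus D)%N -> {in hs, forall h, coprime (b + h) (modulus D)} ->
  condA theta -> condB theta ->
  Icoef (size hs) beta
    < (size hs)%:R * Jcoef i beta * t0 * (1 - 2 * (size hs)%:R ^+ 2 / D%:R) ->
  (forall n, (M0 <= n)%N -> \sum_(h <- hs) (prime (n + h))%:R <= (1 + liouville (n + H)) / 2) ->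
  False.
Proof.
move=> uh hD hH ki i0 kD k2D b0 t01 t0t M01 bW cb cA cB gap pw.
have k0 : (0 < size hs)%N by rewrite ki.
have [C1 h1] := sum_one_estimate M0 uh hD ki i0 kD k2D b0 t01 bW.
have [C3 h3] := sum_liouville_estimate H uh hD ki i0 kD k2D b0 t01 t0t M01 bW cB.
have h2 := @eventually_all hs (fun h K => - (\sum_(M0 <= n < (fl (Nof t0 K)).+1 | (n %% modulus D == b)%N)
      logprime (n + h) * sieveweight hs D beta K n
    - (Nof t0 K + h%:R) / (totient (modulus D))%:R
      * pairsum (size (primes_in D K)) (lam (size hs) D beta K) (lam (size hs) D beta K)
          (maskwt (fun p => i%:R / (p%:R - 1)) (primes_in D K)))) (Nof t0) (fun K => ltW (exp_gt0 _)).
have {h2} [|C2 C20 h2] := h2.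
  move=> h hhs; have [C hC] := sum_prime_estimate M0 uh hD ki i0 kD k2D b0 t01 t0t bW cb cA hhs.
  exists C; apply: (eventually_imp hC) => K; apply: le_trans.
  by rewrite -normrN ler_norm.
have [Cu Cu0 hu] := sieve_upper k0 kD b0 k2D.
have [Cl Cl0 hl] := sieve_lower k0 kD b0 ki i0.
have /andP[c0 c1] := density_bounds (@primes_in_prime 0 D).
set c := density _ in c0 c1 hu hl.
have w0 : 0 < (modulus D)%:R :> R by rewrite ltr0n modulus_gt0.
have D0 : 0 < D%:R :> R by apply: le_lt_trans k2D; rewrite mulr_ge0 ?sqr_ge0.
have l0 : 0 < 1 - 2 * (size hs)%:R ^+ 2 / D%:R :> R by rewrite subr_gt0 ltr_pdivrMr // mul1r.
have /andP[t0p t1] := t01.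
have I0 : 0 <= Icoef (size hs) beta.
  by rewrite !addr_ge0 ?mulr_ge0 ?invr_ge0 ?sqr_ge0.
have J0 : 0 < Jcoef i beta.
  rewrite ltr_pwDl ?ltr_pwDl ?divr_gt0 ?fact_gt0R //.
    by rewrite !mulr_ge0 ?invr_ge0.
  by rewrite !mulr_ge0 ?invr_ge0 ?sqr_ge0.
have kR : 0 < (size hs)%:R :> R by rewrite ltr0n.
have a0 : 0 < c ^+ size hs by rewrite exprn_gt0.
have [x0 fin] := leading_terms_contradiction kR l0 t0p a0 c0 w0 I0 Cl0 C20 Cu0
  (addr_ge0 (normr_ge0 C1) (normr_ge0 C3)) gap.
have := eventually_and (eventually_and (eventually_and h1 h3) (eventually_and h2 (ln_nat_unbounded x0)))
  (eventually_and (eventually_and (ln_nat_unbounded 1) (ln_nat_unbounded (Cl / (c * c ^+ size hs * Jcoef i beta))))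
   (eventually_and (square_small t01 H%:R 0) (ex_intro _ 1%N (fun K h => h)))).
case=> K /(_ K (leqnn K)) [[[{}h1 {}h3] [{}h2 Lx]] [[L1 LC] [NH K0]]].
have := hu K K0 L1; have := hl K K0 L1.
set L := ln K%:R in Lx L1 LC *; set N := Nof t0 K in h1 h2 h3 NH.
set ps := primes_in D K in h1 h2 *.
set Q1 := pairsum _ _ _ (maskwt (fun p => (size hs)%:R / p%:R) ps) in h1 *.
set Q2 := pairsum _ _ _ (maskwt (fun p => i%:R / (p%:R - 1)) ps) in h2 *.
have L0 : 0 < L by lra.
have N1 : 1 <= N by apply: Nof_ge => //; exact: ltW.
have N0 : 0 < N by lra.
rewrite (_ : (i + 2 = (size hs).+1)%N); last by rewrite ki addn2.
rewrite (_ : (i + 5 = (size hs + 2).+2)%N); last by rewrite ki addSn !addnS !addn0.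
rewrite (_ : (i + 4 = (size hs + 2).+1)%N); last by rewrite ki addSn !addnS !addn0.
rewrite (_ : (size hs + 3 = (size hs + 2).+1)%N); last by rewrite addnS.
rewrite !(exprS L (_.+1)) !(exprS L (_ + 2)) (exprS c) => low upp.
set Z := L ^+ (size hs + 2) in low upp.
have LZ : L <= Z by rewrite /Z addn2 exprS ler_peMr ?exprn_ege1 // ltW.
have Z0 : 0 < Z by lra.
(* The sign allows N + h to be replaced by N in the main term of the prime sum; it holds because L
   was taken beyond [Cl / (c * c ^+ size hs * Jcoef i beta)]. *)
have Q20 : 0 <= Q2.
  rewrite -(pmulr_rge0 _ L0); apply: le_trans low.
  rewrite subr_ge0 [leRHS](mulrA _ L (L * Z)).
  apply: ler_wpM2r; first exact: ltW (mulr_gt0 L0 Z0).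
  by move: LC; rewrite ler_pdivrMr ?mulr_gt0 // mulrC.
apply: (fin L Z Q1 Q2 Lx L1 LZ upp low).
rewrite -totient_modulus.
have NH' : H%:R <= N.
  by apply: le_trans NH; rewrite expr0 mulr1 ler_peMl // ler1n expn_gt0 K0.
(* [G] is log N + 1 >= log (2 N), a bound for log (n + h) when n <= N and h <= H <= N. *)
pose G := 2 / t0 * L + 1.
have G0 : 0 <= G by rewrite addr_ge0 // !mulr_ge0 ?invr_ge0 // ltW.
have lG n h : (n < (fl N).+1)%N -> h \in hs -> logprime (n + h) <= (prime (n + h))%:R * G.
  move=> nN hhs; rewrite /logprime; case: ifP => pn; last by rewrite mul0r.
  rewrite mul1r /G -ln_Nof -/N.
  have /andP[f1 _] := flP (ltW N0).
  apply: (le_trans (y := ln (2 * N))).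
    apply: ler_ln; first by rewrite ltr0n prime_gt0.
    have hHR : h%:R <= H%:R :> R by rewrite ler_nat hH.
    have nR : n%:R <= (fl N)%:R :> R by rewrite ler_nat.
    rewrite natrD; lra.
  rewrite lnM // addrC lerD2l.
  by have := @ln_sub1 2 ltac:(by []); lra.
have sw0 n : 0 <= sieveweight hs D beta K n by exact: sqr_ge0.
set S1 := \sum_(_ <= n < _ | _) _ in h1; set S3 := \sum_(_ <= n < _ | _) _ in h3.
have comb : \sum_(h <- hs) \sum_(M0 <= n < (fl N).+1 | (n %% modulus D == b)%N)
      logprime (n + h) * sieveweight hs D beta K n <= G / 2 * (S1 + S3).
  rewrite exchange_big /= /S1 /S3 -big_split /= mulr_sumr.
  rewrite big_nat_cond [leRHS]big_nat_cond; apply: ler_sum => n /andP[/andP[nM nN] _].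
  rewrite -[leLHS]mulr_suml -[X in _ <= _ * X]mulrDl [leRHS]mulrA; apply: ler_wpM2r => //.
  apply: (le_trans (y := \sum_(h <- hs) (prime (n + h))%:R * G)).
    by rewrite big_seq [leRHS]big_seq; apply: ler_sum => h hhs; exact: lG.
  rewrite -mulr_suml; apply: (le_trans (ler_wpM2r G0 (pw n nM))).
  by rewrite le_eqVlt; apply/orP; left; apply/eqP; ring.
have lowS : (size hs)%:R * (N / (totient (modulus D))%:R * Q2 - C2 * N) <=
   \sum_(h <- hs) \sum_(M0 <= n < (fl N).+1 | (n %% modulus D == b)%N)
      logprime (n + h) * sieveweight hs D beta K n.
  rewrite -sumr_const_seq big_seq [leRHS]big_seq; apply: ler_sum => h hhs.
  have := h2 h hhs; rewrite -/N.
  have : N / (totient (modulus D))%:R * Q2 <= (N + h%:R) / (totient (modulus D))%:R * Q2.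
    by rewrite ler_wpM2r // ler_wpM2r ?invr_ge0 // lerDl.
  lra.
have S1u : S1 + S3 <= N * (Q1 / (modulus D)%:R + (`|C1| + `|C3|)).
  have a1 : S1 - N / (modulus D)%:R * Q1 <= `|C1| * N.
    apply: (le_trans (ler_norm _)); apply: (le_trans h1); apply: ler_wpM2r; [exact: ltW|exact: ler_norm].
  have a3 : S3 <= `|C3| * N.
    apply: (le_trans (ler_norm _)); apply: (le_trans h3); apply: ler_wpM2r; [exact: ltW|exact: ler_norm].
  lra.
have G2 : 0 <= G / 2 by rewrite divr_ge0.
have := le_trans lowS (le_trans comb (ler_wpM2l G2 S1u)).
rewrite -(ler_pM2l N0) => fin2.
have e1 : N * ((size hs)%:R * (Q2 / (totient (modulus D))%:R - C2))
  = (size hs)%:R * (N / (totient (modulus D))%:R * Q2 - C2 * N) by ring.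
rewrite -(ler_pM2l N0) e1; move: fin2; rewrite (ler_pM2l N0) => /le_trans; apply.
by rewrite /G le_eqVlt; apply/orP; left; apply/eqP; ring.
Qed.

End Final.

(** * Admissible tuples and the final deduction *)

Section Tuples.

Lemma admissible_residue (hs zs : seq nat) : uniq zs -> {in zs, forall p, prime p} ->
  {in zs, forall p, exists r, {in hs, forall h, ~~ (p %| r + h)}} ->
  exists2 b, b < \prod_(p <- zs) p & {in hs, forall h, coprime (b + h) (\prod_(p <- zs) p)}.
Proof.
elim: zs => [|p zs IH] /=.
  by move=> _ _ _; exists 0; rewrite big_nil // => h _; exact: coprimen1.
move=> /andP[pzs uz] hp hr; rewrite big_cons.
have hp' : {in zs, forall p, prime p} by move=> q qs; apply: hp; rewrite inE qs orbT.
have [b bP cb] := IH uz hp' (fun q qs => hr q (@mem_behead _ (p :: zs) q qs)).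
have [r rP] := hr p (mem_head _ _); have pp := hp p (mem_head _ _).
set P := \prod_(q <- zs) q in bP cb *.
have P0 : 0 < P by exact: leq_ltn_trans bP.
have cpP : coprime p P.
  rewrite /P big_seq; elim/big_ind: _ => [|x y cx cy|q qzs]; first exact: coprimen1.
    by rewrite coprimeMr cx cy.
  rewrite prime_coprime // dvdn_prime2 ?(hp' q qzs) //.
  by apply: contra pzs => /eqP ->.
exists (chinese p P r b %% (p * P)); first by rewrite ltn_mod muln_gt0 prime_gt0.
move=> h hhs; rewrite -coprime_modl modnDml coprime_modl coprimeMr.
rewrite -[X in X && _]coprime_modl -[X in _ && X]coprime_modl.
rewrite -modnDml chinese_modl // modnDml -[X in _ && coprime X _]modnDml chinese_modr // modnDml.
rewrite !coprime_modl cb // andbT coprime_sym prime_coprime //; exact: rP.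
Qed.

(** The translate 11, 13, 17, 19, 23 consists of primes, which settles p <= 7. The primes 11 and 13
    take r = 1 and r = 2, and for p > 13 the values 1 + h <= 13 are too small to be multiples of
    p. *)
Lemma admissible_small p (hs : seq nat) : prime p -> {subset hs <= [:: 0; 2; 6; 8; 12]} ->
  exists r, {in hs, forall h, ~~ (p %| r + h)}.
Proof.
move=> pp sub.
have red r : all (fun h => ~~ (p %| r + h)) [:: 0; 2; 6; 8; 12] ->
    exists r, {in hs, forall h, ~~ (p %| r + h)}.
  by move=> /allP a; exists r => h /sub; exact: a.
case: (ltnP 13 p) => p13.
  apply: (red 1); apply/allP => h; rewrite !inE => hh; rewrite gtnNdvd //.
  by move: hh; do ![case/orP]; move/eqP => ->; apply: leq_trans p13.
case: p pp p13 red => [|[|[|[|[|[|[|[|[|[|[|[|[|[|p]]]]]]]]]]]]]] // pp _ red.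
all: try by apply: (red 11).
- by apply: (red 1).
- by apply: (red 2).
Qed.

Local Open Scope ring_scope.

Lemma liouville_prime p : prime p -> liouville p = -1.
Proof.
by move=> pp; rewrite /liouville RpowE /bigOmega primes_prime // big_seq1 logn_prime // eqxx expr1.
Qed.

Lemma liouville_cases n : liouville n = 1 \/ liouville n = -1.
Proof.
rewrite /liouville RpowE -signr_odd; case: (odd _); [right|left]; by rewrite ?expr1 ?expr0.
Qed.

(** Two primes n + x < n + y would give lambda(n + y) = 1 by the assumption for d = y - x, whereas
    lambda is -1 at a prime. The same assumption for d = H - h gives lambda(n + H) = 1 when n + h is
    prime. *)
Lemma prime_tuple_bound (hs : seq nat) H M0 : {in hs, forall h, (h < H)%N} -> {in hs, forall h, ~~ odd h} ->
  ~~ odd H -> uniq hs ->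
  (forall d, (0 < d <= H)%N -> ~~ odd d -> forall p, (M0 <= p)%N -> prime p -> liouville (p + d) = 1) ->
  forall n, (M0 <= n)%N -> \sum_(h <- hs) (prime (n + h))%:R <= (1 + liouville (n + H)) / 2 :> R.
Proof.
move=> hH ev evH uh good n Mn.
case: (classic (exists2 h, h \in hs & prime (n + h))) => [[h hhs ph]|none]; last first.
  rewrite big_seq big1 => [|h hhs].
    by case: (liouville_cases (n + H)) => ->; lra.
  by case: (boolP (prime (n + h))) => // ph; case: none; exists h.
have lH : liouville (n + H) = 1.
  have hh := hH h hhs.
  rewrite (_ : n + H = n + h + (H - h))%N; last by rewrite -addnA subnKC // ltnW.
  apply: good => //; [by rewrite subn_gt0 hh leq_subr|by rewrite oddB ?(ltnW hh) // (negPf evH) (negPf (ev h hhs))|].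
  exact: leq_trans (leq_addr _ _).
have clash x y : x \in hs -> y \in hs -> prime (n + x) -> prime (n + y) -> (x < y)%N -> False.
  move=> xs ys px py xy.
  have : liouville (n + y) = 1.
    rewrite (_ : n + y = n + x + (y - x))%N; last by rewrite -addnA subnKC // ltnW.
    apply: good => //.
    - by rewrite subn_gt0 xy (leq_trans (leq_subr _ _)) // ltnW // hH.
    - by rewrite oddB ?(ltnW xy) // (negPf (ev x xs)) (negPf (ev y ys)).
    - exact: leq_trans (leq_addr _ _).
  by rewrite liouville_prime //; lra.
rewrite lH (bigD1_seq h) //= big_seq_cond big1 => [|x /andP[xs xh]].
  by rewrite ph addr0 -[leLHS]/(1 : R); lra.
case: (boolP (prime (n + x))) => // px; exfalso.
by move: xh; rewrite neq_ltn => /orP[]; [apply: clash|apply: clash].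
Qed.

(** The gap survives the factor 1 - 2 k ^ 2 / D as soon as D exceeds 2 k ^ 2 P / (P - I). *)
Lemma gap_modulus (k D1 : nat) (I P : R) : I < P -> 0 < P -> exists D : nat,
  [/\ (D1 <= D)%N, 2 * k%:R ^+ 2 < D%:R :> R & I < P * (1 - 2 * k%:R ^+ 2 / D%:R)].
Proof.
move=> IP P0; set a : R := 2 * k%:R ^+ 2; have a0 : 0 <= a by rewrite mulr_ge0 ?sqr_ge0.
have x0 : 0 <= a * P / (P - I) by rewrite divr_ge0 ?mulr_ge0 ?subr_ge0 // ltW.
have /andP[_ f1] := flP x0; have /andP[_ f2] := flP a0.
exists (D1 + (fl (a * P / (P - I))).+1 + (fl a).+1)%N; set D : R := _%:R.
have DE : D = D1%:R + ((fl (a * P / (P - I)))%:R + 1) + ((fl a)%:R + 1).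
  by rewrite /D !natrD !natr1.
have d0 : 0 <= D1%:R :> R by [].
have d1 : 0 <= (fl (a * P / (P - I)))%:R :> R by [].
have d2 : 0 <= (fl a)%:R :> R by [].
split; first by rewrite -addnA leq_addr.
  by rewrite DE; lra.
have D0 : 0 < D by rewrite DE; lra.
have : a * P / (P - I) < D by rewrite DE; lra.
rewrite ltr_pdivrMr ?subr_gt0 // => h.
have : a * P / D < P - I by rewrite ltr_pdivrMr // [ltRHS]mulrC.
by rewrite mulrBr mulr1 (mulrC P) mulrAC; lra.
Qed.

Lemma liouville_shift_infinite (hs : seq nat) (H i : nat) (beta t0 theta : R) :
  uniq hs -> {subset hs <= [:: 0; 2; 6; 8; 12]} -> {in hs, forall h, (h < H)%N} -> ~~ odd H ->
  size hs = i.+1 -> (0 < i)%N -> 0 <= beta -> 0 < t0 < 1 -> t0 < theta ->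
  Icoef (size hs) beta < (size hs)%:R * Jcoef i beta * t0 ->
  condA theta -> condB theta ->
  exists d : nat, [/\ (0 < d)%N, ~~ odd d, (d <= H)%N &
    forall M : nat, exists p : nat, [/\ (M <= p)%N, prime p & liouville (p + d) = -1]].
Proof.
move=> uh sub hH evH ki i0 b0 t01 t0t gap cA cB.
apply: NNPP => noex.
(* Only finitely many d are concerned, so one threshold serves them all. *)
have [M0 hM] : exists M0, forall d, (0 < d <= H)%N -> ~~ odd d -> forall p, (M0 <= p)%N -> prime p ->
    liouville (p + d) = 1.
  elim: {-2}H (leqnn H) => [|n IH] nH.
    by exists 0%N => d /andP[d0]; rewrite leqNgt d0.
  have [M1 h1] := IH (ltnW nH).
  have [M2 h2] : exists M2, ~~ odd n.+1 -> forall p, (M2 <= p)%N -> prime p -> liouville (p + n.+1) = 1.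
    apply: NNPP => no2; apply: noex; exists n.+1; case: (boolP (odd n.+1)) => od.
      by case: no2; exists 0%N; rewrite od.
    split=> // M; apply: NNPP => no3; apply: no2; exists M => _ p Mp pp.
    case: (liouville_cases (p + n.+1)) => // l; case: no3; by exists p.
  exists (maxn M1 M2) => d /andP[d0]; rewrite leq_eqVlt => /orP[/eqP ->|dn] ed p;
    rewrite geq_max => /andP[p1 p2] pp; first exact: h2.
  by apply: h1 => //; rewrite d0 -ltnS.
have k0 : 0 < (size hs)%:R :> R by rewrite ltr0n ki.
have /andP[t0p _] := t01.
have J0 : 0 < Jcoef i beta.
  rewrite ltr_pwDl ?ltr_pwDl ?divr_gt0 ?fact_gt0R //.
    by rewrite !mulr_ge0 ?invr_ge0.
  by rewrite !mulr_ge0 ?invr_ge0 ?sqr_ge0.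
have P0 : 0 < (size hs)%:R * Jcoef i beta * t0 by rewrite !mulr_gt0.
(* The cut-off must reach the largest possible shift, 12, and 2 k. *)
have [D [D1 D2 D3]] := gap_modulus (size hs) (12 + 2 * size hs) gap P0.
have [b bW cb] := admissible_residue (primes_in_uniq 0 D) (@primes_in_prime 0 D)
  (fun p ps => admissible_small (primes_in_prime ps) sub).
have ev : {in hs, forall h, ~~ odd h}.
  by move=> h /sub; rewrite !inE; do ![case/orP]; move/eqP => ->.
have hD : {in hs, forall h, (h <= D)%N}.
  move=> h /sub hh; apply: leq_trans D1; apply: leq_trans (leq_addr _ _).
  by move: hh; rewrite !inE; do ![case/orP]; move/eqP => ->.
(* The successor makes the threshold positive, since the sums of lambda start at 1. *)
have good d : (0 < d <= H)%N -> ~~ odd d -> forall p, (M0.+1 <= p)%N -> prime p -> liouville (p + d) = 1.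
  by move=> dH ed p Mp; apply: hM => //; exact: ltnW.
apply: (@sieve_false hs D beta t0 theta M0.+1 H b i) => //.
- by move=> h /hH /ltnW.
- by apply: leq_trans D1; exact: leq_addl.
- exact: prime_tuple_bound.
Qed.

Lemma IZR_nat n : IZR (Z.of_nat n) = n%:R.
Proof. by rewrite -INR_IZR_INZ INRE. Qed.

Lemma fact_values : (((2`!)%:R = 2 :> R) * ((3`!)%:R = 6 :> R) * ((4`!)%:R = 24 :> R)
  * ((5`!)%:R = 120 :> R) * ((6`!)%:R = 720 :> R) * ((7`!)%:R = 7 * 720 :> R)%R
  * ((8`!)%:R = 8 * (7 * 720) :> R)%R)%type.
Proof.
have f2 : (2`!)%:R = 2 :> R by [].
have f3 : (3`!)%:R = 6 :> R by rewrite (factSR 2) f2; lra.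
have f4 : (4`!)%:R = 24 :> R by rewrite (factSR 3) f3; lra.
have f5 : (5`!)%:R = 120 :> R by rewrite (factSR 4) f4; lra.
have f6 : (6`!)%:R = 720 :> R by rewrite (factSR 5) f5; lra.
have f7 : (7`!)%:R = 7 * 720 :> R by rewrite (factSR 6) f6; lra.
have f8 : (8`!)%:R = 8 * (7 * 720) :> R by rewrite (factSR 7) f7; lra.
by [].
Qed.

End Tuples.

Theorem theorem7 (theta0 : R) (D : nat) (theta : R) :
  (theta0 = Rdiv (IZR 729) (IZR 1000) /\ D = 2 \/
   theta0 = Rdiv (IZR 616) (IZR 1000) /\ D = 6 \/
   theta0 = Rdiv (IZR 554) (IZR 1000) /\ D = 8 \/
   theta0 = Rdiv (IZR 515) (IZR 1000) /\ D = 12) ->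
  Rlt theta0 theta ->
  condA theta -> condB theta ->
  exists d : nat, [/\ 0 < d, ~~ odd d, d <= D + 2 &
    forall M : nat, exists p : nat,
      [/\ M <= p, prime p & liouville (p + d) = Ropp (IZR 1)]].
Proof.
move=> cases /RltP t0t cA cB.
have f (m n : nat) : Rdiv (IZR (Z.of_nat m)) (IZR (Z.of_nat n)) = (m%:R / n%:R)%R.
  by rewrite RdivE !IZR_nat.
case: cases => [[e ->]|[[e ->]|[[e ->]|[e ->]]]].
- apply: (@liouville_shift_infinite [:: 0; 2] 4 1 2%:R theta0 theta) => //.
  + by apply/allP.
  + by apply/allP.
  + by rewrite e (f 729 1000); lra.
  + by rewrite e (f 729 1000) /Icoef /Jcoef [size _]/= !fact_values; lra.
- apply: (@liouville_shift_infinite [:: 0; 2; 6] 8 2 4%:R theta0 theta) => //.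
  + by apply/allP.
  + by apply/allP.
  + by rewrite e (f 616 1000); lra.
  + by rewrite e (f 616 1000) /Icoef /Jcoef [size _]/= !fact_values; lra.
- apply: (@liouville_shift_infinite [:: 0; 2; 6; 8] 10 3 6%:R theta0 theta) => //.
  + by apply/allP.
  + by apply/allP.
  + by rewrite e (f 554 1000); lra.
  + by rewrite e (f 554 1000) /Icoef /Jcoef [size _]/= !fact_values; lra.
- apply: (@liouville_shift_infinite [:: 0; 2; 6; 8; 12] 14 4 9%:R theta0 theta) => //.
  + by apply/allP.
  + by rewrite e (f 515 1000); lra.
  + by rewrite e (f 515 1000) /Icoef /Jcoef [size _]/= !fact_values; lra.
Qed.
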